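(* Let $0<q<1$, let $(\mathcal{A}(S^4_q),\mathcal{H},D)$ be as described in the context, and let $J$ be the antilinear isometry on $\mathcal{H}$ given by $$J|l,m_1,m_2;j\rangle_\pm=i^{2l+1}(-1)^{j+m_1}|l,-m_1,-m_2;j\rangle_\pm.$$ Then $$[a,JbJ]\in\mathrm{OP}^{-\infty},\qquad [[D,a],JbJ]\in\mathrm{OP}^{-\infty},\qquad\forall\;a,b\in\mathcal{A}(S^4_q).$$
   Context: Notation: $\mathbb{N}=\{0,1,2,\dots\}$, $[z]:=(q^z-q^{-z})/(q-q^{-1})$. The algebra: $\mathcal{A}(S^4_q)$ is the unital $*$-algebra generated by $x_0=x_0^*$, $x_1,x_2,x_1^*,x_2^*$ with relations $x_ix_j=q^2x_jx_i$ for $0\le i<j\le 2$; $x_i^*x_j=q^2x_jx_i^*$ for $i\neq j$; $[x_1^*,x_1]=(1-q^4)x_0^2$; $[x_2^*,x_2]=x_1^*x_1-q^4x_1x_1^*$; $x_0^2+x_1x_1^*+x_2x_2^*=1$. Dirac operator: $\mathcal{H}=\mathcal{H}_+\oplus\mathcal{H}_-$ and $D|l,m_1,m_2;j\rangle_\pm=(l+\frac32)|l,m_1,m_2;j\rangle_\mp$, with bases and representation of $\mathcal{A}(S^4_q)$ given below. Smoothing operators: with $\delta(T)=[|D|,T]$ the unbounded derivation on $\mathcal{B}(\mathcal{H})$, put $\mathrm{OP}^0:=\bigcap_{j\in\mathbb{N}}\mathrm{dom}\,\delta^j$ and $\mathrm{OP}^{-\infty}:=\{T\in\mathrm{OP}^0\mid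 |D|^kT\in\mathrm{OP}^0\ \forall k\in\mathbb{N}\}$. Chiral spinor representations: $\mathcal{H}_\pm$ has orthonormal basis $|l,m_1,m_2;j\rangle_\pm$ with $l\in\mathbb{N}+\frac12$, $j=\frac12,\frac32,\ldots,l$, $j-|m_1|\in\mathbb{N}$, $l+\frac12-j-|m_2|\in\mathbb{N}$. Kets with inadmissible labels are $0$. In each coefficient with indices $(l,j,m_2)$, $\epsilon=\frac12(-1)^{l+\frac12-j-m_2}$ is computed from those same indices. The bounded $*$-representation on $\mathcal{H}_\pm$ is \begin{align*} x_0|l,m_1,m_2;j\rangle_\pm &=A^+_{j,m_1}C^+_{l,j,m_2}|l+1,m_1,m_2;j+1\rangle_\pm \mp A^+_{j,m_1}C^0_{l,j,m_2}|l,m_1,m_2;j+1\rangle_\pm +A^+_{j,m_1}C^-_{l,j,m_2}|l-1,m_1,m_2;j+1\rangle_\pm \\ &\quad +A^0_{j,m_1}H^+_{l,j,m_2}|l+1,m_1,m_2;j\rangle_\pm \pm A^0_{j,m_1}H^0_{l,j,m_2}|l,m_1,m_2;j\rangle_\pm +A^0_{j,m_1}H^+_{l-1,j,m_2}|l-1,m_1,m_2;j\rangle_\pm \\ &\quad +A^+_{j-1,m_1}C^-_{l+1,j-1,m_2}|l+1,m_1,m_2;j-1\rangle_\pm \mp A^+_{j-1,m_1}C^0_{l,j-1,m_2}|l,m_1,m_2;j-1\rangle_\pm +A^+_{j-1,m_1}C^+_{l-1,j-1,m_2}|l-1,m_1,m_2;j-1\rangle_\pm,\\ x_1|l,m_1,m_2;j\rangle_\pm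 &=B^+_{j,m_1}C^+_{l,j,m_2}|l+1,m_1+1,m_2;j+1\rangle_\pm \mp B^+_{j,m_1}C^0_{l,j,m_2}|l,m_1+1,m_2;j+1\rangle_\pm +B^+_{j,m_1}C^-_{l,j,m_2}|l-1,m_1+1,m_2;j+1\rangle_\pm \\ &\quad +B^0_{j,m_1}H^+_{l,j,m_2}|l+1,m_1+1,m_2;j\rangle_\pm \pm B^0_{j,m_1}H^0_{l,j,m_2}|l,m_1+1,m_2;j\rangle_\pm +B^0_{j,m_1}H^+_{l-1,j,m_2}|l-1,m_1+1,m_2;j\rangle_\pm \\ &\quad +B^-_{j,m_1}C^-_{l+1,j-1,m_2}|l+1,m_1+1,m_2;j-1\rangle_\pm \mp B^-_{j,m_1}C^0_{l,j-1,m_2}|l,m_1+1,m_2;j-1\rangle_\pm +B^-_{j,m_1}C^+_{l-1,j-1,m_2}|l-1,m_1+1,m_2;j-1\rangle_\pm,\\ x_2|l,m_1,m_2;j\rangle_\pm &=D^+_{l,j,m_2}|l+1,m_1,m_2+1;j\rangle_\pm \pm D^0_{l,j,m_2}|l,m_1,m_2+1;j\rangle_\pm +D^-_{l,j,m_2}|l-1,m_1,m_2+1;j\rangle_\pm, \end{align*} with \begin{align*} A^+_{j,m_1} &=q^{m_1-1}\frac{\sqrt{[j+m_1+1][j-m_1+1]}}{[2j+2]},\qquad A^0_{j,m_1} =q^{-2}\frac{q^{j+m_1+1}[2][j-m_1]-[2j]}{[2j][2j+2]},\\ B^+_{j,m_1} &=q^{-j+m_1-1/2}\frac{\sqrt{[j+m_1+1][j+m_1+2]}}{[2j+2]},\qquad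 B^0_{j,m_1} =(1+q^2)q^{m_1-1/2}\frac{\sqrt{[j-m_1][j+m_1+1]}}{[2j][2j+2]},\\ B^-_{j,m_1} &=-q^{j+m_1+1/2}\frac{\sqrt{[j-m_1][j-m_1-1]}}{[2j]},\\ C^+_{l,j,m_2} &=-q^{m_2-1-\epsilon}\frac{\sqrt{[l+j+m_2+3+\epsilon][l+j-m_2+3-\epsilon]}}{[2l+4]},\\ C^0_{l,j,m_2} &=[4\epsilon]\,q^{2\epsilon l+m_2-1+3\epsilon}\frac{\sqrt{[l+\frac12+j-2\epsilon m_2+2][l+\frac12-j-2\epsilon m_2]}}{[2l+2][2l+4]},\\ C^-_{l,j,m_2} &=-q^{m_2-1+\epsilon}\frac{\sqrt{[l-j+m_2-\epsilon][l-j-m_2+\epsilon]}}{[2l+2]},\\ H^+_{l,j,m_2} &=q^{m_2-1+\epsilon(2j+1)}\frac{\sqrt{[l+2\epsilon j-m_2+2+\epsilon][l-2\epsilon j+m_2+2-\epsilon]}}{[2l+4]},\\ H^0_{l,j,m_2} &=\frac{[l-\epsilon(2j+1)-m_2+1][l-\epsilon(2j+1)+m_2+2]-q^{-2}[l+\epsilon(2j+1)-m_2+2][l+\epsilon(2j+1)+m_2+1]}{[2l+2][2l+4]},\\ D^+_{l,j,m_2} &=q^{-l+m_2-3/2}\frac{\sqrt{[l+j+m_2+3+\epsilon][l-j+m_2+2-\epsilon]}}{[2l+4]},\\ D^0_{l,j,m_2} &=[2]q^{m_2+1/2}\frac{\sqrt{[l-2\epsilon j-m_2+1-\epsilon][l-2\epsilon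 j+m_2+2-\epsilon]}}{[2l+2][2l+4]},\\ D^-_{l,j,m_2} &=-q^{l+m_2+3/2}\frac{\sqrt{[l-j-m_2+\epsilon][l+j-m_2+1-\epsilon]}}{[2l+2]}. \end{align*} *)

(* Defs.v *)
From HB Require Import structures.
From mathcomp Require Import all_boot all_order all_algebra.
From mathcomp Require Import complex.
From mathcomp Require Import all_classical all_reals all_analysis.

Set Implicit Arguments.
Unset Strict Implicit.
Unset Printing Implicit Defensive.

Import Order.TTheory GRing.Theory Num.Theory.
Import numFieldNormedType.Exports.

Local Open Scope classical_set_scope.
Local Open Scope ring_scope.
Local Open Scope quotient_scope.

(** The presented algebra is the set of all *-polynomial expressions in three
    generators, modulo the least congruence that contains the axioms of unital
    complex *-algebras and the defining relations. *)

Inductive sphere_term (R : realType) : Type :=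
| TGen of 'I_3
| TZero
| TOne
| TOpp of sphere_term R
| TAdd of sphere_term R & sphere_term R
| TMul of sphere_term R & sphere_term R
| TScale of R[i] & sphere_term R
| TStar of sphere_term R.

Arguments TGen {R} i.
Arguments TZero {R}.
Arguments TOne {R}.

HB.instance Definition _ (R : realType) := gen_eqMixin (sphere_term R).
HB.instance Definition _ (R : realType) := gen_choiceMixin (sphere_term R).

Declare Scope sphere_scope.
Delimit Scope sphere_scope with S.
Local Notation "0" := TZero : sphere_scope.
Local Notation "1" := TOne : sphere_scope.
Local Notation "- s" := (TOpp s) : sphere_scope.
Local Notation "s + t" := (TAdd s t) : sphere_scope.
Local Notation "s - t" := (TAdd s (TOpp t)) : sphere_scope.
Local Notation "s * t" := (TMul s t) : sphere_scope.
Local Notation "c *: t" := (TScale c t) : sphere_scope.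
Local Notation "t ^*" := (TStar t) : sphere_scope.

Section SphereCongruence.
Variables (R : realType) (q : R).

Local Notation X i := (@TGen R (inord i)).
Local Notation Q n := ((q ^+ n)%:C%C).

Inductive sphere_eq : sphere_term R -> sphere_term R -> Prop :=
| sphere_refl s : sphere_eq s s
| sphere_sym s t : sphere_eq s t -> sphere_eq t s
| sphere_trans s t u : sphere_eq s t -> sphere_eq t u -> sphere_eq s u
| sphere_opp s s' : sphere_eq s s' -> sphere_eq (- s)%S (- s')%S
| sphere_add s s' t t' :
    sphere_eq s s' -> sphere_eq t t' -> sphere_eq (s + t)%S (s' + t')%S
| sphere_mul s s' t t' :
    sphere_eq s s' -> sphere_eq t t' -> sphere_eq (s * t)%S (s' * t')%S
| sphere_scale c s s' : sphere_eq s s' -> sphere_eq (c *: s)%S (c *: s')%S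
| sphere_star s s' : sphere_eq s s' -> sphere_eq (s^*)%S (s'^*)%S
| sphere_addA s t u : sphere_eq (s + (t + u))%S (s + t + u)%S
| sphere_addC s t : sphere_eq (s + t)%S (t + s)%S
| sphere_add0 s : sphere_eq (0 + s)%S s
| sphere_addN s : sphere_eq (- s + s)%S 0%S
| sphere_mulA s t u : sphere_eq (s * (t * u))%S (s * t * u)%S
| sphere_mul1l s : sphere_eq (1 * s)%S s
| sphere_mul1r s : sphere_eq (s * 1)%S s
| sphere_mulDl s t u : sphere_eq ((s + t) * u)%S (s * u + t * u)%S
| sphere_mulDr s t u : sphere_eq (s * (t + u))%S (s * t + s * u)%S
| sphere_scaleA c d s : sphere_eq (c *: (d *: s))%S ((c * d)%R *: s)%S
| sphere_scale1 s : sphere_eq (1%R *: s)%S s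
| sphere_scaleDr c s t : sphere_eq (c *: (s + t))%S (c *: s + c *: t)%S
| sphere_scaleDl c d s : sphere_eq ((c + d)%R *: s)%S (c *: s + d *: s)%S
| sphere_scaleAl c s t : sphere_eq (c *: (s * t))%S ((c *: s) * t)%S
| sphere_scaleAr c s t : sphere_eq (c *: (s * t))%S (s * (c *: t))%S
| sphere_starK s : sphere_eq (s^*^*)%S s
| sphere_starD s t : sphere_eq ((s + t)^*)%S (s^* + t^*)%S
| sphere_starM s t : sphere_eq ((s * t)^*)%S (t^* * s^*)%S
| sphere_starZ c s : sphere_eq ((c *: s)^*)%S ((c^*)%C *: s^*)%S
| sphere_x0_sa : sphere_eq ((X 0)^*)%S (X 0)
| sphere_xx (i j : 'I_3) : (i < j)%N ->
    sphere_eq (TGen i * TGen j)%S (Q 2 *: (TGen j * TGen i))%S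
| sphere_xsx (i j : 'I_3) : i != j ->
    sphere_eq ((TGen i)^* * TGen j)%S (Q 2 *: (TGen j * (TGen i)^*))%S
| sphere_comm1 :
    sphere_eq ((X 1)^* * X 1 - X 1 * (X 1)^*)%S
              ((1 - Q 4)%R *: (X 0 * X 0))%S
| sphere_comm2 :
    sphere_eq ((X 2)^* * X 2 - X 2 * (X 2)^*)%S
              ((X 1)^* * X 1 - Q 4 *: (X 1 * (X 1)^*))%S
| sphere_radius :
    sphere_eq (X 0 * X 0 + X 1 * (X 1)^* + X 2 * (X 2)^*)%S 1%S.

Definition sphere_eqb (s t : sphere_term R) : bool := `[< sphere_eq s t >].

Lemma sphere_eqb_refl : reflexive sphere_eqb.
Proof. by move=> s; apply/asboolP; exact: sphere_refl. Qed.

Lemma sphere_eqb_sym : symmetric sphere_eqb.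
Proof. by move=> s t; apply/asboolP/asboolP; exact: sphere_sym. Qed.

Lemma sphere_eqb_trans : transitive sphere_eqb.
Proof.
move=> t s u /asboolP st /asboolP tu; apply/asboolP.
exact: sphere_trans st tu.
Qed.

Canonical sphere_equiv :=
  EquivRel sphere_eqb sphere_eqb_refl sphere_eqb_sym sphere_eqb_trans.

Definition sphere := {eq_quot sphere_equiv}.

HB.instance Definition _ := Choice.on sphere.

Definition sphere_class (s : sphere_term R) : sphere := \pi_sphere s.

Lemma sphere_classP s t : sphere_class s = sphere_class t <-> sphere_eq s t.
Proof.
split=> [/eqmodP/asboolP //|st].
by apply/eqmodP/asboolP.
Qed.

Lemma sphere_reprK (a : sphere) : sphere_class (repr a) = a.
Proof. exact: reprK. Qed.

Lemma sphere_repr_class s : sphere_eq (repr (sphere_class s)) s.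
Proof. by apply/sphere_classP; rewrite sphere_reprK. Qed.

Definition sphere_zero := sphere_class TZero.
Definition sphere_one := sphere_class TOne.
Definition sphere_oppa (a : sphere) := sphere_class (- repr a)%S.
Definition sphere_adda (a b : sphere) := sphere_class (repr a + repr b)%S.
Definition sphere_mula (a b : sphere) := sphere_class (repr a * repr b)%S.
Definition sphere_scalea (c : R[i]) (a : sphere) := sphere_class (c *: repr a)%S.
Definition sphere_adj (a : sphere) := sphere_class ((repr a)^*)%S.

Lemma sphere_oppE s : sphere_oppa (sphere_class s) = sphere_class (- s)%S.
Proof. apply/sphere_classP/sphere_opp/sphere_repr_class. Qed.

Lemma sphere_addE s t :
  sphere_adda (sphere_class s) (sphere_class t) = sphere_class (s + t)%S.
Proof. apply/sphere_classP/sphere_add; exact: sphere_repr_class. Qed.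

Lemma sphere_mulE s t :
  sphere_mula (sphere_class s) (sphere_class t) = sphere_class (s * t)%S.
Proof. apply/sphere_classP/sphere_mul; exact: sphere_repr_class. Qed.

Lemma sphere_scaleE c s :
  sphere_scalea c (sphere_class s) = sphere_class (c *: s)%S.
Proof. apply/sphere_classP/sphere_scale/sphere_repr_class. Qed.

Lemma sphere_starE s : sphere_adj (sphere_class s) = sphere_class (s^*)%S.
Proof. apply/sphere_classP/sphere_star/sphere_repr_class. Qed.

Let classE :=
  (sphere_oppE, sphere_addE, sphere_mulE, sphere_scaleE, sphere_starE).

Lemma sphere_ind (P : sphere -> Prop) :
  (forall s, P (sphere_class s)) -> forall a, P a.
Proof. by move=> Ps a; rewrite -(sphere_reprK a). Qed.

Let alg_addA : associative sphere_adda.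
Proof.
elim/sphere_ind=> s; elim/sphere_ind=> t; elim/sphere_ind=> u.
by rewrite !classE; apply/sphere_classP/sphere_addA.
Qed.

Let alg_addC : commutative sphere_adda.
Proof.
elim/sphere_ind=> s; elim/sphere_ind=> t.
by rewrite !classE; apply/sphere_classP/sphere_addC.
Qed.

Let alg_add0 : left_id sphere_zero sphere_adda.
Proof.
by elim/sphere_ind=> s; rewrite !classE; apply/sphere_classP/sphere_add0.
Qed.

Let alg_addN : left_inverse sphere_zero sphere_oppa sphere_adda.
Proof.
by elim/sphere_ind=> s; rewrite !classE; apply/sphere_classP/sphere_addN.
Qed.

HB.instance Definition _ := GRing.isZmodule.Build sphere alg_addA alg_addC alg_add0
  alg_addN.

Lemma sphere_class_add s t :
  sphere_class s + sphere_class t = sphere_class (s + t)%S.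
Proof. exact: sphere_addE. Qed.

Let alg_mulA : associative sphere_mula.
Proof.
elim/sphere_ind=> s; elim/sphere_ind=> t; elim/sphere_ind=> u.
by rewrite !classE; apply/sphere_classP/sphere_mulA.
Qed.

Let alg_mul1l : left_id sphere_one sphere_mula.
Proof.
by elim/sphere_ind=> s; rewrite !classE; apply/sphere_classP/sphere_mul1l.
Qed.

Let alg_mul1r : right_id sphere_one sphere_mula.
Proof.
by elim/sphere_ind=> s; rewrite !classE; apply/sphere_classP/sphere_mul1r.
Qed.

Let alg_mulDl : left_distributive sphere_mula +%R.
Proof.
elim/sphere_ind=> s; elim/sphere_ind=> t; elim/sphere_ind=> u.
rewrite [in LHS]sphere_class_add !sphere_mulE sphere_class_add.
exact/sphere_classP/sphere_mulDl.
Qed.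

Let alg_mulDr : right_distributive sphere_mula +%R.
Proof.
elim/sphere_ind=> s; elim/sphere_ind=> t; elim/sphere_ind=> u.
rewrite [in LHS]sphere_class_add !sphere_mulE sphere_class_add.
exact/sphere_classP/sphere_mulDr.
Qed.

(** The algebra is nonzero: it has the character x_0, x_1 |-> 0, x_2 |-> 1. *)
Fixpoint sphere_char (s : sphere_term R) : R[i] :=
  match s with
  | TGen i => (i == 2%N :> nat)%:R
  | TZero => 0
  | TOne => 1
  | TOpp s => - sphere_char s
  | TAdd s t => sphere_char s + sphere_char t
  | TMul s t => sphere_char s * sphere_char t
  | TScale c s => c * sphere_char s
  | TStar s => ((sphere_char s)^*)%C
  end.

Lemma sphere_charP s t : sphere_eq s t -> sphere_char s = sphere_char t.
Proof.
elim=> //=.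
- by move=> ? ? ? _ -> _ ->.
- by move=> ? ? _ ->.
- by move=> ? ? ? ? _ -> _ ->.
- by move=> ? ? ? ? _ -> _ ->.
- by move=> ? ? ? _ ->.
- by move=> ? ? _ ->.
- by move=> *; rewrite addrA.
- by move=> *; rewrite addrC.
- by move=> *; rewrite add0r.
- by move=> *; rewrite addNr.
- by move=> *; rewrite mulrA.
- by move=> *; rewrite mul1r.
- by move=> *; rewrite mulr1.
- by move=> *; rewrite mulrDl.
- by move=> *; rewrite mulrDr.
- by move=> *; rewrite mulrA.
- by move=> *; rewrite mul1r.
- by move=> *; rewrite mulrDr.
- by move=> *; rewrite mulrDl.
- by move=> *; rewrite mulrA.
- by move=> *; rewrite mulrCA.
- by move=> *; rewrite conjcK.
- by move=> *; rewrite rmorphD.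
- by move=> *; rewrite rmorphM mulrC.
- by move=> *; rewrite rmorphM.
- by rewrite inordK// rmorph0.
- move=> i j ij.
  have /negPf -> : (i : nat) != 2%N.
    by rewrite neq_ltn (leq_trans ij) // -ltnS.
  by rewrite !mul0r !mulr0.
- move=> i j ij; rewrite conjc_nat.
  have [i2|] := eqVneq (i : nat) 2%N; last by rewrite !(mul0r, mulr0).
  have [j2|] := eqVneq (j : nat) 2%N; last by rewrite !(mul0r, mulr0).
  by case/eqP: ij; apply/val_inj; rewrite /= i2 j2.
- by rewrite !inordK// !(mulr0, mul0r) subrr.
- by rewrite !inordK// conjc_nat !(mulr0, mul0r) !subrr.
- by rewrite !inordK //= rmorph1 !mul0r mul1r !add0r oppr0.
Qed.

Let one_neq0 : sphere_one != 0 :> sphere.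
Proof.
apply/eqP => /sphere_classP /sphere_charP /= /eqP.
by rewrite oner_eq0.
Qed.

HB.instance Definition _ :=
  GRing.Zmodule_isNzRing.Build sphere alg_mulA alg_mul1l
  alg_mul1r alg_mulDl alg_mulDr one_neq0.

Lemma sphere_class_mul s t :
  sphere_class s * sphere_class t = sphere_class (s * t)%S.
Proof. exact: sphere_mulE. Qed.

Let alg_scaleA (c d : R[i]) (a : sphere) :
  sphere_scalea c (sphere_scalea d a) = sphere_scalea (c * d) a.
Proof.
elim/sphere_ind: a => s; rewrite !classE.
exact/sphere_classP/sphere_scaleA.
Qed.

Let alg_scale1 : left_id 1 sphere_scalea.
Proof.
by elim/sphere_ind=> s; rewrite !classE; apply/sphere_classP/sphere_scale1.
Qed.

Let alg_scaleDr : right_distributive sphere_scalea +%R.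
Proof.
move=> c; elim/sphere_ind=> s; elim/sphere_ind=> t.
rewrite [in LHS]sphere_class_add !sphere_scaleE sphere_class_add.
exact/sphere_classP/sphere_scaleDr.
Qed.

Let alg_scaleDl (a : sphere) : {morph sphere_scalea^~ a : c d / c + d >-> c + d}.
Proof.
move=> c d; elim/sphere_ind: a => s.
rewrite !classE sphere_class_add.
exact/sphere_classP/sphere_scaleDl.
Qed.

HB.instance Definition _ := GRing.Zmodule_isLmodule.Build R[i] sphere
  alg_scaleA alg_scale1 alg_scaleDr alg_scaleDl.

Lemma sphere_class_scale c s :
  c *: sphere_class s = sphere_class (c *: s)%S.
Proof. exact: sphere_scaleE. Qed.

Let alg_scaleAl (c : R[i]) (a b : sphere) : c *: (a * b) = (c *: a) * b.
Proof.
elim/sphere_ind: a => s; elim/sphere_ind: b => t.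
rewrite [in LHS]sphere_class_mul !sphere_class_scale sphere_class_mul.
exact/sphere_classP/sphere_scaleAl.
Qed.

HB.instance Definition _ := GRing.Lmodule_isLalgebra.Build R[i] sphere alg_scaleAl.

Let alg_scaleAr (c : R[i]) (a b : sphere) : c *: (a * b) = a * (c *: b).
Proof.
elim/sphere_ind: a => s; elim/sphere_ind: b => t.
rewrite [in LHS]sphere_class_mul !sphere_class_scale sphere_class_mul.
exact/sphere_classP/sphere_scaleAr.
Qed.

HB.instance Definition _ := GRing.Lalgebra_isAlgebra.Build R[i] sphere alg_scaleAr.

Definition sphere_x (i : nat) : sphere := sphere_class (X i).

End SphereCongruence.

Section Operators.
Variables (R : realType) (H : completeNormedModType R[i]).
Variable ip : {dot H for (@Num.conj R[i])}.

(** [ip] is linear in its first argument; with the completeness of [H], this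
    makes [H] a Hilbert space. *)
Definition hilbert_norm : Prop := forall v : H, `|v| ^+ 2 = ip v v.

Definition bounded_operator (T : H -> H) : Prop :=
  linear T /\ exists M : R[i], forall v, `|T v| <= M * `|v|.

Definition commutator (S T : H -> H) : H -> H := fun v => S (T v) - T (S v).

Definition antilinear_isometry (J : H -> H) : Prop :=
  (forall c u v, J (c *: u + v) = (c^*)%C *: J u + J v) /\
  (forall v, `|J v| = `|v|).

Record star_representation (A : algType R[i]) (star : A -> A)
    (pi : A -> H -> H) : Prop := {
  rep_bounded : forall a, bounded_operator (pi a);
  rep_one : forall v, pi 1 v = v;
  rep_add : forall a b v, pi (a + b) v = pi a v + pi b v;
  rep_scale : forall c a v, pi (c *: a) v = c *: pi a v;
  rep_mul : forall a b v, pi (a * b) v = pi a (pi b v);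
  rep_star : forall a u v, ip (pi (star a) u) v = ip u (pi a v)
}.

(** Partially defined operators; the values of [op] outside of [dom] are
    irrelevant. *)
Record unbounded_operator := UnboundedOperator {
  dom : set H;
  op :> H -> H
}.

Definition op_comp (S T : unbounded_operator) : unbounded_operator :=
  UnboundedOperator [set v | dom T v /\ dom S (T v)] (fun v => S (T v)).

Definition op_eq (S T : unbounded_operator) : Prop :=
  dom S = dom T /\ forall v, dom S v -> S v = T v.

Fixpoint op_pow (T : unbounded_operator) (k : nat) : unbounded_operator :=
  if k is k'.+1 then op_comp T (op_pow T k') else UnboundedOperator setT id.

(** Densely defined and equal, domains included, to its adjoint. *)
Definition self_adjoint (T : unbounded_operator) : Prop :=
  closure (dom T) = setT /\
  forall v w, (dom T v /\ T v = w) <->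
              (forall u, dom T u -> ip (T u) v = ip u w).

Definition positive_operator (T : unbounded_operator) : Prop :=
  forall v, dom T v -> 0 <= ip (T v) v.

(** [E] is [|T|], the positive square root of [T ^ 2], for self-adjoint [T]. *)
Definition is_absolute_value (T E : unbounded_operator) : Prop :=
  [/\ self_adjoint E, positive_operator E & op_eq (op_comp E E) (op_comp T T)].

(** [T] preserves [dom A], and [A T - T A], defined on [dom A], extends to the
    bounded operator [S] of [H] (unique if [dom A] is dense). *)
Definition bounded_commutator (A : unbounded_operator) (T S : H -> H) : Prop :=
  bounded_operator S /\
  forall v, dom A v -> dom A (T v) /\ S v = A (T v) - T (A v).

Section Smoothing.
Variable absD : unbounded_operator.

(** The domain of the [n]-th power of the derivation [T |-> [|D|, T]]. *)
Fixpoint dom_delta (n : nat) (T : H -> H) : Prop :=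
  bounded_operator T /\
  if n is n'.+1 then exists S, bounded_commutator absD T S /\ dom_delta n' S
  else True.

Definition OP0 (T : H -> H) : Prop := forall n, dom_delta n T.

Definition OPminf (T : H -> H) : Prop :=
  OP0 T /\
  forall k, (forall v, dom (op_pow absD k) (T v)) /\
            OP0 (fun v => op_pow absD k (T v)).

End Smoothing.
End Operators.

Section Coefficients.
Variables (R : realType) (q : R).

Definition qnum (z : R) : R := (q `^ z - q `^ (- z)) / (q - q^-1).
Local Notation "[ z ]q" := (qnum z) (at level 0, z at level 200).
Local Notation sqrt := Num.sqrt.
Local Notation half := (2^-1 : R).

(** The exponent is an integer for all admissible labels. *)
Definition eps (l j m2 : R) : R := half * (-1) ^ Num.floor (l + half - j - m2).

Definition Ap (j m1 : R) : R :=
  q `^ (m1 - 1) * sqrt ([j + m1 + 1]q * [j - m1 + 1]q) / [2 * j + 2]q.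
Definition A0 (j m1 : R) : R :=
  q `^ (- 2) * ((q `^ (j + m1 + 1) * [2]q * [j - m1]q - [2 * j]q)
                / ([2 * j]q * [2 * j + 2]q)).
Definition Bp (j m1 : R) : R :=
  q `^ (- j + m1 - half) * sqrt ([j + m1 + 1]q * [j + m1 + 2]q)
  / [2 * j + 2]q.
Definition B0 (j m1 : R) : R :=
  (1 + q ^+ 2) * q `^ (m1 - half) * sqrt ([j - m1]q * [j + m1 + 1]q)
  / ([2 * j]q * [2 * j + 2]q).
Definition Bm (j m1 : R) : R :=
  - (q `^ (j + m1 + half) * sqrt ([j - m1]q * [j - m1 - 1]q) / [2 * j]q).
Definition Cp (l j m2 : R) : R := let e := eps l j m2 in
  - (q `^ (m2 - 1 - e) * sqrt ([l + j + m2 + 3 + e]q * [l + j - m2 + 3 - e]q)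
     / [2 * l + 4]q).
Definition C0 (l j m2 : R) : R := let e := eps l j m2 in
  [4 * e]q * q `^ (2 * e * l + m2 - 1 + 3 * e)
  * sqrt ([l + half + j - 2 * e * m2 + 2]q * [l + half - j - 2 * e * m2]q)
  / ([2 * l + 2]q * [2 * l + 4]q).
Definition Cm (l j m2 : R) : R := let e := eps l j m2 in
  - (q `^ (m2 - 1 + e) * sqrt ([l - j + m2 - e]q * [l - j - m2 + e]q)
     / [2 * l + 2]q).
Definition Hp (l j m2 : R) : R := let e := eps l j m2 in
  q `^ (m2 - 1 + e * (2 * j + 1))
  * sqrt ([l + 2 * e * j - m2 + 2 + e]q * [l - 2 * e * j + m2 + 2 - e]q)
  / [2 * l + 4]q.
Definition H0 (l j m2 : R) : R := let e := eps l j m2 in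
  ([l - e * (2 * j + 1) - m2 + 1]q * [l - e * (2 * j + 1) + m2 + 2]q
   - q `^ (- 2)
     * [l + e * (2 * j + 1) - m2 + 2]q * [l + e * (2 * j + 1) + m2 + 1]q)
  / ([2 * l + 2]q * [2 * l + 4]q).
Definition Dp (l j m2 : R) : R := let e := eps l j m2 in
  q `^ (- l + m2 - 3 / 2)
  * sqrt ([l + j + m2 + 3 + e]q * [l - j + m2 + 2 - e]q) / [2 * l + 4]q.
Definition D0 (l j m2 : R) : R := let e := eps l j m2 in
  [2]q * q `^ (m2 + half)
  * sqrt ([l - 2 * e * j - m2 + 1 - e]q * [l - 2 * e * j + m2 + 2 - e]q)
  / ([2 * l + 2]q * [2 * l + 4]q).
Definition Dm (l j m2 : R) : R := let e := eps l j m2 in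
  - (q `^ (l + m2 + 3 / 2) * sqrt ([l - j - m2 + e]q * [l + j - m2 + 1 - e]q)
     / [2 * l + 2]q).

End Coefficients.

Definition admissible (R : realType) (l m1 m2 j : R) : bool :=
  [&& l - 2^-1 \is a Num.nat, j - 2^-1 \is a Num.nat, l - j \is a Num.nat,
      j - `|m1| \is a Num.nat & l + 2^-1 - j - `|m2| \is a Num.nat].

Section Spinors.
Variables (R : realType) (H : completeNormedModType R[i]).

(** [ket s l m1 m2 j] is [|l,m1,m2;j>_+] for [s = false] and
    [|l,m1,m2;j>_-] for [s = true]: the sign is [(-1) ^+ s]. *)
Variable ket : bool -> R -> R -> R -> R -> H.

(** [H] is the orthogonal sum of [H_+] and [H_-], so one orthonormal basis of
    [H] collects the kets of both signs. *)
Definition spinor_basis (ip : {dot H for (@Num.conj R[i])}) : Prop :=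
  [/\ forall s l m1 m2 j, ~~ admissible l m1 m2 j -> ket s l m1 m2 j = 0,
      forall s s' l l' m1 m1' m2 m2' j j',
        admissible l m1 m2 j -> admissible l' m1' m2' j' ->
        ip (ket s l m1 m2 j) (ket s' l' m1' m2' j') =
        ((s, l, m1, m2, j) == (s', l', m1', m2', j'))%:R
    & closure [set v : H | exists r : seq (R[i] * (bool * R * R * R * R)),
        v = \sum_(x <- r) x.1 *: (let: (s, l, m1, m2, j) := x.2 in
                                  ket s l m1 m2 j)] = setT].

Variable q : R.
Local Notation sg s := ((-1) ^+ (nat_of_bool s) : R).
Local Notation "c *r v" := ((c)%:C%C *: v) (at level 40).
Local Notation Ap := (Ap q). Local Notation A0 := (A0 q).
Local Notation Bp := (Bp q). Local Notation B0 := (B0 q).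
Local Notation Bm := (Bm q).
Local Notation Cp := (Cp q). Local Notation C0 := (C0 q).
Local Notation Cm := (Cm q).
Local Notation Hp := (Hp q). Local Notation H0 := (H0 q).
Local Notation Dp := (Dp q). Local Notation D0 := (D0 q).
Local Notation Dm := (Dm q).

Definition spin_x0 s l m1 m2 j : H :=
    (Ap j m1 * Cp l j m2) *r ket s (l + 1) m1 m2 (j + 1)
  - (sg s * (Ap j m1 * C0 l j m2)) *r ket s l m1 m2 (j + 1)
  + (Ap j m1 * Cm l j m2) *r ket s (l - 1) m1 m2 (j + 1)
  + (A0 j m1 * Hp l j m2) *r ket s (l + 1) m1 m2 j
  + (sg s * (A0 j m1 * H0 l j m2)) *r ket s l m1 m2 j
  + (A0 j m1 * Hp (l - 1) j m2) *r ket s (l - 1) m1 m2 j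
  + (Ap (j - 1) m1 * Cm (l + 1) (j - 1) m2) *r ket s (l + 1) m1 m2 (j - 1)
  - (sg s * (Ap (j - 1) m1 * C0 l (j - 1) m2)) *r ket s l m1 m2 (j - 1)
  + (Ap (j - 1) m1 * Cp (l - 1) (j - 1) m2) *r ket s (l - 1) m1 m2 (j - 1).

Definition spin_x1 s l m1 m2 j : H :=
    (Bp j m1 * Cp l j m2) *r ket s (l + 1) (m1 + 1) m2 (j + 1)
  - (sg s * (Bp j m1 * C0 l j m2)) *r ket s l (m1 + 1) m2 (j + 1)
  + (Bp j m1 * Cm l j m2) *r ket s (l - 1) (m1 + 1) m2 (j + 1)
  + (B0 j m1 * Hp l j m2) *r ket s (l + 1) (m1 + 1) m2 j
  + (sg s * (B0 j m1 * H0 l j m2)) *r ket s l (m1 + 1) m2 j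
  + (B0 j m1 * Hp (l - 1) j m2) *r ket s (l - 1) (m1 + 1) m2 j
  + (Bm j m1 * Cm (l + 1) (j - 1) m2) *r ket s (l + 1) (m1 + 1) m2 (j - 1)
  - (sg s * (Bm j m1 * C0 l (j - 1) m2)) *r ket s l (m1 + 1) m2 (j - 1)
  + (Bm j m1 * Cp (l - 1) (j - 1) m2) *r ket s (l - 1) (m1 + 1) m2 (j - 1).

Definition spin_x2 s l m1 m2 j : H :=
    Dp l j m2 *r ket s (l + 1) m1 (m2 + 1) j
  + (sg s * D0 l j m2) *r ket s l m1 (m2 + 1) j
  + Dm l j m2 *r ket s (l - 1) m1 (m2 + 1) j.

Definition spinor_representation (ip : {dot H for (@Num.conj R[i])})
    (pi : sphere q -> H -> H) : Prop :=
  star_representation ip (@sphere_adj R q) pi /\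
  forall s l m1 m2 j, admissible l m1 m2 j ->
    [/\ pi (sphere_x q 0) (ket s l m1 m2 j) = spin_x0 s l m1 m2 j,
        pi (sphere_x q 1) (ket s l m1 m2 j) = spin_x1 s l m1 m2 j
      & pi (sphere_x q 2) (ket s l m1 m2 j) = spin_x2 s l m1 m2 j].

Definition dirac_operator (ip : {dot H for (@Num.conj R[i])})
    (D : unbounded_operator H) : Prop :=
  self_adjoint ip D /\
  forall s l m1 m2 j, admissible l m1 m2 j ->
    dom D (ket s l m1 m2 j) /\
    D (ket s l m1 m2 j) = (l + 3 / 2) *r ket (~~ s) l m1 m2 j.

(** [2 l + 1] and [j + m1] are integers for admissible labels. *)
Definition real_structure (J : H -> H) : Prop :=
  antilinear_isometry J /\
  forall s l m1 m2 j, admissible l m1 m2 j ->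
    J (ket s l m1 m2 j) =
    (('i%C : R[i]) ^ Num.floor (2 * l + 1) * (-1) ^ Num.floor (j + m1))
      *: ket s l (- m1) (- m2) j.

End Spinors.

(* Main.v *)
From HB Require Import structures.
Require Import Defs.
From mathcomp Require Import all_boot all_order all_algebra.
From mathcomp Require Import complex.
From mathcomp Require Import all_classical all_reals all_analysis.
From mathcomp Require Import zify ring lra.

(** Why the commutators are smoothing.

    Write a ket |l, m1, m2; j> in the coordinates n1 = j + m1, k1 = j - m1,
    n2 = l + 1/2 - j + m2 and k2 = l + 1/2 - j - m2.  These are natural numbers
    with n1 + k1 and n2 + k2 odd, and their sum is 2 l + 1, so that |D| is half
    of that sum plus one.  A generator x_i is a finite sum of weighted shifts
    of the labels, whose coefficients are built from factors q^x,
    sqrt (1 - q^(2 x)) and 1 / (1 - q^(2 x)) with x affine in the coordinates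
    for each parity of k2.

    An operator that changes l by a bounded amount and whose values on the kets
    decrease faster than any power of l belongs to OP^-oo [smoothing_OPminf].
    If 2 l + 1 is large then one of the four coordinates is large; hence a
    shift is smoothing as soon as its coefficient decreases exponentially when
    any single coordinate goes to infinity.  The terms of x_i with a factor
    C^0, H^0 or D^0, which are the only ones that depend on the chirality, are
    smoothing for this reason; without them x_i has a bounded commutator
    with D.

    The main point is an order on the coordinates: n2 < n1 < k1 < k2.  When the
    coordinate i goes to infinity, each shift in x_i either has an
    exponentially small coefficient, or it moves only coordinates <= i and its
    coefficient no longer depends on the coordinates >= i; this is the notion
    of symbol below, for the families [lower] and [upper].  Conjugation by J
    exchanges the letters n and k, which reverses the order, so that J x_i J
    has the mirror property.  In each of the four limits, two shifts of
    opposite types then either have an exponentially small product, or move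
    only coordinates that the coefficient of the other one ignores.  Their
    commutator therefore vanishes in each limit [commutator_vanishing], so it is
    smoothing [shift_commutator].

    The operators generated by the shifts of lower type and by the smoothing
    operators [pdo] form an algebra, closed under adjoints [pdo_adjoint] and
    under commutators with D [pdo_dirac], which J exchanges with the algebra of
    upper type [pdo_conj].  It contains the generators, hence the image of the
    quantum sphere [pdo_representation], and the two algebras commute up to
    smoothing operators [pdo_commutator]. *)

Set Implicit Arguments.
Unset Strict Implicit.
Unset Printing Implicit Defensive.
Import Order.TTheory GRing.Theory Num.Theory.
Import numFieldNormedType.Exports.
Local Open Scope classical_set_scope.
Local Open Scope ring_scope.

(** * Real-valued norms, limits and bounded operators *)
Section HilbertNorm.
Variables (R : realType) (H : completeNormedModType R[i]).
Implicit Types (u v w : H) (T S : H -> H).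

(** The norm of [H] takes its values in [R[i]]; its real form allows
    comparisons in a total order. *)
Definition rnorm u : R := complex.Re `|u|.

Lemma rnormE u : `|u| = (rnorm u)%:C%C :> R[i].
Proof. by rewrite /rnorm RRe_real// ger0_real. Qed.

Lemma rnorm_ge0 u : 0 <= rnorm u.
Proof. by rewrite -ler0c -rnormE. Qed.

Lemma rnorm0 : rnorm 0 = 0.
Proof. by rewrite /rnorm normr0. Qed.

Lemma rnorm_eq0 u : (rnorm u == 0) = (u == 0).
Proof. by rewrite -(inj_eq (@complexI R)) -rnormE normr_eq0. Qed.

Lemma rnormD u v : rnorm (u + v) <= rnorm u + rnorm v.
Proof. by rewrite -lecR rmorphD /= -!rnormE; exact: ler_normD. Qed.

Lemma rnormN u : rnorm (- u) = rnorm u.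
Proof. by rewrite /rnorm normrN. Qed.

Lemma rnormB u v : rnorm (u - v) = rnorm (v - u).
Proof. by rewrite /rnorm distrC. Qed.

Lemma rnormZ (a : R[i]) u : rnorm (a *: u) = complex.Re `|a| * rnorm u.
Proof.
apply: (@complexI R); rewrite -rnormE normrZ rnormE rmorphM /=.
by rewrite RRe_real// ger0_real.
Qed.

Lemma rnorm_sum (I : Type) (r : seq I) (F : I -> H) :
  rnorm (\sum_(i <- r) F i) <= \sum_(i <- r) rnorm (F i).
Proof.
elim: r => [|i r IH]; first by rewrite !big_nil rnorm0.
by rewrite !big_cons (le_trans (rnormD _ _))// lerD2l.
Qed.

Lemma bounded_operatorP T :
  bounded_operator T <-> linear T /\ exists K : R, 0 <= K /\ forall u, rnorm (T u) <= K * rnorm u.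
Proof.
split=> -[lT [K hK]]; split=> //.
  exists `|complex.Re K|; split=> // u.
  have := hK u; rewrite !rnormE lecE => /andP[_].
  have -> : complex.Re (K * (rnorm u)%:C%C) = complex.Re K * rnorm u.
    by case: (K) => a b /=; rewrite mulr0 subr0.
  move=> /le_trans; apply.
  by rewrite ler_wpM2r ?rnorm_ge0// ler_norm.
by exists K%:C%C => u; rewrite !rnormE -rmorphM lecR; apply hK.2.
Qed.

Definition tends (u : nat -> H) l := forall e : R, 0 < e ->
  exists N, forall n, (N <= n)%N -> rnorm (u n - l) < e.

Lemma cauchy_tends (u : nat -> H) :
  (forall e : R, 0 < e -> exists N, forall n m, (N <= n)%N -> (N <= m)%N ->
     rnorm (u n - u m) < e) -> exists l, tends u l.
Proof.
move=> hu; have : cvg (u @ \oo).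
  apply/cauchy_cvgP/cauchy_ballP => e e0.
  have e1 : 0 < complex.Re e by move: e0; rewrite ltcE => /andP[].
  have [N hN] := hu _ e1; rewrite near_simpl.
  exists (`[N, +oo[%classic, `[N, +oo[%classic) => /=.
    by split; exists N => // m /=; rewrite in_itv/= andbT.
  move=> [m n] /=; rewrite !in_itv/= !andbT => -[? ?].
  rewrite -ball_normE /ball_ /= rnormE (@lt_le_trans _ _ (complex.Re e)%:C%C)//.
    by rewrite ltcR; apply: hN.
  by rewrite lecE /= lexx andbT; move: e0; rewrite ltcE => /andP[/eqP -> _].
move=> /cvg_ex[l /cvgrPdist_lt hl]; exists l => e e0.
have e1 : 0 < e%:C%C by rewrite ltcR.
have [N _ hN] := hl _ e1; exists N => n /hN /=.
by rewrite rnormE ltcR rnormB.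
Qed.

Lemma closure_approx (A : set H) : closure A = setT ->
  forall u (e : R), 0 < e -> exists v, A v /\ rnorm (u - v) < e.
Proof.
move=> hA u e e0; have : closure A u by rewrite hA.
move=> /(_ (ball u e%:C%C)) [].
  by apply: nbhsx_ballx; rewrite ltcR.
by move=> v [Av]; rewrite -ball_normE /ball_ /= rnormE ltcR => ?; exists v.
Qed.

Lemma tends_unique (u : nat -> H) l l' : tends u l -> tends u l' -> l = l'.
Proof.
move=> h h'; apply/eqP; rewrite -subr_eq0 -rnorm_eq0; apply/negPn/negP => n0.
have e0 : 0 < rnorm (l - l') / 2 by rewrite divr_gt0// lt_def n0 rnorm_ge0.
have [N hN] := h _ e0; have [N' hN'] := h' _ e0.
have := hN (maxn N N') (leq_maxl _ _); have := hN' (maxn N N') (leq_maxr _ _).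
set x := u _ => h1 h2; have := rnormD (l - x) (x - l').
rewrite addrA subrK; rewrite rnormB in h2; lra.
Qed.

Lemma tends_eventually (u : nat -> H) N l : (forall n, (N <= n)%N -> u n = l) -> tends u l.
Proof. by move=> h e e0; exists N => n /h ->; rewrite subrr rnorm0. Qed.

Lemma tendsD (u u' : nat -> H) l l' : tends u l -> tends u' l' ->
  tends (fun n => u n + u' n) (l + l').
Proof.
move=> h h' e e0; have e2 : 0 < e / 2 by rewrite divr_gt0.
have [N hN] := h _ e2; have [N' hN'] := h' _ e2.
exists (maxn N N') => n; rewrite geq_max => /andP[/hN h1 /hN' h2].
rewrite opprD addrACA (le_lt_trans (rnormD _ _))//; lra.
Qed.

Lemma tends_bounded T (u : nat -> H) l : bounded_operator T -> tends u l ->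
  tends (T \o u) (T l).
Proof.
move=> /bounded_operatorP[lT [K [K0 hK]]] h e e0.
have [N hN] := h (e / (K + 1)) ltac:(by rewrite divr_gt0 // ltr_wpDl).
exists N => n /hN; rewrite ltr_pdivlMr ?ltr_wpDl// => he /=.
have -> : T (u n) - T l = T (u n - l).
  have := lT (-1) l (u n); rewrite !scaleN1r addrC => <-; by rewrite addrC.
apply: le_lt_trans (hK _) _; have := rnorm_ge0 (u n - l); nra.
Qed.

Lemma tends_rnorm_le (u : nat -> H) l (M : R) : tends u l -> (forall n, rnorm (u n) <= M) -> rnorm l <= M.
Proof.
move=> h hM; apply/ler_addgt0Pr => e e0; have [N hN] := h _ e0.
have := hN _ (leqnn N); have := hM N; have := rnormD (u N) (l - u N).
by rewrite addrC subrK rnormB; lra.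
Qed.

End HilbertNorm.

(** * Inner products and orthonormal families *)
Section IP.
Variables (R : realType) (H : completeNormedModType R[i]).
Variable ip : {dot H for (@Num.conj R[i])}.
Hypothesis hip : hilbert_norm ip.
Implicit Types (u v w : H) (a : R[i]).

Lemma conjE a : Num.conj a = (a^*)%C.
Proof. by []. Qed.

Lemma ipDl u v w : ip (u + v) w = ip u w + ip v w.
Proof. exact: linearDl. Qed.
Lemma ipDr u v w : ip w (u + v) = ip w u + ip w v.
Proof. exact: linearDr. Qed.
Lemma ipZl a u w : ip (a *: u) w = a * ip u w.
Proof. exact: linearZl_LR. Qed.
Lemma ipZr a u w : ip w (a *: u) = (a^*)%C * ip w u.
Proof. exact: linearZr_LR. Qed.
Lemma ipC u v : ip u v = (ip v u)^*%C.
Proof. by rewrite hermC /= expr0 mul1r conjE. Qed.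
Lemma ip0l w : ip 0 w = 0. Proof. exact: linear0l. Qed.
Lemma ip0r w : ip w 0 = 0. Proof. exact: linear0r. Qed.
Lemma ipBl u v w : ip (u - v) w = ip u w - ip v w.
Proof. exact: linearBl. Qed.
Lemma ipBr u v w : ip w (u - v) = ip w u - ip w v.
Proof. exact: linearBr. Qed.
Lemma ip_suml (I : Type) (r : seq I) (F : I -> H) w :
  ip (\sum_(i <- r) F i) w = \sum_(i <- r) ip (F i) w.
Proof. exact: linear_sumlz. Qed.
Lemma ip_sumr (I : Type) (r : seq I) (F : I -> H) w :
  ip w (\sum_(i <- r) F i) = \sum_(i <- r) ip w (F i).
Proof. exact: linear_sumr. Qed.

Lemma ip_rnorm u : ip u u = (rnorm u ^+ 2)%:C%C.
Proof. by rewrite -hip rnormE rmorphXn. Qed.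

Lemma ip_eq0P u : (forall w, ip u w = 0) -> u = 0.
Proof.
move=> /(_ u); rewrite ip_rnorm => /complexI/eqP.
by rewrite expf_eq0 /= rnorm_eq0 => /eqP.
Qed.

Lemma conjcM a b : ((a * b)^*)%C = (a^*)%C * (b^*)%C.
Proof. exact: rmorphM. Qed.
Lemma rcM (x y : R) : (x * y)%:C%C = x%:C%C * y%:C%C :> R[i].
Proof. exact: rmorphM. Qed.
Lemma rcD (x y : R) : (x + y)%:C%C = x%:C%C + y%:C%C :> R[i].
Proof. exact: rmorphD. Qed.
Lemma rcB (x y : R) : (x - y)%:C%C = x%:C%C - y%:C%C :> R[i].
Proof. exact: rmorphB. Qed.

Definition cmod (a : R[i]) : R := complex.Re `|a|.
Lemma cmodE a : `|a| = (cmod a)%:C%C. Proof. by rewrite /cmod RRe_real// ger0_real. Qed.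

Lemma cmod_ge0 a : 0 <= cmod a. Proof. by rewrite -ler0c -cmodE. Qed.
Lemma cmod_sqr a : a * (a^*)%C = (cmod a ^+ 2)%:C%C.
Proof. by rewrite -sqr_normc cmodE rmorphXn. Qed.
Lemma cmodJ a : cmod (a^*)%C = cmod a.
Proof. by rewrite /cmod normcJ. Qed.
Lemma cmodM a b : cmod (a * b) = cmod a * cmod b.
Proof. by apply: complexI; rewrite rmorphM /= -!cmodE normrM. Qed.
Lemma cmodR (x : R) : cmod x%:C%C = `|x|.
Proof.
by apply: complexI; rewrite -cmodE normc_def /= expr0n addr0 sqrtr_sqr.
Qed.
Lemma cmod0 : cmod 0 = 0. Proof. by rewrite /cmod normr0. Qed.
Lemma cmod_eq0 a : (cmod a == 0) = (a == 0).
Proof. by rewrite -(inj_eq (@complexI R)) -cmodE normr_eq0. Qed.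

(** Cauchy-Schwarz, from the square norm of [ip v v *: u - ip u v *: v], which
    avoids a division. *)
Lemma cmod_ip u v : cmod (ip u v) <= rnorm u * rnorm v.
Proof.
have [->|v0] := eqVneq v 0; first by rewrite ip0r cmod0 rnorm0 mulr0.
pose w := ip v v *: u - ip u v *: v.
have : ip w w = ((rnorm v ^+ 2) * ((rnorm v * rnorm u) ^+ 2 - cmod (ip u v) ^+ 2))%:C%C.
  rewrite /w !(ipBl, ipBr, ipZl, ipZr) (ipC v u) !ip_rnorm conjc_real.
  rewrite exprMn rcM rcB rcM -cmod_sqr.
  by ring.
rewrite ip_rnorm => /complexI hw.
have v1 : 0 < rnorm v ^+ 2 by rewrite exprn_gt0// lt_def rnorm_ge0 rnorm_eq0 v0.
have : 0 <= rnorm v ^+ 2 * ((rnorm v * rnorm u) ^+ 2 - cmod (ip u v) ^+ 2).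
  by rewrite -hw sqr_ge0.
rewrite pmulr_rge0// subr_ge0 ler_sqr ?nnegrE ?cmod_ge0 ?mulr_ge0 ?rnorm_ge0//.
by rewrite mulrC.
Qed.

Section Basis.
Variables (I : eqType) (e : I -> H) (adm : pred I).
Hypothesis e_on : forall i j, adm i -> adm j -> ip (e i) (e j) = (i == j)%:R.

Lemma ip_comb (r : seq I) (a : I -> R[i]) i : uniq r -> all adm r -> adm i ->
  ip (\sum_(k <- r) a k *: e k) (e i) = if i \in r then a i else 0.
Proof.
move=> ur ar ai; rewrite ip_suml.
transitivity (\sum_(k <- r) if k == i then a k else 0).
  apply: eq_big_seq => k kr; rewrite ipZl e_on//; last exact: (allP ar).
  by case: eqP; rewrite ?mulr1 ?mulr0.
case: ifP => ir; last first.
  by rewrite big_seq big1// => k kr; case: eqP => // ki; rewrite -ki kr in ir.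
rewrite (bigD1_seq i)//= eqxx big1 ?addr0// => k /negPf ->; by [].
Qed.

Lemma rnorm_comb (r : seq I) (a : I -> R[i]) : uniq r -> all adm r ->
  rnorm (\sum_(k <- r) a k *: e k) ^+ 2 = \sum_(k <- r) cmod (a k) ^+ 2.
Proof.
move=> ur ar; apply: complexI; rewrite -ip_rnorm ip_sumr rmorph_sum /=.
apply: eq_big_seq => k kr; rewrite ipZr ip_comb// ?kr; last exact: (allP ar).
by rewrite mulrC cmod_sqr.
Qed.

Lemma bessel (r : seq I) u : uniq r -> all adm r ->
  \sum_(k <- r) cmod (ip u (e k)) ^+ 2 <= rnorm u ^+ 2.
Proof.
move=> ur ar; set s := \sum_(k <- r) _.
pose p := \sum_(k <- r) ip u (e k) *: e k.
have pp : ip p p = s%:C%C by rewrite ip_rnorm rnorm_comb.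
have up : ip u p = s%:C%C.
  rewrite ip_sumr /s rmorph_sum /=; apply: eq_bigr => k _.
  by rewrite ipZr mulrC cmod_sqr.
have : ip (u - p) (u - p) = (rnorm u ^+ 2 - s)%:C%C.
  rewrite !(ipBl, ipBr) pp (ipC p u) up ip_rnorm conjc_real rcB subrr subr0.
  by [].
by rewrite ip_rnorm => /complexI h; rewrite -subr_ge0 -h sqr_ge0.
Qed.

End Basis.
End IP.

Section LinearBounded.
Variables (R : realType) (H : completeNormedModType R[i]).
Implicit Types (u v w : H) (T S : H -> H).

Lemma linear_add T u v : linear T -> T (u + v) = T u + T v.
Proof. by move=> lT; have := lT 1 u v; rewrite !scale1r. Qed.
Lemma linear_zero T : linear T -> T 0 = 0.
Proof.
by move=> lT; have := linear_add 0 0 lT; rewrite addr0 -{1}(addr0 (T 0)) => /addrI.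
Qed.
Lemma linear_scale T (a : R[i]) u : linear T -> T (a *: u) = a *: T u.
Proof. by move=> lT; have := lT a u 0; rewrite !addr0 linear_zero// addr0. Qed.
Lemma linear_opp T u : linear T -> T (- u) = - T u.
Proof. by move=> lT; rewrite -scaleN1r linear_scale// scaleN1r. Qed.
Lemma linear_sub T u v : linear T -> T (u - v) = T u - T v.
Proof. by move=> lT; rewrite linear_add// linear_opp. Qed.
Lemma linear_comb T (I : Type) (r : seq I) (a : I -> R[i]) (F : I -> H) : linear T ->
  T (\sum_(i <- r) a i *: F i) = \sum_(i <- r) a i *: T (F i).
Proof.
move=> lT; elim: r => [|i r IH]; first by rewrite !big_nil linear_zero.
by rewrite !big_cons lT IH.
Qed.

Lemma bounded_add T S : bounded_operator T -> bounded_operator S ->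
  bounded_operator (fun u => T u + S u).
Proof.
move=> /bounded_operatorP[lT [K [K0 hK]]] /bounded_operatorP[lS [M [M0 hM]]].
apply/bounded_operatorP; split.
  by move=> a u v; rewrite lT lS scalerDr addrACA.
exists (K + M); split; first exact: addr_ge0.
move=> u; rewrite mulrDl (le_trans (rnormD _ _))// lerD//.
Qed.

Lemma bounded_scale (a : R[i]) T : bounded_operator T ->
  bounded_operator (fun u => a *: T u).
Proof.
move=> /bounded_operatorP[lT [K [K0 hK]]]; apply/bounded_operatorP; split.
  by move=> b u v; rewrite lT scalerDr !scalerA mulrC.
exists (cmod a * K); split; first by rewrite mulr_ge0// cmod_ge0.
by move=> u; rewrite rnormZ -mulrA ler_wpM2l ?cmod_ge0.
Qed.

Lemma bounded_comp T S : bounded_operator T -> bounded_operator S ->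
  bounded_operator (fun u => T (S u)).
Proof.
move=> /bounded_operatorP[lT [K [K0 hK]]] /bounded_operatorP[lS [M [M0 hM]]].
apply/bounded_operatorP; split; first by move=> a u v; rewrite lS lT.
exists (K * M); split; first exact: mulr_ge0.
by move=> u; rewrite (le_trans (hK _))// -mulrA ler_wpM2l.
Qed.

Lemma bounded_sub T S : bounded_operator T -> bounded_operator S ->
  bounded_operator (fun u => T u - S u).
Proof.
move=> bT bS; have := bounded_add bT (bounded_scale (-1) bS).
by congr bounded_operator; apply/funext => u; rewrite scaleN1r.
Qed.

End LinearBounded.

Lemma ler_sum_mem (R : numDomainType) (I : eqType) (r : seq I) (F G : I -> R) :
  (forall i, i \in r -> F i <= G i) -> \sum_(i <- r) F i <= \sum_(i <- r) G i.
Proof.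
by move=> h; rewrite big_seq [leRHS]big_seq; apply: ler_sum => i; apply: h.
Qed.

(** * Operators on a graded orthonormal basis *)

(** The basis is indexed by the elements of [I] that satisfy [adm], as shifts
    of labels may lead outside; [e] is zero there.  [ball n] lists the indices
    of degree less than [n], and the last field says that their number grows
    polynomially, in the form in which sums of rapidly decreasing families are
    bounded. *)
Record graded_basis (R : realType) (H : completeNormedModType R[i])
    (ip : {dot H for (@Num.conj R[i])}) (I : eqType) (e : I -> H) (adm : pred I)
    (g : I -> nat) (ball : nat -> seq I) := GradedBasis {
  gb_hilbert : hilbert_norm ip;
  gb_on : forall i j, adm i -> adm j -> ip (e i) (e j) = (i == j)%:R;
  gb_out : forall i, ~~ adm i -> e i = 0;
  gb_dense : forall u (d : R), 0 < d -> exists r : seq (R[i] * I),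
    rnorm (u - \sum_(x <- r) x.1 *: e x.2) < d;
  gb_ball : forall n i, (i \in ball n) = adm i && (g i < n)%N;
  gb_uniq : forall n, uniq (ball n);
  gb_rate : nat;
  gb_const : R;
  gb_sum : forall N,
    \sum_(i <- ball N) ((g i).+1%:R ^- gb_rate) <= gb_const
}.

Section GradedBasis.
Variables (R : realType) (H : completeNormedModType R[i]).
Variable ip : {dot H for (@Num.conj R[i])}.
Variables (I : eqType) (e : I -> H) (adm : pred I) (g : I -> nat).
Variable ball : nat -> seq I.
Hypothesis gb : graded_basis ip e adm g ball.
Let hip := gb_hilbert gb.
Let e_on := gb_on gb.
Let e_out := gb_out gb.
Let e_dense := gb_dense gb.
Let mem_ball := gb_ball gb.
Let uniq_ball := gb_uniq gb.
Implicit Types (u v w : H) (T S : H -> H) (f : I -> H).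

Definition partial_sum f N u := \sum_(i <- ball N) ip u (e i) *: f i.

Lemma adm_ball N : all adm (ball N).
Proof. by apply/allP => i; rewrite mem_ball => /andP[]. Qed.

Lemma partial_sum_lin f N : linear (partial_sum f N).
Proof.
move=> a u v; rewrite /partial_sum scaler_sumr -big_split; apply: eq_bigr => i _ /=.
by rewrite ipDl ipZl scalerDl scalerA.
Qed.

Lemma ip_e i j : adm j -> ip (e i) (e j) = (i == j)%:R.
Proof.
move=> aj; have [ai|nai] := boolP (adm i); first exact: e_on.
by rewrite e_out// ip0l; case: eqP => // ij; rewrite ij aj in nai.
Qed.

Lemma partial_sum_e f N i : partial_sum f N (e i) = if i \in ball N then f i else 0.
Proof.
rewrite /partial_sum; case: ifP => iN.
  rewrite (bigD1_seq i)//= big1_seq ?addr0.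
    by rewrite ip_e ?eqxx ?scale1r//; apply: (allP (adm_ball N)).
  move=> j /andP[ji jN]; rewrite ip_e ?(allP (adm_ball N))//.
  by rewrite eq_sym (negPf ji) scale0r.
rewrite big1_seq// => j /andP[_ jN]; rewrite ip_e ?(allP (adm_ball N))//.
by case: eqP => [ij|_]; rewrite ?scale0r// ij jN in iN *.
Qed.

(** A bounded functional that vanishes on the basis vanishes on their span,
    which is dense. *)
Lemma func_ext (phi : H -> R[i]) (K : R) :
  (forall a u v, phi (a *: u + v) = a * phi u + phi v) ->
  (forall u, cmod (phi u) <= K * rnorm u) -> (forall i, adm i -> phi (e i) = 0) ->
  forall u, phi u = 0.
Proof.
move=> lphi bphi ephi u.
have phi0 : phi 0 = 0.
  have := lphi 1 0 0; rewrite scale1r mul1r addr0.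
  by rewrite -{1}(addr0 (phi 0)) => /addrI.
have ee i : phi (e i) = 0.
  by have [/ephi//|/e_out ->] := boolP (adm i).
have es (r : seq (R[i] * I)) : phi (\sum_(x <- r) x.1 *: e x.2) = 0.
  elim: r => [|x r IH]; first by rewrite big_nil.
  by rewrite big_cons lphi ee mulr0 add0r.
apply/eqP; rewrite -cmod_eq0; apply/negPn/negP => n0.
have p0 : 0 < cmod (phi u) by rewrite lt_def n0 cmod_ge0.
have K1 : 0 < `|K| + 1 by rewrite ltr_wpDl.
have [r] := e_dense u (divr_gt0 p0 K1); rewrite ltr_pdivlMr// => hr.
have := bphi (u - \sum_(x <- r) x.1 *: e x.2).
have -> : u - \sum_(x <- r) x.1 *: e x.2 = (-1) *: \sum_(x <- r) x.1 *: e x.2 + u.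
  by rewrite scaleN1r addrC.
rewrite lphi es mulr0 add0r scaleN1r addrC.
have := rnorm_ge0 (u - \sum_(x <- r) x.1 *: e x.2).
have := ler_norm K; set h := rnorm _ in hr *; move: hr; nra.
Qed.

Lemma ip_func_bound T v : bounded_operator T ->
  exists K, forall u, cmod (ip (T u) v) <= K * rnorm u.
Proof.
move=> /bounded_operatorP[lT [K [K0 hK]]]; exists (K * rnorm v) => u.
by rewrite (le_trans (cmod_ip hip _ _))// mulrAC ler_wpM2r ?rnorm_ge0.
Qed.

Lemma op_func_ext T S v w : bounded_operator T -> bounded_operator S ->
  (forall i, adm i -> ip (T (e i)) v = ip (S (e i)) w) ->
  forall u, ip (T u) v = ip (S u) w.
Proof.
move=> bT bS h u; have [lT _] := bT; have [lS _] := bS.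
have [K hK] := ip_func_bound v bT; have [L hL] := ip_func_bound w bS.
apply/eqP; rewrite -subr_eq0; apply/eqP.
apply: (func_ext (phi := fun u => ip (T u) v - ip (S u) w) (K := K + L)).
- by move=> a x y; rewrite lT lS !ipDl !ipZl mulrBr opprD addrACA.
- move=> y; rewrite mulrDl.
  have := ler_normB (ip (T y) v) (ip (S y) w).
  rewrite !cmodE -rcD lecR => /le_trans; apply; exact: lerD.
- by move=> i ai; rewrite h// subrr.
Qed.

Lemma op_ext T S : bounded_operator T -> bounded_operator S ->
  (forall i, adm i -> T (e i) = S (e i)) -> T = S.
Proof.
move=> bT bS h; apply/funext => u; apply/eqP; rewrite -subr_eq0; apply/eqP.
apply: (ip_eq0P hip) => w; rewrite ipBl (op_func_ext (w := w) bT bS) ?subrr//.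
by move=> i /h ->.
Qed.

(** All operators below are built here: the partial sums are uniformly bounded
    and stationary on the dense span of the basis, hence they converge at each
    vector. *)
Lemma ext_op f (M : R) : 0 <= M -> (forall N u, rnorm (partial_sum f N u) <= M * rnorm u) ->
  exists T, [/\ linear T, forall u, rnorm (T u) <= M * rnorm u,
    forall i, adm i -> T (e i) = f i & forall u, tends (fun N => partial_sum f N u) (T u)].
Proof.
move=> M0 hM.
have ex u : exists l, tends (fun N => partial_sum f N u) l.
  apply: cauchy_tends => d d0.
  have M1 : 0 < 2 * M + 1 by rewrite ltr_wpDl// mulr_ge0.
  have [r hr] := e_dense u (divr_gt0 d0 M1).
  set v := \sum_(x <- r) _ in hr.
  have [N hN] : exists N, forall n, (N <= n)%N -> partial_sum f n v = partial_sum f N v.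
    exists (\max_(x <- r) (g x.2).+1) => n nN.
    rewrite /v !(linear_comb _ _ _ (@partial_sum_lin f _)); apply: eq_big_seq => x xr.
    have gx : (g x.2 < \max_(x <- r) (g x.2).+1)%N.
      by rewrite (@leq_bigmax_seq _ r predT (fun x => (g x.2).+1)).
    by rewrite !partial_sum_e !mem_ball gx (leq_trans gx nN).
  exists N => n m hn1 hm1.
  have -> : partial_sum f n u - partial_sum f m u = partial_sum f n (u - v) - partial_sum f m (u - v).
    rewrite !(linear_sub _ _ (@partial_sum_lin f _)) (hN n)// (hN m)//.
    by rewrite opprB addrA subrK.
  have h1 := hM n (u - v); have h2 := hM m (u - v).
  move: hr; rewrite ltr_pdivlMr// => hr.
  have := rnormD (partial_sum f n (u - v)) (- partial_sum f m (u - v)); rewrite rnormN.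
  have := rnorm_ge0 (u - v); nra.
have [T hT] := boolp.choice ex.
exists T; split=> //.
- move=> a u v; apply: (tends_unique (hT _)).
  have h := tendsD (tends_bounded (T := fun w => a *: w) _ (hT u)) (hT v).
  have -> : (fun N => partial_sum f N (a *: u + v)) =
    (fun n => (fun w => a *: w) (partial_sum f n u) + partial_sum f n v).
    by apply/funext => n; rewrite partial_sum_lin.
  apply: h; apply: bounded_scale; split=> //.
  by exists 1 => w; rewrite mul1r.
- by move=> u; apply: (tends_rnorm_le (hT u)).
- move=> i ai; apply: (tends_unique (hT _)).
  apply: (tends_eventually (N := (g i).+1)) => n ni.
  by rewrite partial_sum_e mem_ball ai ni.
Qed.

Lemma rnorm_partial_sum N u : rnorm (partial_sum e N u) <= rnorm u.
Proof.
rewrite -(@ler_sqr _ (rnorm _)) ?nnegrE ?rnorm_ge0//.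
by rewrite (rnorm_comb hip e_on) ?adm_ball// (bessel hip e_on)// adm_ball.
Qed.

Lemma partial_sum_tends u : tends (fun N => partial_sum e N u) u.
Proof.
have [|T [lT bT Te hT]] := @ext_op e 1 ler01.
  by move=> N v; rewrite mul1r rnorm_partial_sum.
suff E : T = id by have := hT u; rewrite E.
apply: op_ext.
- apply/bounded_operatorP; split=> //; by exists 1.
- by split=> //; exists 1 => w; rewrite mul1r.
- exact: Te.
Qed.

(** Vectors are determined by their coefficients, so identities between
    vectors may be tested on the basis. *)
Lemma coef_eq0 u : (forall i, adm i -> ip u (e i) = 0) -> u = 0.
Proof.
move=> h; apply: (tends_unique (partial_sum_tends u)).
apply: (tends_eventually (N := 0%N)) => n _; rewrite /partial_sum big1_seq// => i /andP[_ iN].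
by rewrite h ?scale0r// (allP (adm_ball n)).
Qed.

Lemma coef_eq u v : (forall i, adm i -> ip u (e i) = ip v (e i)) -> u = v.
Proof.
move=> h; apply/eqP; rewrite -subr_eq0; apply/eqP/coef_eq0 => i /h hi.
by rewrite ipBl hi subrr.
Qed.

Lemma finite_expansion N u :
  (forall i, adm i -> (N <= g i)%N -> ip u (e i) = 0) -> u = partial_sum e N u.
Proof.
move=> h; apply: coef_eq => i ai; rewrite (ip_comb e_on)// ?adm_ball//.
rewrite mem_ball ai /=; case: leqP => //; exact: h.
Qed.

Definition adjoint T S := forall u v, ip (T u) v = ip u (S v).

Lemma adjoint_sym T S : adjoint T S -> adjoint S T.
Proof. by move=> h u v; rewrite ipC -h -ipC. Qed.

Lemma adjoint_ext T S : bounded_operator T -> bounded_operator S ->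
  (forall i j, adm i -> adm j -> ip (T (e i)) (e j) = ip (e i) (S (e j))) ->
  adjoint T S.
Proof.
move=> bT bS h u v.
have bid : bounded_operator (@id H) by split=> //; exists 1 => w; rewrite mul1r.
have h1 j : adm j -> forall x, ip (T x) (e j) = ip x (S (e j)).
  by move=> aj; apply: (op_func_ext (S := id)) => // i ai; exact: h.
have -> : ip (T u) v = (ip v (T u))^*%C by rewrite -ipC.
have -> : ip u (S v) = (ip (S v) u)^*%C by rewrite -ipC.
congr (_^*%C); apply: (op_func_ext (T := id)) => // i ai.
by rewrite ipC h1// -ipC.
Qed.

Let p0 := gb_rate gb.
Let C0 := gb_const gb.
Let ball_sum := gb_sum gb.

Local Notation G i := ((g i).+1%:R : R).

Lemma C0_ge0 : 0 <= C0.
Proof.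
apply: le_trans (ball_sum 0); apply: sumr_ge0 => i _.
by rewrite invr_ge0 exprn_ge0.
Qed.

Definition degree_close (N : nat) i j := (g i <= g j + N)%N && (g j <= g i + N)%N.

Lemma degree_close_sym N i j : degree_close N i j = degree_close N j i.
Proof. by rewrite /degree_close andbC. Qed.

(** Matrix elements vanish away from a band around the diagonal.  With it, the
    image of a basis vector is a finite sum, and decay in the degree survives
    compositions on both sides. *)
Definition banded N T := forall i j, adm i -> adm j -> ~~ degree_close N i j ->
  ip (T (e i)) (e j) = 0.
Definition rapid f := forall p, exists K : R, forall i, adm i ->
  rnorm (f i) * G i ^+ p <= K.
Definition smoothing T :=
  [/\ bounded_operator T, exists N, banded N T & rapid (T \o e)].

(** Inside the band the degrees of [i] and [j] are comparable, so the power of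
    the degree of [i] is absorbed by the decay of [f j]. *)
Lemma rapid_band f N p : rapid f -> exists K : R, forall i M,
  \sum_(j <- ball M | degree_close N i j) rnorm (f j) * G i ^+ p <= K.
Proof.
move=> /(_ (p + p0)%N)[K hK]; exists (N.+1%:R ^+ p * `|K| * C0) => i M.
apply: le_trans (_ : \sum_(j <- ball M) N.+1%:R ^+ p * `|K| * (G j ^- p0) <= _); last first.
  by rewrite -mulr_sumr ler_wpM2l// mulr_ge0// exprn_ge0.
rewrite big_mkcond /=; apply: ler_sum_mem => j jM.
case: ifP => [nij|_]; last by rewrite !mulr_ge0// ?exprn_ge0// invr_ge0 exprn_ge0.
rewrite ler_pdivlMr ?exprn_gt0// -mulrA.
have aj : adm j by apply: (allP (adm_ball M)).
have hp : G i ^+ p <= N.+1%:R ^+ p * G j ^+ p.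
  rewrite -exprMn lerXn2r ?nnegrE ?mulr_ge0// -natrM ler_nat.
  by move: nij => /andP[]; nia.
apply: le_trans (_ : rnorm (f j) * (N.+1%:R ^+ p * G j ^+ p * G j ^+ p0) <= _).
  by rewrite ler_wpM2l ?rnorm_ge0// ler_wpM2r ?exprn_ge0.
rewrite -mulrA mulrCA ler_wpM2l ?exprn_ge0// -exprD.
exact: le_trans (hK _ aj) (ler_norm _).
Qed.

Lemma rnorm_e i : adm i -> rnorm (e i) = 1.
Proof.
move=> ai; apply/eqP; rewrite -(@eqrXn2 _ 2%N) ?rnorm_ge0// expr1n; apply/eqP.
by apply: complexI; rewrite -(ip_rnorm hip) e_on// eqxx.
Qed.

Lemma coef_le u i : adm i -> cmod (ip u (e i)) <= rnorm u.
Proof. by move=> ai; rewrite (le_trans (cmod_ip hip _ _))// rnorm_e// mulr1. Qed.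

Lemma band_expansion N T i : banded N T -> adm i ->
  T (e i) = \sum_(j <- ball (g i + N).+1 | degree_close N i j) ip (T (e i)) (e j) *: e j.
Proof.
move=> bT ai; rewrite [LHS](finite_expansion (N := (g i + N).+1)).
  rewrite /partial_sum [RHS]big_mkcond /=; apply: eq_big_seq => j jM.
  by case: ifPn => // nij; rewrite bT ?scale0r// (allP (adm_ball (g i + N).+1)).
move=> j aj h; rewrite bT// /degree_close negb_and orbC -!ltnNge; apply/orP; left; lia.
Qed.

(** A rapidly decreasing family is absolutely summable, so it defines an
    operator. *)
Lemma smoothing_ext f N : rapid f ->
  (forall i j, adm i -> adm j -> ~~ degree_close N i j -> ip (f i) (e j) = 0) ->
  exists2 T, smoothing T & forall i, adm i -> T (e i) = f i.
Proof.
move=> rf bf; have [K hK] := rf p0.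
have [|M u|T [lT bT Te _]] := @ext_op f (`|K| * C0).
- by rewrite mulr_ge0 ?C0_ge0.
- apply: le_trans (rnorm_sum _ _) _; rewrite mulrAC.
  apply: le_trans (_ : \sum_(i <- ball M) `|K| * rnorm u * (G i ^- p0) <= _); last first.
    by rewrite -mulr_sumr ler_wpM2l// mulr_ge0 ?rnorm_ge0.
  apply: ler_sum_mem => i iM.
  have ai : adm i by apply: (allP (adm_ball M)).
  rewrite rnormZ -/(cmod _) ler_pdivlMr ?exprn_gt0// -mulrA mulrC.
  apply: ler_pM; rewrite ?cmod_ge0 ?mulr_ge0 ?exprn_ge0 ?rnorm_ge0 ?coef_le//.
  exact: le_trans (hK _ ai) (ler_norm _).
exists T => //; split.
- apply/bounded_operatorP; split=> //; exists (`|K| * C0); split=> //.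
  by rewrite mulr_ge0 ?C0_ge0.
- by exists N => i j ai aj nij; rewrite Te// bf.
- move=> p; have [L hL] := rf p; exists L => i ai /=; rewrite Te//; exact: hL.
Qed.

Definition banded_operator T := bounded_operator T /\ exists N, banded N T.

Lemma smoothing_banded_operator T : smoothing T -> banded_operator T.
Proof. by case. Qed.

Lemma bandedW N M T : (N <= M)%N -> banded N T -> banded M T.
Proof.
move=> NM h i j ai aj nij; apply: h => //; apply: contraNN nij.
by rewrite /degree_close => /andP[h1 h2]; lia.
Qed.

Lemma banded_operator_add T S : banded_operator T -> banded_operator S -> banded_operator (fun u => T u + S u).
Proof.
move=> [bT [N hN]] [bS [M hM]]; split; first exact: bounded_add.
exists (maxn N M) => i j ai aj nij; rewrite ipDl.
by rewrite (bandedW (leq_maxl N M) hN)// (bandedW (leq_maxr N M) hM)// addr0.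
Qed.

Lemma banded_operator_scale a T : banded_operator T -> banded_operator (fun u => a *: T u).
Proof.
move=> [bT [N hN]]; split; first exact: bounded_scale.
by exists N => i j ai aj nij; rewrite ipZl hN// mulr0.
Qed.

Lemma linear_comb_if T (r : seq I) (P : pred I) (a : I -> R[i]) : linear T ->
  T (\sum_(k <- r | P k) a k *: e k) = \sum_(k <- r | P k) a k *: T (e k).
Proof. by move=> lT; rewrite -big_filter (linear_comb _ _ _ lT) big_filter. Qed.

Lemma banded_comp N M T S : linear T -> banded N T -> banded M S ->
  banded (M + N) (fun u => T (S u)).
Proof.
move=> lT hN hM i j ai aj nij; rewrite (band_expansion hM ai) linear_comb_if//.
rewrite -big_filter ip_suml big1_seq// => k; rewrite mem_filter => /andP[_ /andP[nik kM]].
have ak : adm k by apply: (allP (adm_ball _) _ kM).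
rewrite ipZl hN ?mulr0//; apply: contraNN nij; move: nik.
by rewrite /degree_close; lia.
Qed.

Lemma banded_operator_comp T S : banded_operator T -> banded_operator S -> banded_operator (fun u => T (S u)).
Proof.
move=> [bT [N hN]] [bS [M hM]]; split; first exact: bounded_comp.
by exists (M + N)%N; apply: banded_comp => //; case: bT.
Qed.

Lemma smoothing_add T S : smoothing T -> smoothing S ->
  smoothing (fun u => T u + S u).
Proof.
move=> sT sS; have [b n] := banded_operator_add (smoothing_banded_operator sT) (smoothing_banded_operator sS).
split=> // p; have [_ _ /(_ p)[K hK]] := sT; have [_ _ /(_ p)[L hL]] := sS.
exists (K + L) => i ai; apply: le_trans (lerD (hK _ ai) (hL _ ai)).
by rewrite -mulrDl ler_wpM2r ?exprn_ge0// rnormD.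
Qed.

Lemma smoothing_scale a T : smoothing T -> smoothing (fun u => a *: T u).
Proof.
move=> sT; have [b n] := banded_operator_scale a (smoothing_banded_operator sT).
split=> // p; have [_ _ /(_ p)[K hK]] := sT.
exists (cmod a * K) => i ai /=; rewrite rnormZ -mulrA ler_wpM2l ?cmod_ge0//.
exact: hK.
Qed.

Lemma smoothing_compl T S : banded_operator T -> smoothing S ->
  smoothing (fun u => T (S u)).
Proof.
move=> tT sS; have [b n] := banded_operator_comp tT (smoothing_banded_operator sS).
split=> // p; have [_ _ /(_ p)[K hK]] := sS.
have [/bounded_operatorP[_ [L [L0 hL]]] _] := tT.
exists (L * K) => i ai /=; apply: le_trans (_ : L * rnorm (S (e i)) * G i ^+ p <= _).
  by rewrite ler_wpM2r ?exprn_ge0.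
by rewrite -mulrA ler_wpM2l// hK.
Qed.

(** [T] sends a basis vector to a combination of basis vectors of comparable
    degree, on each of which [S] is small. *)
Lemma smoothing_compr T S : smoothing S -> banded_operator T ->
  smoothing (fun u => S (T u)).
Proof.
move=> sS tT; have [b n] := banded_operator_comp (smoothing_banded_operator sS) tT.
split=> // p; have [[lS _] _ rS] := sS.
have [/bounded_operatorP[_ [L [L0 hL]]] [N hN]] := tT.
have [K hK] := rapid_band N p rS; exists (L * K) => i ai /=.
rewrite (band_expansion hN ai) linear_comb_if//.
apply: le_trans (_ : (\sum_(j <- ball (g i + N).+1 | degree_close N i j)
   L * rnorm (S (e j))) * G i ^+ p <= _); last first.
  by rewrite -mulr_sumr -mulrA mulr_suml ler_wpM2l// hK.
rewrite ler_wpM2r ?exprn_ge0// -big_filter -[leRHS]big_filter (le_trans (rnorm_sum _ _))//.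
apply: ler_sum_mem => j; rewrite mem_filter => /andP[_ jM].
rewrite rnormZ ler_wpM2r ?rnorm_ge0// -/(cmod _).
have aj : adm j by apply: (allP (adm_ball _) _ jM).
by rewrite (le_trans (coef_le _ aj))// (le_trans (hL _))// rnorm_e// mulr1.
Qed.

(** Existence of the adjoint comes with the smoothing property: its columns
    are the conjugate rows of [S], which decrease because of the band. *)
Lemma smoothing_adjoint S : smoothing S ->
  exists2 S', smoothing S' & adjoint S' S.
Proof.
move=> sS; have [bS [N hN] rS] := sS.
pose f i := \sum_(j <- ball (g i + N).+1 | degree_close N i j) (ip (S (e j)) (e i))^*%C *: e j.
have fE i j : adm i -> adm j -> ip (f i) (e j) = (ip (S (e j)) (e i))^*%C.
  move=> ai aj; rewrite /f -big_filter (ip_comb e_on)//.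
  - rewrite mem_filter mem_ball aj /=; case: ifPn => // hij.
    rewrite hN ?conjc0// degree_close_sym; apply: contraNN hij => nij.
    by rewrite nij /=; move: nij; rewrite /degree_close; lia.
  - exact: filter_uniq.
  - by apply/allP => k; rewrite mem_filter => /andP[_]; apply: (allP (adm_ball _)).
have [|i j ai aj nij|T sT Te] := @smoothing_ext f N.
- move=> p; have [K hK] := rapid_band N p rS; exists K => i ai.
  apply: le_trans (hK i (g i + N).+1); rewrite -mulr_suml ler_wpM2r ?exprn_ge0//.
  rewrite /f -big_filter -[leRHS]big_filter (le_trans (rnorm_sum _ _))//.
  apply: ler_sum_mem => j; rewrite mem_filter => /andP[_ jM].
  have aj : adm j by apply: (allP (adm_ball _) _ jM).
  by rewrite rnormZ rnorm_e// mulr1 -/(cmod _) cmodJ coef_le.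
- by rewrite fE// hN ?conjc0// degree_close_sym.
exists T => //; apply: adjoint_ext => //; first by case: sT.
by move=> i j ai aj; rewrite Te// fE// -ipC.
Qed.

Section WeightedShift.
Variables (c : I -> R) (t : I -> I) (K : R).
Hypothesis t_inj : injective t.
Hypothesis cK : forall i, adm i -> `|c i| <= K.

Definition is_shift T := bounded_operator T /\
  forall i, adm i -> T (e i) = (c i)%:C%C *: e (t i).

(** The images of distinct basis vectors are orthogonal, so the operator is
    bounded by the supremum of the weights, by Bessel's inequality. *)
Lemma shift_ex : exists T, is_shift T.
Proof.
have [|N u|T [lT bT Te _]] := @ext_op (fun i => (c i)%:C%C *: e (t i)) `|K|.
- exact: normr_ge0.
- rewrite -(@ler_sqr _ (rnorm _)) ?nnegrE ?mulr_ge0 ?rnorm_ge0//.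
  pose r := [seq i <- ball N | adm (t i)].
  have -> : partial_sum (fun i => (c i)%:C%C *: e (t i)) N u =
    \sum_(i <- r) (ip u (e i) * (c i)%:C%C) *: e (t i).
    rewrite /partial_sum /r big_filter [RHS]big_mkcond /=; apply: eq_bigr => i _.
    by rewrite scalerA; case: ifPn => // /e_out ->; rewrite scaler0.
  have [|/negPf r0] := boolP (0 < size (ball N))%N; last first.
    have : ball N = [::] by case: (ball N) r0.
    by rewrite /r => -> /=; rewrite big_nil rnorm0 expr0n sqr_ge0.
  case E: (ball N) => [//|i0 b'] _; have {E b'} i0 := i0.
  pose s k := nth i0 r (index k (map t r)).
  have sK i : i \in r -> s (t i) = i.
    by move=> ir; rewrite /s index_map// nth_index.
  have -> : \sum_(i <- r) (ip u (e i) * (c i)%:C%C) *: e (t i) =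
    \sum_(k <- map t r) (ip u (e (s k)) * (c (s k))%:C%C) *: e k.
    by rewrite big_map; apply: eq_big_seq => i ir; rewrite sK.
  rewrite (rnorm_comb hip e_on); last 2 first.
  + by rewrite (map_inj_uniq t_inj) filter_uniq.
  + by apply/allP => k /mapP; case=> i; rewrite mem_filter => /andP[? _] ->.
  rewrite big_map.
  apply: le_trans (_ : \sum_(i <- r) `|K| ^+ 2 * cmod (ip u (e i)) ^+ 2 <= _).
    apply: ler_sum_mem => i ir; rewrite sK//.
    move: ir; rewrite mem_filter => /andP[_ ir].
    rewrite cmodM exprMn mulrC ler_wpM2r ?sqr_ge0// ler_sqr ?nnegrE ?cmod_ge0//.
    rewrite cmodR (le_trans (cK _)) ?ler_norm//; exact: (allP (adm_ball _) _ ir).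
  rewrite -mulr_sumr exprMn ler_wpM2l ?sqr_ge0//.
  apply: (bessel hip e_on); first exact: filter_uniq.
  by apply/allP => i; rewrite mem_filter => /andP[_]; apply: (allP (adm_ball _)).
exists T; split=> //; apply/bounded_operatorP; split=> //.
by exists `|K|.
Qed.

End WeightedShift.

End GradedBasis.

(** * Self-adjoint operators that are diagonal up to an involution *)

(** The value l + 3/2 in terms of the degree n = 2 l + 1. *)
Definition dirac_eigenvalue (R : realType) (n : nat) : R := (n%:R + 2) / 2.

Section Diag.
Variables (R : realType) (H : completeNormedModType R[i]).
Variable ip : {dot H for (@Num.conj R[i])}.
Variables (I : eqType) (e : I -> H) (adm : pred I) (g : I -> nat).
Variable ball : nat -> seq I.
Hypothesis gb : graded_basis ip e adm g ball.
Let hip := gb_hilbert gb.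
Let e_on := gb_on gb.
Let e_out := gb_out gb.
Let e_dense := gb_dense gb.
Let mem_ball := gb_ball gb.
Let uniq_ball := gb_uniq gb.
Let p0 := gb_rate gb.
Let C0 := gb_const gb.
Let ball_sum := gb_sum gb.
Local Notation G i := ((g i).+1%:R : R).
Local Notation smoothing := (smoothing ip e adm g).
Local Notation adm_ball := (adm_ball gb).
Local Notation partial_sum := (partial_sum ip e ball).
Local Notation adjoint := (adjoint ip).
Implicit Types (u v w : H) (T S : H -> H) (f : I -> H).

Section DiagonalOperator.
Variable A : unbounded_operator H.
Hypothesis sA : self_adjoint ip A.
Variable s : I -> I.
Hypothesis sK : involutive s.
Hypothesis s_adm : forall i, adm (s i) = adm i.
Hypothesis s_g : forall i, g (s i) = g i.
Hypothesis A_e : forall i, adm i ->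
  dom A (e i) /\ A (e i) = (dirac_eigenvalue R (g i))%:C%C *: e (s i).

Lemma self_adjoint_sym u v : dom A u -> dom A v -> ip (A u) v = ip u (A v).
Proof. by move=> du dv; have [_ h] := sA; apply: (h v (A v)).1. Qed.

(** The basis is a core: both [A x] and [x] are limits of their partial sums,
    and the self-adjointness of [A], tested on partial sums, is the equality of
    coefficients.  This describes the domain of [A] without spectral theory,
    and applies both to D (with the exchange of chiralities as involution) and
    to |D|. *)
Lemma diag_criterion u w : (dom A u /\ A u = w) <->
  forall i, adm i -> (dirac_eigenvalue R (g i))%:C%C * ip u (e (s i)) = ip w (e i).
Proof.
have [_ h] := sA; rewrite h; split=> [huw i ai|huw x dx].
  have [di Ai] := A_e ai; rewrite ipC [RHS]ipC -huw// Ai ipZl conjcM.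
  by rewrite conjc_real -ipC.
have PN N : ip (partial_sum e N (A x)) u = ip (partial_sum e N x) w.
  rewrite /partial_sum !ip_suml.
  have pb : perm_eq (map s (ball N)) (ball N).
    apply: uniq_perm => // [|i]; first by rewrite (map_inj_uniq (inv_inj sK)).
    by rewrite -[i in LHS]sK (mem_map (inv_inj sK)) !mem_ball s_adm s_g.
  rewrite -[RHS](perm_big _ pb) big_map; apply: eq_big_seq => i iN.
  have ai : adm i by apply: (allP (adm_ball _) _ iN).
  have [di Ai] := A_e ai; rewrite !ipZl (self_adjoint_sym dx di) Ai ipZr conjc_real.
  have := huw (s i); rewrite s_adm sK s_g => /(_ ai) h1.
  rewrite [ip (e i) u]ipC [ip (e (s i)) w]ipC -h1 conjcM conjc_real; ring.
apply/eqP; rewrite -subr_eq0 -cmod_eq0; apply/negPn/negP => n0.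
have d0 : 0 < cmod (ip (A x) u - ip x w) by rewrite lt_def n0 cmod_ge0.
have K0 : 0 < 2 * (rnorm u + rnorm w + 1).
  by rewrite mulr_gt0// ltr_wpDl// addr_ge0 ?rnorm_ge0.
have [N hN] := partial_sum_tends gb (A x) (divr_gt0 d0 K0).
have [M hM] := partial_sum_tends gb x (divr_gt0 d0 K0).
pose n := maxn N M; have h1 := hN n (leq_maxl _ _); have h2 := hM n (leq_maxr _ _).
have h3 := cmod_ip hip (partial_sum e n (A x) - A x) u.
have h4 := cmod_ip hip (partial_sum e n x - x) w.
have : cmod (ip (A x) u - ip x w) <=
  cmod (ip (partial_sum e n (A x) - A x) u) + cmod (ip (partial_sum e n x - x) w).
  rewrite -lecR rcD -!cmodE !ipBl PN.
  have -> : ip (A x) u - ip x w = (ip (partial_sum e n x) w - ip x w) -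
    (ip (partial_sum e n x) w - ip (A x) u) by ring.
  by rewrite [leRHS]addrC; apply: ler_normB.
move: h1 h2; rewrite !ltr_pdivlMr// => h1 h2 h5.
have p0' := rnorm_ge0 u; have r0' := rnorm_ge0 w.
move: d0 n0 h1 h2 h3 h4 h5 K0; set a := rnorm (_ - A x); set b := rnorm (_ - x).
set p := rnorm u; set r := rnorm w; set d := cmod (_ - _); set K := 2 * _.
move=> d0 _ h1 h2 h3 h4 h5 K0.
have h6 : a * K * p <= d * p by rewrite ler_wpM2r// ltW.
have h7 : b * K * r <= d * r by rewrite ler_wpM2r// ltW.
have h8 : d * K <= (a * p + b * r) * K.
  by rewrite ler_wpM2r ?(ltW K0)// (le_trans h5)// lerD.
have h9 : d * p + d * r < d * K by rewrite -mulrDr ltr_pM2l// /K; lra.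
clearbody K; lra.
Qed.

(** By the criterion, the commutator needs to be computed only against basis
    vectors, which amounts to a computation with the adjoints on the basis. *)
Lemma bounded_commutator_adjoint T T' S S' : bounded_operator S -> adjoint T' T -> adjoint S' S ->
  (forall i, adm i -> dom A (T' (e i)) /\ T' (A (e i)) = A (T' (e i)) + S' (e i)) ->
  bounded_commutator A T S.
Proof.
move=> bS aT aS h; split=> // v dv.
have [d1 d2] : dom A (T v) /\ A (T v) = S v + T (A v).
  apply/diag_criterion => i ai; have [di Ai] := A_e ai.
  have [dT hT] := h i ai.
  have -> : (dirac_eigenvalue R (g i))%:C%C * ip (T v) (e (s i)) = ip (T v) (A (e i)).
    by rewrite Ai ipZr conjc_real.
  rewrite ipDl (adjoint_sym aT) (adjoint_sym aT) (adjoint_sym aS) hT ipDr.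
  by rewrite (self_adjoint_sym dv dT) addrC.
by split=> //; rewrite d2 addrK.
Qed.

Lemma size_ball M : (size (ball M))%:R <= C0 * M%:R ^+ p0.
Proof.
have [->|M0] := posnP M.
  have -> : ball 0 = [::].
    by case E: (ball 0) => [//|i b]; have := mem_ball 0 i; rewrite E inE eqxx andbF.
  by rewrite /= mulr_ge0 ?exprn_ge0// (C0_ge0 gb).
rewrite -ler_pdivrMr ?exprn_gt0 ?ltr0n// -sum1_size natr_sum mulr_suml.
apply: le_trans (ball_sum M); apply: ler_sum_mem => i.
rewrite mem_ball => /andP[_ iM]; rewrite mul1r lef_pV2 ?posrE ?exprn_gt0 ?ltr0n//.
by rewrite lerXn2r ?nnegrE ?ler0n// ler_nat.
Qed.

(** The eigenvalues grow linearly in the degree, which rapid decay absorbs. *)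
Lemma smoothing_diagl T : smoothing T ->
  exists2 S, smoothing S & forall v, dom A (T v) /\ A (T v) = S v.
Proof.
move=> sT; have [bT [N hN] rT] := sT.
pose f i := \sum_(j <- ball (g i + N).+1)
   (ip (T (e i)) (e (s j)) * (dirac_eigenvalue R (g j))%:C%C) *: e j.
have fE i j : adm i -> adm j ->
    ip (f i) (e j) = ip (T (e i)) (e (s j)) * (dirac_eigenvalue R (g j))%:C%C.
  move=> ai aj; rewrite /f (ip_comb e_on) ?adm_ball//.
  rewrite mem_ball aj /=; case: ltnP => // hij.
  by rewrite hN ?mul0r ?s_adm// /degree_close s_g; apply/negP => /andP[]; lia.
have [||S sS Se] := @smoothing_ext _ _ _ _ _ _ _ _ gb f N.
- move=> p; have [L hL] := rT (p + p0.+1)%N.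
  exists (C0 * N.+1%:R ^+ p0.+1 * L) => i ai.
  set M := (g i + N).+1.
  have hM : rnorm (f i) <= C0 * M%:R ^+ p0.+1 * rnorm (T (e i)).
    apply: le_trans (_ : (size (ball M))%:R * (M%:R * rnorm (T (e i))) <= _); last first.
      by rewrite exprSr !mulrA ler_wpM2r ?rnorm_ge0// ler_wpM2r// size_ball.
    rewrite -sum1_size natr_sum mulr_suml.
    rewrite /f (le_trans (rnorm_sum _ _))//.
    apply: ler_sum_mem => j jM; have aj : adm j by apply: (allP (adm_ball _) _ jM).
    rewrite mul1r rnormZ (rnorm_e gb)// mulr1 -/(cmod _) cmodM cmodR mulrC.
    have gj : G j <= M%:R by rewrite ler_nat; move: jM; rewrite mem_ball => /andP[_].
    have l0 : 0 <= dirac_eigenvalue R (g j) by rewrite divr_ge0// addr_ge0.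
    have lj : `|dirac_eigenvalue R (g j)| <= M%:R.
      rewrite ger0_norm// (le_trans _ gj)// ler_pdivrMr// -natr1.
      have : 0 <= (g j)%:R :> R by [].
      by lra.
    by apply: ler_pM => //; rewrite ?cmod_ge0// (coef_le gb)// s_adm.
  apply: le_trans (_ : C0 * N.+1%:R ^+ p0.+1 * (rnorm (T (e i)) * G i ^+ (p + p0.+1)) <= _).
    apply: le_trans (_ : C0 * M%:R ^+ p0.+1 * rnorm (T (e i)) * G i ^+ p <= _).
      by rewrite ler_wpM2r ?exprn_ge0.
    rewrite -!mulrA ler_wpM2l ?(C0_ge0 gb)// exprD.
    rewrite mulrCA [leRHS]mulrCA ler_wpM2l ?rnorm_ge0//.
    rewrite [G i ^+ p * _]mulrC mulrA ler_wpM2r ?exprn_ge0//.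
    by rewrite -exprMn lerXn2r ?nnegrE ?mulr_ge0 ?ler0n// -natrM ler_nat /M; nia.
  by rewrite ler_wpM2l ?hL// mulr_ge0 ?exprn_ge0 ?(C0_ge0 gb).
- move=> i j ai aj nij; rewrite fE// hN ?mul0r ?s_adm//.
  by apply: contraNN nij; rewrite /degree_close s_g.
exists S => // v; apply/diag_criterion => i ai.
have bS : bounded_operator S by case: sS.
transitivity (ip (T v) ((dirac_eigenvalue R (g i))%:C%C *: e (s i))).
  by rewrite ipZr conjc_real.
apply: (op_func_ext gb) => // j aj; rewrite Se// fE// ipZr conjc_real mulrC//.
Qed.

(** Adjoint of the previous statement applied to the adjoint of [T]. *)
Lemma smoothing_diagr T : smoothing T ->
  exists2 S, smoothing S & forall v, dom A v -> T (A v) = S v.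
Proof.
move=> sT; have [T' sT' aT] := smoothing_adjoint gb sT.
have [S' sS' hS'] := smoothing_diagl sT'.
have [S sS aS] := smoothing_adjoint gb sS'.
exists S => // v dv; apply/eqP; rewrite -subr_eq0; apply/eqP/(ip_eq0P hip) => w.
rewrite ipBl aS; have [d <-] := hS' w.
rewrite -(self_adjoint_sym dv d) -(adjoint_sym aT) subrr//.
Qed.

Lemma smoothing_bounded_commutator T : smoothing T ->
  exists2 S, smoothing S & bounded_commutator A T S.
Proof.
move=> sT; have [S1 sS1 h1] := smoothing_diagl sT.
have [S2 sS2 h2] := smoothing_diagr sT.
have sS : smoothing (fun v => S1 v + -1 *: S2 v).
  exact: (smoothing_add gb sS1 (smoothing_scale (-1) sS2)).
exists (fun v => S1 v + -1 *: S2 v) => //; split; first by case: sS.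
move=> v dv; have [d1 d2] := h1 v; split=> //.
by rewrite d2 h2// scaleN1r.
Qed.

End DiagonalOperator.

Section Smoothing.
Variable E : unbounded_operator H.
Hypothesis sE : self_adjoint ip E.
Hypothesis E_e : forall i, adm i ->
  dom E (e i) /\ E (e i) = (dirac_eigenvalue R (g i))%:C%C *: e i.

Lemma smoothing_OP0 T : smoothing T -> OP0 E T.
Proof.
move=> sT n; elim: n T sT => [|n IH] T sT; first by split => //; case: sT.
split; first by case: sT.
have [S sS bcS] := @smoothing_bounded_commutator E sE id (fun _ => erefl) (fun _ => erefl) (fun _ => erefl) E_e _ sT.
by exists S; split=> //; apply: IH.
Qed.

(** Both |D| T and [|D|, T] are again smoothing, so all the iterated domains
    contain [T]. *)
Lemma smoothing_OPminf T : smoothing T -> OPminf E T.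
Proof.
move=> sT; split; first exact: smoothing_OP0.
suff h k : exists2 S, smoothing S &
    forall v, dom (op_pow E k) (T v) /\ op_pow E k (T v) = S v.
  move=> k; have [S sS hS] := h k; split=> [v|]; first by have [] := hS v.
  have -> : (fun v => op_pow E k (T v)) = S by apply/funext => v; have [] := hS v.
  exact: smoothing_OP0.
elim: k => [|k [S sS hS]]; first by exists T.
have [S1 sS1 hS1] := @smoothing_diagl E sE id (fun _ => erefl) (fun _ => erefl) (fun _ => erefl) E_e _ sS.
exists S1 => // v; have [d1 e1] := hS v; have [d2 e2] := hS1 v.
by split; [split=> //; rewrite e1|rewrite /= e1].
Qed.

End Smoothing.

Section AbsoluteValue.
Variables D E : unbounded_operator H.
Hypothesis sD : self_adjoint ip D.
Hypothesis DE : is_absolute_value ip D E.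
Variable s : I -> I.
Hypothesis sK : involutive s.
Hypothesis s_adm : forall i, adm (s i) = adm i.
Hypothesis s_g : forall i, g (s i) = g i.
Hypothesis D_e : forall i, adm i ->
  dom D (e i) /\ D (e i) = (dirac_eigenvalue R (g i))%:C%C *: e (s i).

Lemma self_adjoint_lin A a u v : self_adjoint ip A -> dom A u -> dom A v ->
  dom A (a *: u + v) /\ A (a *: u + v) = a *: A u + A v.
Proof.
move=> [_ h] du dv; apply/h => x dx.
by rewrite !ipDr !ipZr (h u (A u)).1// (h v (A v)).1.
Qed.

(** The absolute value is known only through its square, self-adjointness and
    positivity; that these determine it on eigenvectors of the square is
    elementary. *)
Lemma abs_e i : adm i -> dom E (e i) /\ E (e i) = (dirac_eigenvalue R (g i))%:C%C *: e i.
Proof.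
move=> ai; have [sE pE [dE eE]] := DE.
have asi : adm (s i) by rewrite s_adm.
have [d1 D1] := D_e ai; have [d2 D2] := D_e asi.
set l : R[i] := (dirac_eigenvalue R (g i))%:C%C.
have d0 : dom D 0 /\ D 0 = 0.
  by have [_ h] := sD; apply/h => x _; rewrite !ip0r.
have dDs (a : R[i]) j : adm j -> dom D (a *: e j) /\ D (a *: e j) = a *: D (e j).
  move=> aj; have [dj _] := D_e aj; have [d3 D3] := d0.
  by have := self_adjoint_lin a sD dj d3; rewrite !addr0 D3 addr0.
have DDi : dom (op_comp D D) (e i) /\ op_comp D D (e i) = (l * l) *: e i.
  split; first by split=> //; rewrite D1; have [] := dDs l _ asi.
  by rewrite /= D1; have [_ ->] := dDs l _ asi; rewrite D2 sK s_g scalerA.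
have [dd EEi] := DDi; rewrite -dE in dd; have EE := eE _ dd; rewrite EEi /= in EE.
have [de dEe] := dd; split=> //.
(* E^2 e_i = l^2 e_i, so E sends w := (E - l) e_i to - l w; positivity of E
   and of l then leaves only w = 0. *)
pose w := - l *: e i + E (e i).
have [dw Ew] := self_adjoint_lin (- l) sE de dEe.
have Ew' : E w = - l *: w.
  by rewrite /w Ew EE scalerDr scalerA mulrNN addrC.
have := pE w dw; rewrite Ew' ipZl ip_rnorm// mulNr oppr_ge0 -rcM lecR => h.
have l0 : 0 < dirac_eigenvalue R (g i) by rewrite divr_gt0// ltr_wpDl.
have : rnorm w ^+ 2 <= 0 by rewrite -(pmulr_rle0 _ l0).
rewrite le_eqVlt ltNge sqr_ge0 orbF expf_eq0 /= rnorm_eq0 /w scaleNr addrC subr_eq0.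
by move=> /eqP.
Qed.

End AbsoluteValue.
End Diag.

(** * Labels of the kets *)
Section Labels.

(** The first bit of an axis tells the letters n and k apart, so that J flips
    it; the second bit tells the index 1 from the index 2. *)
Definition axis := (bool * bool)%type.
Definition label := {ffun axis -> int}.
Implicit Types (v d : label) (i t : axis).

Definition n1 v := v (false, false).
Definition k1 v := v (true, false).
Definition n2 v := v (false, true).
Definition k2 v := v (true, true).

Definition total v : int := n1 v + k1 v + n2 v + k2 v.

Definition admissible_label v :=
  [&& 0 <= n1 v, 0 <= k1 v, 0 <= n2 v, 0 <= k2 v,
      ((n1 v + k1 v) %% 2)%Z == 1 & ((n2 v + k2 v) %% 2)%Z == 1].

Local Notation adm := admissible_label.

Lemma labelD v d t : (v + d) t = v t + d t. Proof. by rewrite ffunE. Qed.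
Lemma labelN v t : (- v) t = - v t. Proof. by rewrite ffunE. Qed.

Lemma adm_ge0 v t : adm v -> 0 <= v t.
Proof. by case/and5P=> ? ? ? ? _; case: t => -[] []. Qed.

Lemma adm_pos v w : (forall t, 0 <= v t) ->
  ((n1 v + k1 v) %% 2)%Z = ((n1 w + k1 w) %% 2)%Z ->
  ((n2 v + k2 v) %% 2)%Z = ((n2 w + k2 w) %% 2)%Z -> adm w -> adm v.
Proof.
move=> h e1 e2 /and5P[_ _ _ _ /andP[/eqP p1 /eqP p2]].
by rewrite /admissible_label !h e1 e2 p1 p2.
Qed.

(** Parities add up, so [v + a + b] can fail to be admissible only by a
    negative coordinate, which both [a] and [b] must move. *)
Lemma adm_corner v (a b : label) : adm v -> adm (v + a) -> adm (v + b) ->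
  ~~ adm (v + a + b) -> exists t, [/\ a t != 0, b t != 0 & v t < - a t - b t].
Proof.
move=> av va vb /negP nab.
have [t ht|h] := pickP [pred t | (v + a + b) t < 0]; last first.
  case: nab; apply: (@adm_pos _ (v + b)) => // [t||].
  - by rewrite leNgt; have /= -> := h t.
  - move: av va; rewrite /admissible_label /n1 /n2 /k1 /k2 !labelD. lia.
  - move: av va; rewrite /admissible_label /n1 /n2 /k1 /k2 !labelD. lia.
exists t; move: ht => /=; have := adm_ge0 t va; have := adm_ge0 t vb.
by rewrite !labelD; move=> *; split; [apply/eqP|apply/eqP|]; lia.
Qed.

Lemma adm_corner2 v (a b : label) : adm v -> adm (v + b) -> adm (v + a + b) ->
  ~~ adm (v + a) -> exists t, [/\ a t != 0, b t != 0 & v t < - a t].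
Proof.
move=> av vb vab /negP na.
have [t ht|h] := pickP [pred t | (v + a) t < 0]; last first.
  case: na; apply: (@adm_pos _ v) => // [t||].
  - by rewrite leNgt; have /= -> := h t.
  - move: av vb vab; rewrite /admissible_label /n1 /n2 /k1 /k2 !labelD. lia.
  - move: av vb vab; rewrite /admissible_label /n1 /n2 /k1 /k2 !labelD. lia.
exists t; move: ht => /=; have := adm_ge0 t av; have := adm_ge0 t vab.
by rewrite !labelD; move=> *; split; [apply/eqP|apply/eqP|]; lia.
Qed.

End Labels.

Notation adml := admissible_label.

(** * Symbols of weighted shifts *)
Section Symbols.
Variables (R : realType) (q : R).
Hypothesis hq : 0 < q < 1.
Implicit Types (v d : label) (i t : axis) (c F G : label -> R) (S : axis -> pred axis).

Let q0 : 0 < q. Proof. by case/andP: hq. Qed.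
Let q1 : q <= 1. Proof. by case/andP: hq => _ /ltW. Qed.

Lemma powq_le (x y : R) : x <= y -> q `^ y <= q `^ x.
Proof. by move=> xy; apply: (@ger_powR _ q) => //; rewrite q0. Qed.

Definition weight i v : R := q `^ (v i)%:~R.

Lemma weight_gt0 i v : 0 < weight i v. Proof. exact: powR_gt0. Qed.
Lemma weight_le1 i v : adml v -> weight i v <= 1.
Proof.
by move=> av; rewrite /weight -[leRHS](powRr0 q) powq_le// ler0z adm_ge0.
Qed.
Lemma weightD i v d : weight i (v + d) = weight i v * weight i d.
Proof. by rewrite /weight labelD intrD powRD// (gt_eqF q0) implybT. Qed.

Definition bounded_on (P : pred label) c := exists K, forall v, P v -> `|c v| <= K.
Definition vanishing_on (P : pred label) i c :=
  exists K, forall v, P v -> `|c v| <= K * weight i v.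
(** The coefficient does not feel the displacement [d] when the coordinate [i]
    goes to infinity; stated without naming the limit function. *)
Definition invariant_on (P : pred label) i d c :=
  exists K, forall v, P v -> P (v + d) -> `|c (v + d) - c v| <= K * weight i v.

Definition supported (P : pred axis) d := forall t, d t != 0 -> P t.

(** Behaviour of the shift by [d] with coefficient [c] as one coordinate [i]
    goes to infinity: either it becomes negligible, or it moves only the axes
    in [S i] and ignores displacements along the axes in [S' i]. *)
Definition regime (P : pred label) S S' d c := bounded_on P c /\
  forall i, vanishing_on P i c \/
    (supported (S i) d /\ forall d', supported (S' i) d' -> invariant_on P i d' c).

Definition active d : pred label := [pred v | adml v && adml (v + d)].

(** The first condition cuts the coefficient off where the target of the shift
    is not admissible, so that composing shifts never passes through a zero
    vector with a nonzero weight. *)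
Definition symbol S S' d c :=
  (forall v, adml v -> ~~ adml (v + d) -> c v = 0) /\ regime adml S S' d c.

Definition cutoff d c v := if adml (v + d) then c v else 0.

(** The cutoff could destroy invariance only at a corner of the cone of
    admissible labels.  There the responsible axis is moved by both
    displacements, hence it is [i] itself; so [v i] is bounded, and there is
    nothing to prove since the weight is bounded below. *)
Lemma symbol_cutoff S S' d c : (forall i t, S i t -> S' i t -> t = i) ->
  regime (active d) S S' d c -> symbol S S' d (cutoff d c).
Proof.
move=> SS [[K hK] hreg]; split; first by move=> v av /negPf; rewrite /cutoff => ->.
have hK' v : adml v -> `|cutoff d c v| <= `|K|.
  move=> av; rewrite /cutoff; case: ifP => avd; last by rewrite normr0.
  by rewrite (le_trans (hK _ _)) ?ler_norm// /active /= av avd.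
split; first by exists `|K|.
move=> i; have [[L hL]|[sd hinv]] := hreg i.
  left; exists `|L| => v av; rewrite /cutoff; case: ifP => avd.
    apply: le_trans (hL _ _) _; first by rewrite /active /= av avd.
    by rewrite ler_wpM2r ?ler_norm// ltW ?weight_gt0.
  by rewrite normr0 mulr_ge0// ltW ?weight_gt0.
right; split=> // d' sd'; have [L hL] := hinv _ sd'.
pose M := q `^ (- (`|d i| + `|d' i|)%:~R).
exists (`|L| + 2 * `|K| * M) => v av avd'.
have M0 : 0 < M by exact: powR_gt0.
have w0 := weight_gt0 i v.
have small : (v i < `|d i| + `|d' i|)%R -> `|cutoff d c (v + d') - cutoff d c v| <=
    (`|L| + 2 * `|K| * M) * weight i v.
  move=> vi; apply: le_trans (ler_normB _ _) _.
  have h1 := hK' _ av; have h2 := hK' _ avd'.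
  have h3 : 1 <= M * weight i v.
    rewrite -[leLHS](powRr0 q) /M /weight -powRD ?(gt_eqF q0) ?implybT// powq_le//.
    by rewrite -mulrNz -intrD lerz0; clear -vi; lia.
  have : 0 <= `|L| by []. have : 0 <= `|K| by [].
  move: (cutoff d c _) (cutoff d c _) h1 h2 => a b h1 h2 hk hl.
  rewrite mulrDl -mulrA.
  have : 2 * `|K| * 1 <= 2 * `|K| * (M * weight i v) by rewrite ler_wpM2l// mulr_ge0.
  have : 0 <= `|L| * weight i v by rewrite mulr_ge0// ltW.
  lra.
have [ad|nad] := boolP (adml (v + d)); have [ad'|nad'] := boolP (adml (v + d' + d)).
- rewrite /cutoff ad ad'; apply: le_trans (hL _ _ _) _; rewrite /active /= ?av ?avd' ?ad ?ad'//.
  rewrite ler_wpM2r ?(ltW w0)// (le_trans (ler_norm _))// lerDl.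
  by rewrite !mulr_ge0// ltW.
- have [|t [dt d't lt]] := adm_corner av ad avd' ; first by rewrite addrAC.
  have ti := SS i t (sd _ dt) (sd' _ d't); apply: small; rewrite -ti; clear -lt; lia.
- have [|t [dt d't lt]] := @adm_corner2 v d d' av avd' _ nad; first by rewrite addrAC.
  have ti := SS i t (sd _ dt) (sd' _ d't); apply: small; rewrite -ti; clear -lt; lia.
- rewrite /cutoff (negPf nad) (negPf nad') subrr normr0.
  by rewrite mulr_ge0 ?(ltW w0)// addr_ge0// !mulr_ge0// ltW.
Qed.

Lemma symbol_adjoint S S' d c : (forall i t, S i t -> S' i t -> t = i) ->
  symbol S S' d c -> symbol S S' (- d) (cutoff (- d) (fun v => c (v - d))).
Proof.
move=> SS [_ [[K hK] h]]; apply: symbol_cutoff => //; split.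
  by exists K => v /andP[_]; exact: hK.
move=> i; have [[L hL]|[sd hi]] := h i; [left|right].
  exists (L * weight i (- d)) => v /andP[_ avd].
  by rewrite -mulrA [weight i (- d) * _]mulrC -weightD hL.
split; first by move=> t; rewrite labelN oppr_eq0; exact: sd.
move=> d' /hi[L hL]; exists (L * weight i (- d)) => v /andP[_ av] /andP[_ av'].
rewrite -mulrA [weight i (- d) * _]mulrC -weightD addrAC; apply: hL => //.
by rewrite addrAC.
Qed.

Lemma symbol_scale S S' d c (a : R) : symbol S S' d c -> symbol S S' d (fun v => a * c v).
Proof.
move=> [h0 [[K hK] h]]; split; first by move=> v av /(h0 _ av) ->; rewrite mulr0.
split; first by exists (`|a| * K) => v /hK; rewrite normrM; apply: ler_wpM2l.
move=> i; have [[L hL]|[sd hi]] := h i; [left|right].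
  by exists (`|a| * L) => v /hL; rewrite normrM -mulrA; apply: ler_wpM2l.
split=> // d' /hi[L hL]; exists (`|a| * L) => v av /(hL _ av).
by rewrite -mulrBr normrM -mulrA; apply: ler_wpM2l.
Qed.

Definition commutator_symbol d c d' c' v := c' v * c (v + d') - c v * c' (v + d).

(** If neither symbol is negligible at [i], then [d] is supported where [c'] is
    insensitive and vice versa, and the commutator is a sum of two
    differences that are small. *)
Lemma commutator_vanishing S S' d c d' c' : symbol S S' d c -> symbol S' S d' c' ->
  forall i, vanishing_on adml i (commutator_symbol d c d' c').
Proof.
move=> [c0 [[K hK] h]] [c0' [[K' hK'] h']] i.
suff [M hM] : exists M, forall v, adml v ->
   (`|c' v * c (v + d')| <= M * weight i v /\ `|c v * c' (v + d)| <= M * weight i v)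
   \/ `|commutator_symbol d c d' c' v| <= M * weight i v.
  exists (2 * `|M|) => v av; have w0 := weight_gt0 i v.
  have [[h1 h2]|h1] := hM v av.
    apply: le_trans (ler_normB _ _) _; rewrite mulr_natl mulr2n mulrDl.
    by apply: lerD; apply: le_trans; [exact: h1| |exact: h2|]; rewrite ler_wpM2r ?ler_norm// ltW.
  apply: (le_trans h1); rewrite ler_wpM2r ?(ltW w0)//.
  by have := ler_norm M; have := normr_ge0 M; lra.
have bK v : adml v -> `|c v| <= `|K| by move=> /hK/le_trans; apply; exact: ler_norm.
have bK' v : adml v -> `|c' v| <= `|K'| by move=> /hK'/le_trans; apply; exact: ler_norm.
have w0 v := weight_gt0 i v.
have z v : 0 <= weight i v by exact: ltW.
have [[L hL]|[sd hi]] := h i.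
  exists (`|L| * `|K'| * (1 + weight i d')) => v av; left; split.
    have [ad|/(c0' _ av) ->] := boolP (adml (v + d')); last first.
      by rewrite mul0r normr0 !mulr_ge0// addr_ge0.
    rewrite normrM mulrC; apply: le_trans (_ : `|L| * weight i (v + d') * `|K'| <= _).
      apply: ler_pM => //; last exact: bK'.
      by rewrite (le_trans (hL _ ad))// ler_wpM2r ?ler_norm.
    rewrite weightD; have := mulr_ge0 (mulr_ge0 (normr_ge0 L) (normr_ge0 K')) (z v).
    by rewrite !mulrDr mulr1 mulrDl; lra.
  have [ad|/(c0 _ av) ->] := boolP (adml (v + d)); last first.
    by rewrite mul0r normr0 !mulr_ge0// addr_ge0.
  rewrite normrM; apply: le_trans (_ : `|L| * weight i v * `|K'| <= _).
    apply: ler_pM => //; last exact: bK'.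
    by rewrite (le_trans (hL _ av))// ler_wpM2r ?ler_norm.
  have := mulr_ge0 (mulr_ge0 (mulr_ge0 (normr_ge0 L) (normr_ge0 K')) (z d')) (z v).
  by rewrite !mulrDr mulr1 mulrDl; lra.
have [[L hL]|[sd' hi']] := h' i.
  exists (`|L| * `|K| * (1 + weight i d)) => v av; left; split.
    have [ad|/(c0' _ av) ->] := boolP (adml (v + d')); last first.
      by rewrite mul0r normr0 !mulr_ge0// addr_ge0.
    rewrite normrM; apply: le_trans (_ : `|L| * weight i v * `|K| <= _).
      apply: ler_pM => //; last exact: bK.
      by rewrite (le_trans (hL _ av))// ler_wpM2r ?ler_norm.
    have := mulr_ge0 (mulr_ge0 (mulr_ge0 (normr_ge0 L) (normr_ge0 K)) (z d)) (z v).
    by rewrite !mulrDr mulr1 mulrDl; lra.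
  have [ad|/(c0 _ av) ->] := boolP (adml (v + d)); last first.
    by rewrite mul0r normr0 !mulr_ge0// addr_ge0.
  rewrite normrM mulrC; apply: le_trans (_ : `|L| * weight i (v + d) * `|K| <= _).
    apply: ler_pM => //; last exact: bK.
    by rewrite (le_trans (hL _ ad))// ler_wpM2r ?ler_norm.
  rewrite weightD; have := mulr_ge0 (mulr_ge0 (normr_ge0 L) (normr_ge0 K)) (z v).
  by rewrite !mulrDr mulr1 mulrDl; lra.
have [L hL] := hi _ sd'; have [L' hL'] := hi' _ sd.
exists (`|K'| * `|L| + `|K| * `|L'|) => v av; right.
have -> : commutator_symbol d c d' c' v =
    c' v * (c (v + d') - c v) - c v * (c' (v + d) - c' v).
  by rewrite /commutator_symbol; ring.
apply: le_trans (ler_normB _ _) _; rewrite mulrDl !normrM; apply: lerD.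
  rewrite -mulrA; have [ad|/(c0' _ av) ->] := boolP (adml (v + d')); last first.
    by rewrite normr0 mul0r !mulr_ge0.
  apply: ler_pM => //; first exact: bK'.
  by rewrite (le_trans (hL _ av ad))// ler_wpM2r ?ler_norm.
rewrite -mulrA; have [ad|/(c0 _ av) ->] := boolP (adml (v + d)); last first.
  by rewrite normr0 mul0r !mulr_ge0.
apply: ler_pM => //; first exact: bK.
by rewrite (le_trans (hL' _ av ad))// ler_wpM2r ?ler_norm.
Qed.

(** Bernoulli's inequality for the inverse of the root of [r] of order p + 1. *)
Lemma rapid_power (r : R) p : 0 < r < 1 -> exists K, forall n : nat, r ^+ n * n.+1%:R ^+ p <= K.
Proof.
move=> /andP[r0 r1].
pose s := r `^ (p.+1%:R)^-1.
have s0 : 0 < s by exact: powR_gt0.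
have s1 : s < 1.
  rewrite -(powRr0 r) /s /powR gt_eqF// ltr_expR mul0r pmulr_rlt0 ?invr_gt0//.
  by apply: ln_lt0; rewrite r0.
have sr : s ^+ p.+1 = r.
  by rewrite -powR_mulrn ?ltW// /s -powRrM mulVf ?pnatr_eq0// powRr1 ?ltW.
pose x := s^-1 - 1; have x0 : 0 < x by rewrite subr_gt0 invf_gt1.
have bern n : s ^+ n * (1 + n%:R * x) <= 1.
  elim: n => [|n IH]; first by rewrite expr0 mul0r addr0 mul1r.
  rewrite exprS -natr1.
  have sx : s * x = 1 - s by rewrite /x mulrBr mulfV ?gt_eqF// mulr1.
  have -> : s * s ^+ n * (1 + (n%:R + 1) * x) =
    s ^+ n * (s + n%:R * (s * x) + s * x) by ring.
  rewrite sx; apply: le_trans IH; rewrite ler_wpM2l ?exprn_ge0 ?(ltW s0)//.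
  have : 0 <= n%:R :> R by [].
  have : 1 - s <= x by rewrite -sx ger_pMl// ltW.
  move=> h1 h2; have := ler_wpM2l h2 h1; clearbody x.
  lra.
exists ((1 + x^-1) ^+ p) => n.
have h : s ^+ n * n.+1%:R <= 1 + x^-1.
  have h1 : n.+1%:R <= (1 + x^-1) * (1 + n%:R * x).
    have xx : x^-1 * x = 1 by rewrite mulVf// gt_eqF.
    have -> : (1 + x^-1) * (1 + n%:R * x) = 1 + n%:R * x + x^-1 + n%:R * (x^-1 * x).
      by ring.
    rewrite xx mulr1 -natr1.
    have : 0 <= n%:R * x by rewrite mulr_ge0 // ltW.
    have : 0 <= x^-1 by rewrite invr_ge0 ltW.
    lra.
  apply: le_trans (_ : s ^+ n * ((1 + x^-1) * (1 + n%:R * x)) <= _).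
    by rewrite ler_wpM2l ?exprn_ge0 ?(ltW s0).
  by rewrite mulrCA ler_piMr// addr_ge0// invr_ge0 (ltW x0).
apply: le_trans (_ : (s ^+ n * n.+1%:R) ^+ p <= _).
  rewrite exprMn ler_wpM2r ?exprn_ge0// -sr -exprM mulnC exprM exprS.
  by rewrite ler_piMl ?exprn_ge0 ?exprn_ile1 ?(ltW s0) ?(ltW s1).
by rewrite lerXn2r ?nnegrE ?mulr_ge0 ?exprn_ge0 ?addr_ge0 ?invr_ge0 ?(ltW x0) ?(ltW s0).
Qed.

End Symbols.

Definition spin_index := (bool * label)%type.
Definition adm_index : pred spin_index := fun x => adml x.2.
Definition degree (x : spin_index) : nat := absz (total x.2).
Definition move_index (f : bool) (d : label) (x : spin_index) : spin_index := (x.1 (+) f, x.2 + d).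

Lemma totalD (v d : label) : total (v + d) = total v + total d.
Proof. by rewrite /total /n1 /n2 /k1 /k2 !labelD; lia. Qed.
Lemma totalN (v : label) : total (- v) = - total v.
Proof. by rewrite /total /n1 /n2 /k1 /k2 !labelN; lia. Qed.
Lemma total_ge0 v : adml v -> 0 <= total v.
Proof. by case/and5P=> ? ? ? ? _; rewrite /total; lia. Qed.
Lemma degreeE x : adm_index x -> (degree x)%:Z = total x.2.
Proof. by move=> /total_ge0; rewrite /degree; lia. Qed.

Lemma move_indexK f d : cancel (move_index f d) (move_index f (- d)).
Proof. by case=> s v; rewrite /move_index /= addbK addrK. Qed.
Lemma move_indexKV f d : cancel (move_index f (- d)) (move_index f d).
Proof. by case=> s v; rewrite /move_index /= addbK subrK. Qed.

(** * The algebra generated by shifts and smoothing operators *)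
Section Pdo.
Variables (R : realType) (q : R).
Hypothesis hq : 0 < q < 1.
Variable H : completeNormedModType R[i].
Variable ip : {dot H for (@Num.conj R[i])}.
Variables (e : spin_index -> H) (ball : nat -> seq spin_index).
Hypothesis gb : graded_basis ip e adm_index degree ball.
Let hip := gb_hilbert gb.
Implicit Types (T U Y : H -> H) (d v : label) (x : spin_index) (S : axis -> pred axis).

Local Notation smoothing := (smoothing ip e adm_index degree).
Local Notation banded_operator := (banded_operator ip e adm_index degree).
Local Notation adjoint := (adjoint ip).

Definition shift_op f d (c : label -> R) T :=
  is_shift e adm_index (fun x => c x.2) (move_index f d) T.

(** A calculus of operators modulo smoothing ones.  Weights do not depend on
    the chirality, which [f] may exchange: the exchange then commutes with all
    shifts, and commutators with D stay in the class. *)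
Inductive pdo S S' : (H -> H) -> Prop :=
| pdo_shift f d c T : symbol q S S' d c -> shift_op f d c T -> pdo S S' T
| pdo_smoothing T : smoothing T -> pdo S S' T
| pdo_add T U : pdo S S' T -> pdo S S' U -> pdo S S' (fun u => T u + U u)
| pdo_scale (a : R[i]) T : pdo S S' T -> pdo S S' (fun u => a *: T u)
| pdo_comp T U : pdo S S' T -> pdo S S' U -> pdo S S' (fun u => T (U u)).

Lemma shift_op_ex S S' f d c : symbol q S S' d c -> exists T, shift_op f d c T.
Proof.
move=> [c0 [[K hK] _]]; apply: (shift_ex gb (K := K)).
- exact: can_inj (move_indexK f d).
- by move=> x; exact: hK.
Qed.

Lemma shift_op_banded f d c T : shift_op f d c T -> banded_operator T.
Proof.
move=> [bT Te]; split=> //; exists (absz (total d)) => x y ax ay nxy.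
rewrite Te// ipZl (ip_e gb)//; case: eqP => [xy|_]; last by rewrite mulr0.
case/negP: nxy; have hy : degree y = absz (total x.2 + total d).
  by rewrite -xy /degree /= totalD.
rewrite /degree_close hy /degree; clear; move: (total x.2) (total d) => a b.  apply/andP; split; lia.
Qed.

Lemma pdo_banded S S' T : pdo S S' T -> banded_operator T.
Proof.
elim=> {T} [f d c T _|T|T U _ ? _|a T _|T U _ ? _].
- exact: shift_op_banded.
- exact: smoothing_banded_operator.
- exact: (banded_operator_add gb).
- exact: banded_operator_scale.
- exact: (banded_operator_comp gb).
Qed.

Lemma pdo_bounded S S' T : pdo S S' T -> bounded_operator T.
Proof. by case/pdo_banded. Qed.

Section Adjoint.
Variables S S' : axis -> pred axis.
Hypothesis SS : forall i t, S i t -> S' i t -> t = i.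

Lemma shift_op_adjoint f d c T T' : shift_op f d c T ->
  (forall v, adml v -> ~~ adml (v + d) -> c v = 0) ->
  shift_op f (- d) (cutoff (- d) (fun v => c (v - d))) T' -> adjoint T' T.
Proof.
move=> [bT Te] c0 [bT' Te']; apply: (adjoint_ext gb) => // x y ax ay.
rewrite Te'// Te// ipZl ipZr conjc_real (ip_e gb _ ay).
have [xy|nxy] := eqVneq (move_index f (- d) x) y; last first.
  rewrite mulr0 ipC (ip_e gb)//; case: eqP => [yx|_]; last by rewrite conjc0 mulr0.
  by rewrite -yx move_indexK eqxx in nxy.
have yx : move_index f d y = x by rewrite -xy move_indexKV.
rewrite yx (gb_on gb)// eqxx !mulr1 /cutoff.
by move: ay; rewrite -xy /adm_index /= => ->.
Qed.

Lemma pdo_adjoint T : pdo S S' T -> exists2 T', pdo S S' T' & adjoint T' T.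
Proof.
elim=> {T} [f d c T sc sT|T sT|T U _ [T' pT aT] _ [U' pU aU]|a T _ [T' pT aT]
  |T U _ [T' pT aT] _ [U' pU aU]].
- have sc' := symbol_adjoint hq SS sc.
  have [T' sT'] := shift_op_ex f sc'; exists T'; first exact: pdo_shift sc' sT'.
  by apply: shift_op_adjoint sT _ sT'; case: sc.
- have [T' sT' aT'] := smoothing_adjoint gb sT.
  by exists T' => //; exact: pdo_smoothing.
- exists (fun u => T' u + U' u); first exact: pdo_add.
  by move=> u v; rewrite ipDl ipDr aT aU.
- exists (fun u => (a^*)%C *: T' u); first exact: pdo_scale.
  by move=> u v; rewrite ipZl ipZr aT.
- exists (fun u => U' (T' u)); first exact: pdo_comp.
  by move=> u v; rewrite aU aT.
Qed.

Lemma adjoint_unique T T' T'' : adjoint T' T -> adjoint T'' T -> T' = T''.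
Proof.
move=> h h'; apply/funext => u; apply/eqP; rewrite -subr_eq0; apply/eqP.
by apply: (ip_eq0P hip) => w; rewrite ipBl h h' subrr.
Qed.

End Adjoint.

Section Commutator.
Variables S S' : axis -> pred axis.

(** The commutator is a shift whose weight is small in terms of each
    coordinate, hence of the largest one, which is at least a quarter of the
    degree. *)
Lemma shift_commutator f d c T f' d' c' T' :
  symbol q S S' d c -> symbol q S' S d' c' -> shift_op f d c T -> shift_op f' d' c' T' ->
  smoothing (commutator T T').
Proof.
move=> sc sc' sT sT'; have tT := shift_op_banded sT; have tT' := shift_op_banded sT'.
have [bC nC] : banded_operator (fun u => T (T' u) + -1 *: T' (T u)).
  exact: (banded_operator_add gb (banded_operator_comp gb tT tT') (banded_operator_scale (-1) (banded_operator_comp gb tT' tT))).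
have -> : commutator T T' = (fun u => T (T' u) + -1 *: T' (T u)).
  by apply/funext => u; rewrite scaleN1r.
split=> // p.
have [bT Te] := sT; have [bT' Te'] := sT'; have [lT _] := bT; have [lT' _] := bT'.
have [c0 _] := sc; have [c0' _] := sc'.
pose m := commutator_symbol d c d' c'.
have mE x : adm_index x -> T (T' (e x)) + -1 *: T' (T (e x)) =
    (m x.2)%:C%C *: e (move_index f d (move_index f' d' x)).
  move=> ax; rewrite Te'// Te// (linear_scale _ _ lT) (linear_scale _ _ lT').
  have swap : move_index f d (move_index f' d' x) = move_index f' d' (move_index f d x).
    by rewrite /move_index /= -!addbA [f' (+) f]addbC addrAC.
  have E1 : (c' x.2)%:C%C *: T (e (move_index f' d' x)) = (c' x.2 * c (x.2 + d'))%:C%C *: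
      e (move_index f d (move_index f' d' x)).
    have [ax'|/(c0' _ ax) ->] := boolP (adm_index (move_index f' d' x)).
      by rewrite Te// scalerA -rcM.
    by rewrite mul0r !scale0r.
  have E2 : (c x.2)%:C%C *: T' (e (move_index f d x)) = (c x.2 * c' (x.2 + d))%:C%C *:
      e (move_index f d (move_index f' d' x)).
    rewrite swap; have [ax'|/(c0 _ ax) ->] := boolP (adm_index (move_index f d x)).
      by rewrite Te'// scalerA -rcM.
    by rewrite mul0r !scale0r.
  by rewrite E1 E2 scaleN1r -scalerBl -rcB.
have van := commutator_vanishing hq sc sc'.
have [K hK] : exists K, forall t v, adml v -> `|m v| <= K * weight q t v.
  have [f0 hf0] := boolp.choice van.
  exists (\sum_t `|f0 t|) => t v av; apply: le_trans (hf0 t v av) _.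
  rewrite ler_wpM2r ?(ltW (weight_gt0 hq _ _))// (bigD1 t)//=.
  by rewrite (le_trans (ler_norm _))// lerDl sumr_ge0.
pose r := q `^ (4^-1).
have r01 : 0 < r < 1.
  have /andP[q0 q1] := hq; rewrite powR_gt0//= -(powRr0 q) /r /powR (gt_eqF q0).
  rewrite ltr_expR mul0r pmulr_rlt0 ?invr_gt0//; exact: ln_lt0.
have [L hL] := rapid_power p r01; exists (`|K| * L) => x ax /=.
rewrite mE// rnormZ -/(cmod _) cmodR.
have he : rnorm (e (move_index f d (move_index f' d' x))) <= 1.
  have [a|na] := boolP (adm_index (move_index f d (move_index f' d' x))).
    by rewrite (rnorm_e gb).
  by rewrite (gb_out gb)// rnorm0.
have hm : `|m x.2| <= `|K| * r ^+ degree x.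
  have [t ht] : exists t, total x.2 <= x.2 t *+ 4.
    have [t ht|h] := pickP [pred t | total x.2 <= x.2 t *+ 4]; first by exists t.
    have := h (false,false); have := h (true,false).
    have := h (false,true); have := h (true,true).
    rewrite /= /total /n1 /n2 /k1 /k2 !mulrS mulr0n.
    move: (x.2 _) (x.2 _) (x.2 _) (x.2 _) => a b c2 d2; lia.
  apply: le_trans (hK t _ ax) _; apply: ler_pM => //.
  - by rewrite -(pmulr_lge0 _ (weight_gt0 hq t x.2)) (le_trans _ (hK t _ ax)).
  - exact: ltW (weight_gt0 hq _ _).
  - exact: ler_norm.
  rewrite /weight /r -powR_mulrn ?powR_ge0// -powRrM; apply: (powq_le hq).
  rewrite ler_pdivrMl// -[(degree x)%:R]/((degree x)%:Z%:~R) degreeE//.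
  by move: ht; rewrite -(ler_int R) rmorphMn /= mulr_natl.
apply: le_trans (_ : `|K| * r ^+ degree x * (degree x).+1%:R ^+ p <= _).
  rewrite ler_wpM2r ?exprn_ge0// -[leRHS]mulr1; apply: ler_pM => //; exact: rnorm_ge0.
by rewrite -mulrA ler_wpM2l.
Qed.

Lemma commutatorC T U : commutator T U = (fun u => -1 *: commutator U T u).
Proof. by apply/funext => u; rewrite /commutator scaleN1r opprB. Qed.

Lemma commutator_addl T1 T2 U : linear U ->
  commutator (fun u => T1 u + T2 u) U = (fun u => commutator T1 U u + commutator T2 U u).
Proof.
move=> lU; apply/funext => u; rewrite /commutator (linear_add _ _ lU) opprD.
exact: addrACA.
Qed.

Lemma commutator_scalel (a : R[i]) T U : linear U ->
  commutator (fun u => a *: T u) U = (fun u => a *: commutator T U u).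
Proof. by move=> lU; apply/funext => u; rewrite /commutator (linear_scale _ _ lU) scalerBr. Qed.

Lemma commutator_compl T1 T2 U : linear T1 ->
  commutator (fun u => T1 (T2 u)) U =
  (fun u => T1 (commutator T2 U u) + commutator T1 U (T2 u)).
Proof.
by move=> lT; apply/funext => u; rewrite /commutator (linear_sub _ _ lT) addrA subrK.
Qed.

Lemma smoothing_commutator T U : smoothing T -> banded_operator U -> smoothing (commutator T U).
Proof.
move=> sT tU; have h1 := smoothing_compr gb sT tU; have h2 := smoothing_compl gb tU sT.
have -> : commutator T U = (fun u => T (U u) + -1 *: U (T u)).
  by apply/funext => u; rewrite scaleN1r.
exact: (smoothing_add gb h1 (smoothing_scale (-1) h2)).
Qed.

Lemma pdo_commutator T Y : pdo S S' T -> pdo S' S Y -> smoothing (commutator T Y).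
Proof.
move=> pT pY; have tY := pdo_banded pY; have [[lY _] _] := tY.
elim: pT => {T} [f d c T sc sT|T sT|T U pT IT pU IU|a T pT IT|T U pT IT pU IU].
- have tT := shift_op_banded sT; have [[lT _] _] := tT.
  rewrite commutatorC; apply: smoothing_scale.
  elim: pY {tY lY} => {Y} [f' d' c' T' sc' sT'|U sU|U V pU IU pV IV|a U pU IU|U V pU IU pV IV].
  + rewrite commutatorC; apply: smoothing_scale; exact: shift_commutator sc sc' sT sT'.
  + exact: smoothing_commutator.
  + by rewrite commutator_addl//; apply: (smoothing_add gb).
  + by rewrite commutator_scalel//; apply: smoothing_scale.
  + have tU := pdo_banded pU; have tV := pdo_banded pV.
    rewrite commutator_compl; last by case: tU => -[].
    apply: (smoothing_add gb); first exact: (smoothing_compl gb).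
    exact: (smoothing_compr gb IU tV).
- exact: smoothing_commutator.
- by rewrite commutator_addl//; apply: (smoothing_add gb).
- by rewrite commutator_scalel//; apply: smoothing_scale.
- have tT := pdo_banded pT; have tU := pdo_banded pU.
  rewrite commutator_compl; last by case: tT => -[].
  apply: (smoothing_add gb); first exact: (smoothing_compl gb).
  exact: (smoothing_compr gb IT tU).
Qed.

End Commutator.
End Pdo.

(** * Conjugation by the real structure *)
Definition flip_axis (t : axis) : axis := (~~ t.1, t.2).
Definition reflect_label (v : label) : label := [ffun t => v (flip_axis t)].
Definition flip_sign (x : spin_index) : spin_index := (~~ x.1, x.2).

Lemma flip_axisK : involutive flip_axis.
Proof. by case=> -[] []. Qed.
Lemma reflectE v t : reflect_label v t = v (flip_axis t).
Proof. by rewrite ffunE. Qed.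
Lemma reflect_labelK : involutive reflect_label.
Proof. by move=> v; apply/ffunP => t; rewrite !reflectE flip_axisK. Qed.
Lemma reflectD (v d : label) : reflect_label (v + d) = reflect_label v + reflect_label d.
Proof. by apply/ffunP => t; rewrite labelD !reflectE labelD. Qed.
Lemma adml_reflect v : adml (reflect_label v) = adml v.
Proof.
rewrite /admissible_label /n1 /k1 /n2 /k2 !reflectE /flip_axis /=.
by rewrite [v (true,false) + _]addrC [v (true,true) + _]addrC;
  case: (0 <= v (true,false)); case: (0 <= v (false,false));
  case: (0 <= v (true,true)); case: (0 <= v (false,true)).
Qed.
Lemma total_reflect v : total (reflect_label v) = total v.
Proof. by rewrite /total /n1 /k1 /n2 /k2 !reflectE /flip_axis /=; ring. Qed.

Section Conjugation.
Variables (R : realType) (q : R).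
Hypothesis hq : 0 < q < 1.
Variable H : completeNormedModType R[i].
Variable ip : {dot H for (@Num.conj R[i])}.
Variables (e : spin_index -> H) (ball : nat -> seq spin_index).
Hypothesis gb : graded_basis ip e adm_index degree ball.
Let hip := gb_hilbert gb.
Implicit Types (T U Y : H -> H) (d v : label) (x : spin_index) (S : axis -> pred axis).
Local Notation smoothing := (smoothing ip e adm_index degree).
Local Notation banded_operator := (banded_operator ip e adm_index degree).
Local Notation pdo := (pdo q ip e).
Local Notation shift_op := (shift_op e).

Lemma symbol_reflect S S' d (c : label -> R) : (forall i t, S' i t = S (flip_axis i) (flip_axis t)) ->
  symbol q S S' d c -> symbol q S' S (reflect_label d) (c \o reflect_label).
Proof.
move=> SS [c0 [[K hK] h]].
have SS2 i t : S i t = S' (flip_axis i) (flip_axis t) by rewrite SS !flip_axisK.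
have wr i v : weight q (flip_axis i) (reflect_label v) = weight q i v.
  by rewrite /weight reflectE flip_axisK.
split.
  move=> v av nav; apply: c0; first by rewrite adml_reflect.
  by apply: contraNN nav; rewrite -adml_reflect reflectD reflect_labelK.
split; first by exists K => v av; apply: hK; rewrite adml_reflect.
move=> i; have [[L hL]|[sd hi]] := h (flip_axis i); [left|right].
  by exists L => v av; rewrite -(wr i); apply: hL; rewrite adml_reflect.
split; first by move=> t; rewrite reflectE SS => /sd.
move=> d' sd'; have [|L hL] := hi (reflect_label d').
  by move=> t; rewrite reflectE SS flip_axisK => /sd'.
exists L => v av avd; rewrite -(wr i) /= reflectD; apply: hL.
  by rewrite adml_reflect.
by rewrite -reflectD adml_reflect.
Qed.

Variable J : H -> H.
Hypothesis hJ : antilinear_isometry J.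
Definition phase v : R[i] := 'i%C ^ total v * (-1) ^ n1 v.
Hypothesis J_e : forall s v, adml v -> J (e (s, v)) = phase v *: e (s, reflect_label v).

Lemma i_unit : ('i%C : R[i]) \is a GRing.unit.
Proof. by rewrite unitfE eq_complex /= oner_eq0 andbF. Qed.

Lemma cmod_phase v : cmod (phase v) = 1.
Proof.
rewrite cmodM.
have cmodX (a : R[i]) (z : int) : cmod a = 1 -> cmod (a ^ z) = 1.
  move=> a1; apply: complexI; rewrite -cmodE.
  by case: z => n; rewrite ?NegzE -?invr_expz ?normfV normrX cmodE a1 expr1n ?invr1.
rewrite !cmodX ?mulr1//; apply: complexI; rewrite -cmodE; first by rewrite normrN1.
by rewrite normc_def /= expr0n expr1n add0r sqrtr1.
Qed.

(** The powers of i cancel up to the displacement, and n1 + k1 is odd; this is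
    why J has square -1, and why J sends shifts to multiples of shifts. *)
Lemma phase_reflect v d : adml v ->
  ((phase v)^*)%C * phase (reflect_label v + d) = - phase d.
Proof.
move=> av; have pv : ((phase v)^*)%C = (phase v)^-1.
  apply: (@mulfI _ (phase v)).
    by rewrite -cmod_eq0 cmod_phase oner_eq0.
  by rewrite cmod_sqr cmod_phase expr1n mulfV// -cmod_eq0 cmod_phase oner_eq0.
rewrite pv /phase totalD total_reflect /n1 labelD reflectE /=.
have i1 : 'i%C != 0 :> R[i] by rewrite -unitfE i_unit.
have m1 : -1 != 0 :> R[i] by rewrite oppr_eq0 oner_eq0.
rewrite (expfzDr (total v) (total d) i1) (expfzDr _ _ m1).
have sgn : ((-1) ^ v (false,false))^-1 * (-1) ^ v (true,false) = -1 :> R[i].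
  have /and5P[_ _ _ _ /andP[/eqP h _]] := av.
  rewrite invr_expz -expfzDr ?oppr_eq0 ?oner_eq0//.
  have [m hm] : exists m : int, - v (false,false) + v (true,false) = 2 * m + 1.
    exists (((- v (false,false) + v (true,false)) %/ 2)%Z).
    move: h; rewrite /n1 /k1; lia.
  rewrite hm expfzDr ?oppr_eq0 ?oner_eq0// -exprz_exp.
  have -> : (-1) ^ (2 : int) = 1 :> R[i] by exact: sqrr_sign 1%N.
  by rewrite exp1rz mul1r expr1z.
have i0 : 'i%C ^ total v != 0 :> R[i] by rewrite expfz_neq0.
rewrite invfM; have -> : forall a b c d0 f : R[i], a^-1 * b^-1 * (a * c * (d0 * f)) =
  (a^-1 * a) * (b^-1 * d0) * (c * f) by move=> *; ring.
by rewrite mulVf// mul1r sgn mulN1r.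
Qed.

Lemma bounded_conj T : bounded_operator T -> bounded_operator (fun u => J (T (J u))).
Proof.
have [aJ nJ] := hJ; have hnJ u : rnorm (J u) = rnorm u by rewrite /rnorm nJ.
move=> /bounded_operatorP[lT [K [K0 hK]]]; apply/bounded_operatorP; split.
  by move=> a u v; rewrite aJ lT aJ conjcK.
by exists K; split=> // u; rewrite hnJ (le_trans (hK _))// hnJ.
Qed.

Lemma antilin_sum (I : Type) (r : seq I) (a : I -> R[i]) (F : I -> H) :
  J (\sum_(i <- r) a i *: F i) = \sum_(i <- r) (a i)^*%C *: J (F i).
Proof.
have [aJ _] := hJ; have J0 : J 0 = 0.
  have := aJ 1 0 0; rewrite scale1r addr0 conjc1 scale1r.
  by rewrite -{1}(addr0 (J 0)) => /addrI.
by elim: r => [|i r IH]; rewrite ?big_nil// !big_cons aJ IH.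
Qed.

Lemma antilinZ a u : J (a *: u) = (a^*)%C *: J u.
Proof.
have := @antilin_sum unit [:: tt] (fun=> a) (fun=> u).
by rewrite !big_seq1.
Qed.

Lemma antilinD (u w : H) : J (u + w) = J u + J w.
Proof. by have [aJ _] := hJ; have := aJ 1 u w; rewrite conjc1 !scale1r. Qed.

Lemma J_index x : adm_index x -> J (e x) = phase x.2 *: e (x.1, reflect_label x.2).
Proof. by case: x => s v; exact: J_e. Qed.

Lemma JJ u : J (J u) = - u.
Proof.
have bJ : bounded_operator (fun u => J (J u)).
  by apply: (bounded_conj (T := id)); split=> //; exists 1 => w; rewrite mul1r.
have bN : bounded_operator (fun u : H => (-1) *: u).
  by apply: (bounded_scale (-1) (T := id)); split=> //; exists 1 => w; rewrite mul1r.
rewrite -scaleN1r.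
suff h : (fun u => J (J u)) = (fun u : H => (-1) *: u) by exact: (congr1 (fun F => F u) h).
apply: (op_ext gb) => // -[s v] ax.
rewrite J_e// antilinZ J_e ?adml_reflect// scalerA reflect_labelK.
by have := phase_reflect 0 ax; rewrite addr0 => ->; rewrite /phase /total /n1 /n2 /k1 /k2 !ffunE !addr0 !expr0z mulr1.
Qed.

Lemma shift_op_conj f d c T T' : shift_op f d c T ->
  (forall v, adml v -> ~~ adml (v + d) -> c v = 0) ->
  shift_op f (reflect_label d) (c \o reflect_label) T' ->
  (fun u => J (T (J u))) = (fun u => - phase d *: T' u).
Proof.
move=> [bT Te] c0 [bT' Te']; apply: (op_ext gb); first exact: bounded_conj.
  exact: bounded_scale.
move=> [s v] ax; rewrite Te'// J_e//=; have [lT _] := bT.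
have ax' : adml (reflect_label v) by rewrite adml_reflect.
rewrite (linear_scale _ _ lT) Te//= scalerA antilinZ.
have [ad|nad] := boolP (adml (reflect_label v + d)); last first.
  by rewrite c0// mulr0 conjc0 !scale0r scaler0.
rewrite J_e//= reflectD reflect_labelK !scalerA conjcM conjc_real; congr (_ *: _).
by rewrite mulrAC (phase_reflect d ax) mulrC.
Qed.

Lemma smoothing_conj T : smoothing T -> smoothing (fun u => J (T (J u))).
Proof.
move=> [bT [N hN] rT]; split; first exact: bounded_conj.
  exists N => -[s v] y ax ay nxy; rewrite J_e//; have [lT _] := bT.
  have ax' : adm_index (s, reflect_label v) by rewrite /adm_index /= adml_reflect.
  rewrite (linear_scale _ _ lT) antilinZ ipZl (band_expansion gb hN ax').
  rewrite -big_filter antilin_sum ip_suml big1_seq ?mulr0// => k.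
  rewrite mem_filter => /andP[_ /andP[nk kM]].
  have ak : adm_index k by apply: (allP (adm_ball gb _) _ kM).
  rewrite ipZl J_index// ipZl (ip_e gb)//; case: eqP => [yE|_]; last by rewrite !mulr0.
  case/negP: nxy; move: nk; rewrite /degree_close -yE /degree /= !total_reflect.
  by [].
move=> p; have [K hK] := rT p; exists K => -[s v] ax /=; have [aJ nJ] := hJ.
have ax' : adm_index (s, reflect_label v) by rewrite /adm_index /= adml_reflect.
have [lT _] := bT.
rewrite J_e// (linear_scale _ _ lT) antilinZ rnormZ -/(cmod _) cmodJ cmod_phase mul1r /rnorm nJ.
by have := hK _ ax'; rewrite /= /degree /= total_reflect.
Qed.

(** Since J has square -1, T |-> J T J is multiplicative up to sign. *)
Lemma pdo_conj S S' T : (forall i t, S' i t = S (flip_axis i) (flip_axis t)) ->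
  pdo S S' T -> pdo S' S (fun u => J (T (J u))).
Proof.
move=> SS; elim=> {T} [f d c T sc sT|T sT|T U pT IT pU IU|a T pT IT|T U pT IT pU IU].
- have sc' := symbol_reflect SS sc; have [T' sT'] := shift_op_ex gb f sc'.
  rewrite (shift_op_conj sT _ sT'); last by case: sc.
  by apply: pdo_scale; apply: pdo_shift sc' sT'.
- by apply: pdo_smoothing; apply: smoothing_conj.
- have -> : (fun u => J (T (J u) + U (J u))) = (fun u => J (T (J u)) + J (U (J u))).
    by apply/funext => u; rewrite antilinD.
  exact: pdo_add.
- have -> : (fun u => J (a *: T (J u))) = (fun u => (a^*)%C *: J (T (J u))).
    by apply/funext => u; rewrite antilinZ.
  exact: pdo_scale.
- have -> : (fun u => J (T (U (J u)))) = (fun u => -1 *: J (T (J (J (U (J u)))))).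
    apply/funext => u; rewrite JJ; have [lT _] := pdo_bounded gb pT.
    by rewrite (linear_opp _ lT) -(scaleN1r (T _)) antilinZ rmorphN rmorph1 scalerA mulrNN mulr1 scale1r.
  apply: pdo_scale; exact: (pdo_comp IT IU).
Qed.

End Conjugation.

(** * Commutators with the Dirac operator *)
Section Dirac.
Variables (R : realType) (q : R).
Hypothesis hq : 0 < q < 1.
Variable H : completeNormedModType R[i].
Variable ip : {dot H for (@Num.conj R[i])}.
Variables (e : spin_index -> H) (ball : nat -> seq spin_index).
Hypothesis gb : graded_basis ip e adm_index degree ball.
Let hip := gb_hilbert gb.
Implicit Types (T U Y : H -> H) (d v : label) (x : spin_index).
Local Notation smoothing := (smoothing ip e adm_index degree).
Local Notation pdo := (pdo q ip e).
Local Notation shift_op := (shift_op e).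
Variable D : unbounded_operator H.
Hypothesis sD : self_adjoint ip D.
Hypothesis D_e : forall x, adm_index x ->
  dom D (e x) /\ D (e x) = (dirac_eigenvalue R (degree x))%:C%C *: e (flip_sign x).

Lemma flip_signK : involutive flip_sign.
Proof. by case=> s v; rewrite /flip_sign /= negbK. Qed.

Lemma dom0 : dom D 0 /\ D 0 = 0.
Proof. by have [_ h] := sD; apply/h => x _; rewrite !ip0r. Qed.

Lemma domZ a u : dom D u -> dom D (a *: u) /\ D (a *: u) = a *: D u.
Proof.
move=> du; have [d0 e0] := dom0.
by have := self_adjoint_lin a sD du d0; rewrite !addr0 e0 addr0.
Qed.

Lemma domD (u w : H) : dom D u -> dom D w -> dom D (u + w) /\ D (u + w) = D u + D w.
Proof. by move=> du dw; have := self_adjoint_lin 1 sD du dw; rewrite !scale1r. Qed.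

Lemma bounded_commutator_add T U T' U' :
  bounded_commutator D T T' -> bounded_commutator D U U' ->
  bounded_commutator D (fun u => T u + U u) (fun u => T' u + U' u).
Proof.
move=> [bT hT] [bU hU]; split; first exact: bounded_add.
move=> v dv; have [d1 ->] := hT v dv; have [d2 ->] := hU v dv.
by have [d3 ->] := domD d1 d2; split=> //; rewrite opprD addrACA.
Qed.

Lemma bounded_commutator_scale a T T' : bounded_commutator D T T' ->
  bounded_commutator D (fun u => a *: T u) (fun u => a *: T' u).
Proof.
move=> [bT hT]; split; first exact: bounded_scale.
move=> v dv; have [d1 ->] := hT v dv.
by have [d3 ->] := domZ a d1; split=> //; rewrite scalerBr.
Qed.

Lemma bounded_commutator_comp T U T' U' : bounded_operator T -> bounded_operator U ->
  bounded_commutator D T T' -> bounded_commutator D U U' ->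
  bounded_commutator D (fun u => T (U u)) (fun u => T' (U u) + T (U' u)).
Proof.
move=> bT bU [bT' hT] [bU' hU]; have [lT _] := bT; split.
  by apply: bounded_add; apply: bounded_comp.
move=> v dv; have [d1 ->] := hU v dv; have [d2 ->] := hT _ d1; split=> //.
by rewrite (linear_sub _ _ lT) addrA subrK.
Qed.

(** A shift by [d] changes l by half the sum of [d], so its commutator with D is
    that multiple of the same shift, composed with the exchange of the
    chiralities. *)
Lemma pdo_dirac (S S' : axis -> pred axis) T : (forall i t, S i t -> S' i t -> t = i) -> pdo S S' T ->
  exists2 T', pdo S S' T' & bounded_commutator D T T'.
Proof.
move=> SS; elim=> {T} [f d c T sc sT|T sT|T U pT [T' pT' hT] pU [U' pU' hU]
  |a T pT [T' pT' hT]|T U pT [T' pT' hT] pU [U' pU' hU]].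
- have sc' := symbol_scale ((total d)%:~R / 2) sc.
  have [T' sT'] := shift_op_ex gb (~~ f) sc'; exists T'; first exact: pdo_shift sc' sT'.
  have [A sA] := shift_op_ex gb f (symbol_adjoint hq SS sc).
  have [A' sA'] := shift_op_ex gb (~~ f) (symbol_adjoint hq SS sc').
  have aA : adjoint ip A T by apply: (shift_op_adjoint gb) sT _ sA; case: sc.
  have aA' : adjoint ip A' T' by apply: (shift_op_adjoint gb) sT' _ sA'; case: sc'.
  have bT' : bounded_operator T' by case: sT'.
  apply: (bounded_commutator_adjoint gb sD flip_signK _ _ D_e bT' aA aA') => // x ax.
  have [bA Ae] := sA; have [bA' Ae'] := sA'; have [lA _] := bA.
  have [dx Dx] := D_e ax; rewrite Dx (linear_scale _ _ lA) !Ae// Ae'//.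
  have E (y : spin_index) : move_index f (- d) (flip_sign y) = flip_sign (move_index f (- d) y).
    by rewrite /move_index /flip_sign /= addNb.
  have E' : move_index (~~ f) (- d) x = flip_sign (move_index f (- d) x).
    by rewrite /move_index /flip_sign /= addbN.
  rewrite E E' /cutoff; case: ifP => axd; last first.
    by rewrite !scale0r scaler0 addr0; have [d0 ->] := dom0.
  have [dy Dy] := D_e (x := move_index f (- d) x) axd.
  have [dy' ->] := domZ (c (x.2 - d))%:C%C dy; split=> //.
  rewrite Dy !scalerA -scalerDl -!rcM -rcD; congr (_%:C%C *: _).
  have -> : dirac_eigenvalue R (degree x) = dirac_eigenvalue R (degree (move_index f (- d) x)) + (total d)%:~R / 2.
    rewrite /dirac_eigenvalue -[(degree x)%:R]/((degree x)%:Z%:~R) degreeE//.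
    rewrite -[(degree (move_index _ _ _))%:R]/((degree (move_index f (- d) x))%:Z%:~R).
    by rewrite degreeE// /= totalD totalN intrD rmorphN /=; field.
  by rewrite -/(x.2 - d); ring.
- have [T' sT' hT] := smoothing_bounded_commutator gb sD flip_signK (fun _ => erefl) (fun _ => erefl) D_e sT.
  by exists T' => //; exact: pdo_smoothing.
- exists (fun u => T' u + U' u); first exact: pdo_add.
  exact: bounded_commutator_add.
- exists (fun u => a *: T' u); first exact: pdo_scale.
  exact: bounded_commutator_scale.
- exists (fun u => T' (U u) + T (U' u)).
    by apply: pdo_add; apply: pdo_comp.
  by apply: bounded_commutator_comp => //; [exact: (pdo_bounded gb pT)|exact: (pdo_bounded gb pU)].
Qed.

End Dirac.

(** * The kets as a graded basis *)
Section SpinLabels.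
Variable R : realType.
Implicit Types (v : label).

Definition label_l v : R := ((total v)%:~R - 1) / 2.
Definition label_j v : R := ((n1 v)%:~R + (k1 v)%:~R) / 2.
Definition label_m1 v : R := ((n1 v)%:~R - (k1 v)%:~R) / 2.
Definition label_m2 v : R := ((n2 v)%:~R - (k2 v)%:~R) / 2.

Lemma totalR v : (total v)%:~R = (n1 v)%:~R + (k1 v)%:~R + (n2 v)%:~R + (k2 v)%:~R :> R.
Proof. by rewrite /total !intrD. Qed.

Definition mk_label (a b c d : int) : label :=
  [ffun t : axis => if t.1 then (if t.2 then d else b) else (if t.2 then c else a)].

Lemma mk_labelE a b c d : [/\ n1 (mk_label a b c d) = a, k1 (mk_label a b c d) = b,
  n2 (mk_label a b c d) = c & k2 (mk_label a b c d) = d].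
Proof. by rewrite /n1 /k1 /n2 /k2 !ffunE. Qed.

Lemma label_eq v w : n1 v = n1 w -> k1 v = k1 w -> n2 v = n2 w -> k2 v = k2 w -> v = w.
Proof. by move=> *; apply/ffunP => -[] [] []. Qed.

(** The absolute values in the admissibility of a ket encode the minimum of
    n and k. *)
Lemma admissibleE v : admissible (label_l v) (label_m1 v) (label_m2 v) (label_j v) = adml v.
Proof.
apply/idP/idP.
  move=> /and5P[_ /natrP[b hb] /natrP[a ha] /natrP[c hc] /natrP[d hd]].
  have e1 : n1 v + k1 v = (b.*2.+1)%:Z.
    apply: (@intr_inj R); rewrite intrD -addnn -addSn PoszD -addn1 PoszD !intrD.
    by move: hb; rewrite /label_j -!pmulrn; lra.
  have e2 : n2 v + k2 v = (a.*2.+1)%:Z.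
    apply: (@intr_inj R); rewrite intrD -addnn -addSn PoszD -addn1 PoszD !intrD.
    by move: ha; rewrite /label_l /label_j totalR -!pmulrn; lra.
  have c0 : 0 <= c%:R :> R by []. have d0 : 0 <= d%:R :> R by [].
  have h1 : 0 <= n1 v.
    rewrite -(ler0z R); have := ler_norm (- label_m1 v); rewrite normrN.
    by move: hc; rewrite /label_j /label_m1; set m := `|_|; move=> *; lra.
  have h2 : 0 <= k1 v.
    rewrite -(ler0z R); have := ler_norm (label_m1 v).
    by move: hc; rewrite /label_j /label_m1; set m := `|_|; move=> *; lra.
  have h3 : 0 <= n2 v.
    rewrite -(ler0z R); have := ler_norm (- label_m2 v); rewrite normrN.
    by move: hd; rewrite /label_l totalR /label_j /label_m2; set m := `|_|; move=> *; lra.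
  have h4 : 0 <= k2 v.
    rewrite -(ler0z R); have := ler_norm (label_m2 v).
    by move: hd; rewrite /label_l totalR /label_j /label_m2; set m := `|_|; move=> *; lra.
  by rewrite /admissible_label h1 h2 h3 h4 e1 e2; lia.
move=> /and5P[h1 h2 h3 h4 /andP[/eqP p1 /eqP p2]].
have [b hb] : exists b : nat, n1 v + k1 v = (b.*2.+1)%:Z.
  exists (absz ((n1 v + k1 v) %/ 2)%Z); lia.
have [a ha] : exists a : nat, n2 v + k2 v = (a.*2.+1)%:Z.
  exists (absz ((n2 v + k2 v) %/ 2)%Z); lia.
have {}hb : (n1 v)%:~R + (k1 v)%:~R = b%:R + b%:R + 1 :> R.
  by rewrite -intrD hb -addnn -addn1 !PoszD !intrD.
have {}ha : (n2 v)%:~R + (k2 v)%:~R = a%:R + a%:R + 1 :> R.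
  by rewrite -intrD ha -addnn -addn1 !PoszD !intrD.
have natmin (x y : int) : 0 <= x -> 0 <= y ->
    exists n : nat, ((x%:~R + y%:~R) / 2 - `|(x%:~R - y%:~R) / 2| = n%:R :> R).
  move=> x0 y0; have [xy|yx] := leP x y.
    exists (absz x); rewrite natr_absz (ger0_norm x0) ler0_norm; first by lra.
    by move: xy; rewrite -(ler_int R); lra.
  exists (absz y); rewrite natr_absz (ger0_norm y0) ger0_norm; first by lra.
  by move: yx; rewrite -(ltr_int R); lra.
apply/and5P; split; apply/natrP.
- exists (a + b)%N; rewrite /label_l totalR natrD; lra.
- by exists b; rewrite /label_j; lra.
- by exists a; rewrite /label_l /label_j totalR; lra.
- exact: natmin.
- have [n En] := natmin _ _ h3 h4; exists n; rewrite -En /label_l /label_j /label_m2 totalR.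
  by set m := `|_|; lra.
Qed.

Lemma admissible_label_ex (l m1 m2 j : R) : admissible l m1 m2 j ->
  exists v, [/\ label_l v = l, label_m1 v = m1, label_m2 v = m2 & label_j v = j].
Proof.
move=> /and5P[_ /natrP[b hb] /natrP[a ha] /natrP[c hc] /natrP[d hd]].
have ex (m x : R) (n r : nat) : x = n%:R + 2^-1 -> x - `|m| = r%:R ->
    exists p p' : int, p%:~R + p'%:~R = x * 2 /\ p%:~R - p'%:~R = m * 2.
  move=> hx hm; have [m0|m0] := leP 0 m.
    exists ((n.*2.+1)%:Z - r%:Z), r%:Z.
    move: hm; rewrite ger0_norm// -addnn -addn1 !PoszD !(intrD, rmorphN) /= => hm; lra.
  exists r%:Z, ((n.*2.+1)%:Z - r%:Z).
  move: hm; rewrite ltr0_norm// -addnn -addn1 !PoszD !(intrD, rmorphN) /= => hm; lra.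
have [p [p' [e1 e2]]] := ex m1 j b c ltac:(lra) hc.
have [r [r' [e3 e4]]] := ex m2 (l + 2^-1 - j) a d ltac:(lra) hd.
exists (mk_label p p' r r').
have [E1 E2 E3 E4] := mk_labelE p p' r r'.
rewrite /label_l totalR /label_m1 /label_m2 /label_j E1 E2 E3 E4; split; lra.
Qed.

Lemma label_coordinates_inj v w : label_l v = label_l w -> label_m1 v = label_m1 w -> label_m2 v = label_m2 w ->
  label_j v = label_j w -> v = w.
Proof.
rewrite /label_l /label_m1 /label_m2 /label_j !totalR => h1 h2 h3 h4.
by apply: label_eq; apply: (@intr_inj R); lra.
Qed.

End SpinLabels.

Section Ball.

Definition box_label N (w : {ffun axis -> 'I_N}) : label := [ffun t => (w t : nat)%:Z].
Definition box N : seq spin_index :=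
  [seq (s, box_label w) | s <- [:: false; true], w <- enum {: {ffun axis -> 'I_N}}].
Definition spin_ball N : seq spin_index :=
  [seq x <- box N | adm_index x && (degree x < N)%N].

Lemma box_label_inj N : injective (@box_label N).
Proof.
move=> w w' h; apply/ffunP => t; apply/val_inj.
by have := congr1 (fun v : label => v t) h; rewrite !ffunE => -[].
Qed.

Lemma uniq_box N : uniq (box N).
Proof.
apply: allpairs_uniq => //; first exact: enum_uniq.
by move=> [s w] [s' w'] _ _ /= [-> /box_label_inj ->].
Qed.

Lemma uniq_spin_ball N : uniq (spin_ball N).
Proof. exact/filter_uniq/uniq_box. Qed.

Lemma degree_ge x t : adm_index x -> (absz (x.2 t) <= degree x)%N.
Proof.
move=> ax; have := degreeE ax; move: (ax) => /and5P[h1 h2 h3 h4 _].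
have : [|| x.2 t == n1 x.2, x.2 t == k1 x.2, x.2 t == n2 x.2 | x.2 t == k2 x.2].
  by case: t => -[] []; rewrite !eqxx ?orbT.
rewrite /total; move: (x.2 t) => y; lia.
Qed.

Lemma mem_spin_ball N x : (x \in spin_ball N) = adm_index x && (degree x < N)%N.
Proof.
rewrite mem_filter; case ax: (adm_index x) => //=; case: ltnP => //= xN.
apply/allpairsP.
have lt t : (absz (x.2 t) < N)%N by rewrite (leq_ltn_trans (degree_ge t ax)).
exists (x.1, [ffun t => Ordinal (lt t)]); split=> /=.
- by case: x.1.
- by rewrite mem_enum.
- case: x ax {xN} lt => s v ax lt /=; congr (_, _); apply/ffunP => t.
  by rewrite !ffunE /= gez0_abs// (adm_ge0 t ax).
Qed.

Lemma inverse_square_sum (R : realType) N : \sum_(a < N) ((a.+1)%:R ^- 2) <= 2 :> R.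
Proof.
suff h : \sum_(a < N.+1) ((a.+1)%:R ^- 2) <= 2 - (N.+1%:R)^-1 :> R.
  apply: le_trans (_ : 2 - (N.+1%:R)^-1 <= _); last by rewrite gerBl invr_ge0.
  by apply: le_trans h; rewrite big_ord_recr /= lerDl invr_ge0 exprn_ge0.
elim: N => [|N IH]; first by rewrite big_ord1 expr1n invr1; lra.
rewrite big_ord_recr /=; apply: le_trans (lerD IH (lexx _)) _.
have x0 : 0 < N.+1%:R :> R by rewrite ltr0n.
rewrite -[N.+2%:R]natr1; set x := N.+1%:R in x0 *.
rewrite -addrA lerD2l -subr_ge0.
have -> : - (x + 1)^-1 - (- x^-1 + (x + 1) ^- 2) = x^-1 * (x + 1) ^- 2.
  by field; rewrite !gt_eqF// addr_gt0.
by rewrite mulr_ge0 ?invr_ge0 ?exprn_ge0 ?addr_ge0// ltW.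
Qed.

(** The degree dominates each of the four coordinates, so the sum factors
    through the product of four series of inverse squares; the factor 2 counts
    the chiralities. *)
Lemma spin_ball_sum (R : realType) N :
  \sum_(x <- spin_ball N) ((degree x).+1%:R ^- 8) <= 2 * 2 ^+ 4 :> R.
Proof.
pose F (x : spin_index) : R := \prod_t (absz (x.2 t)).+1%:R ^- 2.
have F0 x : 0 <= F x by apply: prodr_ge0 => t _; rewrite invr_ge0 exprn_ge0.
apply: le_trans (_ : \sum_(x <- box N) F x <= _).
  rewrite big_filter big_mkcond /=; apply: ler_sum => x _; case: ifPn => // /andP[ax _].
  rewrite -[8%N]/(2 * 4)%N exprM -exprVn.
  have -> : ((degree x).+1%:R ^+ 2)^-1 ^+ 4 = \prod_(t : axis) ((degree x).+1%:R ^- 2) :> R.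
    by rewrite prodr_const card_prod !card_bool.
  apply: ler_prod => t _; rewrite invr_ge0 exprn_ge0//=.
  rewrite lef_pV2 ?posrE ?exprn_gt0 ?ltr0n// lerXn2r ?nnegrE ?ler0n//.
  by rewrite ler_nat ltnS degree_ge.
rewrite /box big_allpairs_dep big_cons big_seq1.
have E : \sum_(w <- enum {: {ffun axis -> 'I_N}}) F (false, box_label w) <= 2 ^+ 4.
  rewrite big_enum /=.
  have -> : \sum_(w : {ffun axis -> 'I_N}) F (false, box_label w) =
     \prod_(t : axis) \sum_(a < N) ((a.+1)%:R ^- 2).
    rewrite bigA_distr_bigA; apply: eq_bigr => w _; apply: eq_bigr => t _.
    by rewrite ffunE.
  rewrite prodr_const card_prod !card_bool lerXn2r ?nnegrE ?inverse_square_sum//.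
  by apply: sumr_ge0 => a _; rewrite invr_ge0 exprn_ge0.
by rewrite mulr_natl mulr2n; apply: lerD.
Qed.

End Ball.

Section SpinorBasis.
Variables (R : realType) (H : completeNormedModType R[i]).
Variable ip : {dot H for (@Num.conj R[i])}.
Hypothesis hip : hilbert_norm ip.
Variable ket : bool -> R -> R -> R -> R -> H.
Hypothesis hket : spinor_basis ket ip.

Definition spin_ket (x : spin_index) : H :=
  ket x.1 (label_l R x.2) (label_m1 R x.2) (label_m2 R x.2) (label_j R x.2).

Lemma ket_span s l m1 m2 j : exists x, ket s l m1 m2 j = spin_ket x.
Proof.
have [k0 _ _] := hket.
have [a|na] := boolP (admissible l m1 m2 j).
  by have [v [<- <- <- <-]] := admissible_label_ex a; exists (s, v).
exists (s, 0); rewrite k0// /spin_ket /= k0// admissibleE /admissible_label.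
by rewrite /n1 /k1 /n2 /k2 !ffunE.
Qed.

Lemma spin_graded_basis : graded_basis ip spin_ket adm_index degree spin_ball.
Proof.
have [k0 kon kd] := hket.
apply: (@GradedBasis _ _ _ _ _ _ _ _ hip _ _ _ mem_spin_ball uniq_spin_ball 8 (2 * 2 ^+ 4)).
- move=> [s v] [s' v'] av av'; rewrite kon ?admissibleE//=; congr (_%:R); congr nat_of_bool.
  apply/eqP/eqP => [[-> h1 h2 h3 h4]|[-> ->]//].
  by rewrite (label_coordinates_inj h1 h2 h3 h4).
- by move=> [s v] nav; rewrite /spin_ket k0// admissibleE.
- move=> u d d0; have [v [[r ->] hr]] := closure_approx kd u d0.
  suff [r' E] : exists r' : seq (R[i] * spin_index),
    \sum_(x <- r) x.1 *: (let: (s, l, m1, m2, j) := x.2 in ket s l m1 m2 j) =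
    \sum_(x <- r') x.1 *: spin_ket x.2 by exists r'; rewrite -E.
  elim: r {hr} => [|[a [[[[s l] m1] m2] j]] r [r' IH]]; first by exists [::]; rewrite !big_nil.
  have [x hx] := ket_span s l m1 m2 j; exists ((a, x) :: r').
  by rewrite !big_cons IH /= hx.
- exact: spin_ball_sum.
Qed.

End SpinorBasis.

(** * Asymptotics of the factors of the coefficients *)

(** The order n2 < n1 < k1 < k2, which the flip of the letters reverses. *)
Definition rank (t : axis) : nat :=
  match t with
  | (false, true) => 0 | (false, false) => 1 | (true, false) => 2 | (true, true) => 3
  end.
Definition lower (i : axis) : pred axis := fun t => (rank t <= rank i)%N.
Definition upper (i : axis) : pred axis := fun t => (rank i <= rank t)%N.

Lemma lower_upper i t : lower i t -> upper i t -> t = i.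
Proof. by case: i => -[] []; case: t => -[] []. Qed.
Lemma upper_flip i t : upper i t = lower (flip_axis i) (flip_axis t).
Proof. by case: i => -[] []; case: t => -[] []. Qed.

Section Factors.
Variables (R : realType) (q : R).
Hypothesis hq : 0 < q < 1.
Let q0 : 0 < q. Proof. by case/andP: hq. Qed.
Let q1 : q < 1. Proof. by case/andP: hq. Qed.
Implicit Types (v d : label) (i : axis) (x y : label -> R) (F G : label -> R).

Local Notation vanishes := (vanishing_on q adml).
Local Notation bdd := (bounded_on adml).

(** As the coordinate [i] goes to infinity, [F] depends only on the coordinates
    strictly below [i]. *)
Definition feels i F := forall d, supported (upper i) d -> invariant_on q adml i d F.

Lemma powqD (a b : R) : q `^ (a + b) = q `^ a * q `^ b.
Proof. by rewrite powRD// (gt_eqF q0) implybT. Qed.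
Lemma powq_ge0 (a : R) : 0 <= q `^ a. Proof. exact: powR_ge0. Qed.
Lemma powq_le1 (a : R) : 0 <= a -> q `^ a <= 1.
Proof. by move=> a0; rewrite -[leRHS](powRr0 q); exact: powq_le. Qed.

Lemma vanishes_bdd i F : vanishes i F -> bdd F.
Proof.
move=> [K hK]; exists `|K| => v av; apply: le_trans (hK _ av) _.
apply: le_trans (_ : `|K| * weight q i v <= _).
  by rewrite ler_wpM2r ?ler_norm// ltW// weight_gt0.
by rewrite ler_piMr// weight_le1.
Qed.

Lemma vanishesMl i F G : vanishes i F -> bdd G -> vanishes i (fun v => F v * G v).
Proof.
move=> [K hK] [L hL]; exists (K * L) => v av; rewrite normrM mulrAC.
by apply: ler_pM => //; [exact: hK|exact: hL].
Qed.
Lemma bddM F G : bdd F -> bdd G -> bdd (fun v => F v * G v).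
Proof.
move=> [K hK] [L hL]; exists (K * L) => v av; rewrite normrM.
by apply: ler_pM => //; [exact: hK|exact: hL].
Qed.

Lemma feelsM i F G : bdd F -> bdd G -> feels i F -> feels i G ->
  feels i (fun v => F v * G v).
Proof.
move=> [K hK] [L hL] fF fG d sd; have [M hM] := fF d sd; have [N hN] := fG d sd.
exists (M * L + K * N) => v av avd.
have -> : F (v + d) * G (v + d) - F v * G v =
  (F (v + d) - F v) * G (v + d) + F v * (G (v + d) - G v) by ring.
rewrite (le_trans (ler_normD _ _))// [leRHS]mulrDl !normrM; apply: lerD.
  by rewrite mulrAC; apply: ler_pM => //; [exact: hM|exact: hL].
by rewrite -mulrA; apply: ler_pM => //; [exact: hK|exact: hN].
Qed.

Lemma feels_vanishes i F : vanishes i F -> feels i F.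
Proof.
move=> [K hK] d _; exists (`|K| * (1 + weight q i d)) => v av avd.
apply: le_trans (ler_normB _ _) _.
have h1 := hK _ av; have h2 := hK _ avd; rewrite weightD// in h2.
have w0 := weight_gt0 hq i v; have w1 := weight_gt0 hq i d.
have k1 : K * weight q i v <= `|K| * weight q i v by rewrite ler_wpM2r ?ler_norm// ltW.
have k2 : K * (weight q i v * weight q i d) <= `|K| * (weight q i v * weight q i d).
  by rewrite ler_wpM2r ?ler_norm// mulr_ge0 ?ltW.
by rewrite mulrDr mulr1 mulrDl -mulrA [weight q i d * _]mulrC; lra.
Qed.

Lemma feels_limit i F (a : R) : vanishes i (fun v => F v - a) -> feels i F.
Proof.
move=> /feels_vanishes h d sd; have [K hK] := h d sd; exists K => v av avd.
by have := hK v av avd; rewrite opprB addrA subrK.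
Qed.

Definition exact_in i F := forall d, supported (upper i) d -> forall v, adml v ->
  adml (v + d) -> F (v + d) = F v.

Lemma feels_exact i F : exact_in i F -> feels i F.
Proof.
move=> h d sd; exists 0 => v av avd.
by rewrite h// subrr normr0 mul0r.
Qed.

Lemma eq_on_bdd F G : (forall v, adml v -> F v = G v) -> bdd G -> bdd F.
Proof. by move=> h [K hK]; exists K => v av; rewrite h// hK. Qed.
Lemma eq_on_vanishes i F G : (forall v, adml v -> F v = G v) -> vanishes i G -> vanishes i F.
Proof. by move=> h [K hK]; exists K => v av; rewrite h// hK. Qed.
Lemma eq_on_feels i F G : (forall v, adml v -> F v = G v) -> feels i G -> feels i F.
Proof.
by move=> h f d /f[K hK]; exists K => v av avd; rewrite !h// hK.
Qed.

Definition root_factor (a : R) : R := Num.sqrt (1 - q `^ (2 * a)).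

Lemma root_factor_ge0 a : 0 <= root_factor a. Proof. exact: sqrtr_ge0. Qed.
Lemma root_factor_le1 a : root_factor a <= 1.
Proof. by rewrite -[leRHS]sqrtr1 ler_sqrt// gerBl powq_ge0. Qed.
Lemma root_factor_near1 a : `|root_factor a - 1| <= q `^ (2 * a).
Proof.
rewrite distrC ger0_norm ?subr_ge0 ?root_factor_le1// lerBlDl -lerBlDr.
have [h|h] := leP 0 (1 - q `^ (2 * a)); last by rewrite (le_trans (ltW h))// root_factor_ge0.
have h1 : 1 - q `^ (2 * a) <= 1 by rewrite gerBl powq_ge0.
rewrite -[leLHS]sqr_sqrtr// -/(root_factor a) expr2 ler_piMr ?root_factor_ge0 ?root_factor_le1//.
Qed.

Lemma pow_vanishes i x (C : R) : (forall v, adml v -> (v i)%:~R - C <= x v) ->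
  vanishes i (fun v => q `^ (x v)).
Proof.
move=> h; exists (q `^ (- C)) => v av; rewrite ger0_norm ?powq_ge0// /weight -powqD.
by apply: (powq_le hq); rewrite addrC; exact: h.
Qed.

Lemma pow_bdd x (C : R) : (forall v, adml v -> - C <= x v) -> bdd (fun v => q `^ (x v)).
Proof.
move=> h; exists (q `^ (- C)) => v av; rewrite ger0_norm ?powq_ge0//.
by apply: (powq_le hq); exact: h.
Qed.

Lemma root_factor_bdd x : bdd (fun v => root_factor (x v)).
Proof. by exists 1 => v av; rewrite ger0_norm ?root_factor_ge0// root_factor_le1. Qed.

Lemma root_factor_limit i x (C : R) : (forall v, adml v -> (v i)%:~R - C <= 2 * x v) ->
  vanishes i (fun v => root_factor (x v) - 1).
Proof.
move=> /pow_vanishes[K hK]; exists K => v av; apply: le_trans (root_factor_near1 _) _.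
by have := hK v av; rewrite ger0_norm ?powq_ge0.
Qed.

Definition inverse_factor (c : R) : R := (1 - q `^ (2 * c))^-1.

Lemma q2_lt1 : q `^ 2 < 1.
Proof. by rewrite powR_mulrn ?ltW// expr_lt1// ltW. Qed.

Lemma inverse_factor_pos c : 1 <= c -> 0 <= inverse_factor c <= (1 - q `^ 2)^-1 /\ 0 < 1 - q `^ (2 * c).
Proof.
move=> c1; have h : q `^ (2 * c) <= q `^ 2 by apply: (powq_le hq); lra.
have h2 := q2_lt1; have h3 : 0 < 1 - q `^ (2 * c) by lra.
split=> //; rewrite invr_ge0 ltW//= lef_pV2 ?posrE//; lra.
Qed.

Lemma inverse_factor_bdd x : (forall v, adml v -> 1 <= x v) -> bdd (fun v => inverse_factor (x v)).
Proof.
move=> h; exists ((1 - q `^ 2)^-1) => v /h /inverse_factor_pos[/andP[d0 d1] _].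
by rewrite ger0_norm.
Qed.

Lemma inverse_factor_limit i x (C : R) : (forall v, adml v -> 1 <= x v) ->
  (forall v, adml v -> (v i)%:~R - C <= 2 * x v) -> vanishes i (fun v => inverse_factor (x v) - 1).
Proof.
move=> h1 h2; apply: (@eq_on_vanishes _ _ (fun v => q `^ (2 * x v) * inverse_factor (x v))).
  move=> v /h1 /inverse_factor_pos[_ h]; rewrite /inverse_factor; field; exact: lt0r_neq0.
by apply: vanishesMl (inverse_factor_bdd h1); apply: pow_vanishes h2.
Qed.

(** The shape of almost all factors once the powers of q in the q-numbers are
    collected; the asymptotics can then be read off the exponents. *)
Definition standard_factor x a b c v := q `^ (x v) * (root_factor (a v) * root_factor (b v)) * inverse_factor (c v).

Lemma standard_factor_bdd x a b c (C : R) : (forall v, adml v -> - C <= x v) ->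
  (forall v, adml v -> 1 <= c v) -> bdd (standard_factor x a b c).
Proof.
move=> hx hc; apply: bddM; last exact: inverse_factor_bdd.
by apply: bddM; [exact: pow_bdd hx|apply: bddM; exact: root_factor_bdd].
Qed.

Lemma standard_factor_vanishes i x a b c (C : R) : (forall v, adml v -> (v i)%:~R - C <= x v) ->
  (forall v, adml v -> 1 <= c v) -> vanishes i (standard_factor x a b c).
Proof.
move=> hx hc; apply: vanishesMl; last exact: inverse_factor_bdd.
by apply: vanishesMl; [exact: pow_vanishes hx|apply: bddM; exact: root_factor_bdd].
Qed.

(** In the limit [i], an argument either does not depend on the coordinates from
    [i] upwards or goes to infinity, in which case its factor tends to 1.  The constant 100
    leaves room for all the additive constants. *)
Definition mild i x := exact_in i x \/ forall v, adml v -> (v i)%:~R - 100 <= 2 * x v.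

Lemma root_factor_feels i x : mild i x -> feels i (fun v => root_factor (x v)).
Proof.
move=> [h|h]; last by apply: feels_limit (root_factor_limit h).
by apply: feels_exact => d sd v av avd; rewrite h.
Qed.

Lemma inverse_factor_feels i x : (forall v, adml v -> 1 <= x v) -> mild i x -> feels i (fun v => inverse_factor (x v)).
Proof.
move=> h1 [h|h]; last by apply: feels_limit (inverse_factor_limit h1 h).
by apply: feels_exact => d sd v av avd; rewrite h.
Qed.

Lemma standard_factor_feels i x a b c (C : R) : (forall v, adml v -> - C <= x v) ->
  (forall v, adml v -> 1 <= c v) -> exact_in i x -> mild i a -> mild i b -> mild i c ->
  feels i (standard_factor x a b c).
Proof.
move=> hx hc ex ha hb hc'; apply: feelsM; last exact: inverse_factor_feels.
- by apply: bddM; [exact: pow_bdd hx|apply: bddM; exact: root_factor_bdd].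
- exact: inverse_factor_bdd.
- apply: feelsM.
  + exact: pow_bdd hx.
  + by apply: bddM; exact: root_factor_bdd.
  + by apply: feels_exact => d sd v av avd; rewrite ex.
  + by apply: feelsM; [exact: root_factor_bdd|exact: root_factor_bdd|exact: root_factor_feels|exact: root_factor_feels].
Qed.

Definition mu : R := q^-1 - q.
Lemma mu_gt0 : 0 < mu.
Proof. by rewrite subr_gt0 (lt_trans q1)// invf_gt1. Qed.

Lemma qnumE z : qnum q z = q `^ (- z) * (1 - q `^ (2 * z)) / mu.
Proof.
rewrite mulrBr mulr1 -powqD (_ : - z + 2 * z = z); last by ring.
by rewrite /qnum /mu -[q - _]opprB invrN mulrN -mulNr opprB.
Qed.

Lemma sqrt_qnum a b : 0 <= a ->
  Num.sqrt (qnum q a * qnum q b) = q `^ (- ((a + b) / 2)) / mu * (root_factor a * root_factor b).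
Proof.
move=> a0; have m0 := mu_gt0.
have -> : qnum q a * qnum q b = (q `^ (- ((a + b) / 2)) / mu) ^+ 2 *
    ((1 - q `^ (2 * a)) * (1 - q `^ (2 * b))).
  rewrite !qnumE exprMn expr2 -powqD.
  have -> : - ((a + b) / 2) - (a + b) / 2 = - a + - b by lra.
  by rewrite powqD; field; rewrite gt_eqF.
rewrite sqrtrM ?sqr_ge0// sqrtr_sqr ger0_norm ?divr_ge0 ?powq_ge0 ?(ltW m0)//.
by rewrite sqrtrM// subr_ge0 powq_le1// mulr_ge0.
Qed.

Lemma qnum_inv z : (qnum q z)^-1 = mu * q `^ z * inverse_factor z.
Proof.
rewrite qnumE !invfM invrK -powRN opprK /inverse_factor; ring.
Qed.

(** Only one of the arguments has to be nonnegative: where the other one is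
    negative, both sides are zero by the convention for square roots. *)
Lemma standard_factor_qnum (x a b c : R) : 0 <= a ->
  q `^ x * Num.sqrt (qnum q a * qnum q b) / qnum q c =
  q `^ (x - (a + b) / 2 + c) * (root_factor a * root_factor b) * inverse_factor c.
Proof.
move=> a0; rewrite sqrt_qnum// qnum_inv !powqD.
by field; rewrite gt_eqF ?mu_gt0.
Qed.

Lemma qnum_le z : 0 <= z -> `|qnum q z| <= q `^ (- z) / mu.
Proof.
move=> z0; have m0 := mu_gt0; rewrite qnumE normrM normrM.
rewrite (ger0_norm (powq_ge0 _)) [`|mu^-1|]ger0_norm ?invr_ge0 ?(ltW m0)//.
rewrite ler_wpM2r ?invr_ge0 ?(ltW m0)// ler_piMr ?powq_ge0//.
have h1 := powq_ge0 (2 * z); have h2 : q `^ (2 * z) <= 1 by rewrite powq_le1// mulr_ge0.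
by rewrite ger0_norm; lra.
Qed.

Lemma qnum_inv_le z : 1 <= z -> `|(qnum q z)^-1| <= mu * (1 - q `^ 2)^-1 * q `^ z.
Proof.
move=> /inverse_factor_pos[/andP[d0 d1] _]; rewrite qnum_inv !normrM (ger0_norm d0).
rewrite (ger0_norm (powq_ge0 _)) (ger0_norm (ltW mu_gt0)) mulrAC.
by rewrite ler_wpM2r ?powq_ge0// ler_wpM2l// (ltW mu_gt0).
Qed.

Lemma sqrt_qnum_le a b : 0 <= a ->
  `|Num.sqrt (qnum q a * qnum q b)| <= mu^-1 * q `^ (- ((a + b) / 2)).
Proof.
move=> a0; rewrite sqrt_qnum// mulrC normrM; have m0 := mu_gt0.
rewrite [`|_ / _|]ger0_norm ?divr_ge0 ?powq_ge0 ?(ltW m0)// [mu^-1 * _]mulrC.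
rewrite ler_piMl ?divr_ge0 ?powq_ge0 ?(ltW m0)//.
by rewrite ger0_norm ?mulr_ge0 ?root_factor_ge0// mulr_ile1 ?root_factor_ge0 ?root_factor_le1.
Qed.

Definition dominated F x := exists K, forall v, adml v -> `|F v| <= K * q `^ (x v).

Lemma dominatedM F G x y : dominated F x -> dominated G y ->
  dominated (fun v => F v * G v) (fun v => x v + y v).
Proof.
move=> [K hK] [L hL]; exists (K * L) => v av; rewrite normrM powqD mulrACA.
by apply: ler_pM => //; [exact: hK|exact: hL].
Qed.

Lemma dominatedW F x y : (forall v, adml v -> y v <= x v) -> dominated F x -> dominated F y.
Proof.
move=> h [K hK]; exists `|K| => v av; apply: le_trans (hK v av) _.
apply: le_trans (_ : `|K| * q `^ (x v) <= _).
  by rewrite ler_wpM2r ?powq_ge0// ler_norm.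
by rewrite ler_wpM2l//; apply: (powq_le hq); exact: h.
Qed.

Lemma dominatedB F G x : dominated F x -> dominated G x ->
  dominated (fun v => F v - G v) x.
Proof.
move=> [K hK] [L hL]; exists (K + L) => v av; rewrite mulrDl.
by rewrite (le_trans (ler_normB _ _))// lerD ?hK ?hL.
Qed.

Lemma dominated_pow x : dominated (fun v => q `^ (x v)) x.
Proof. by exists 1 => v _; rewrite mul1r ger0_norm ?powq_ge0. Qed.

Lemma dominated_bdd F : bdd F -> dominated F (fun=> 0).
Proof. by move=> [K hK]; exists K => v av; rewrite powRr0 mulr1 hK. Qed.

Lemma dominated_cst (a : R) : dominated (fun=> a) (fun=> 0).
Proof. by apply: dominated_bdd; exists `|a|. Qed.

Lemma dominated_qnum x : (forall v, adml v -> 0 <= x v) ->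
  dominated (fun v => qnum q (x v)) (fun v => - x v).
Proof. by move=> h; exists mu^-1 => v /h /qnum_le; rewrite mulrC. Qed.

Lemma dominated_qnumV x : (forall v, adml v -> 1 <= x v) ->
  dominated (fun v => (qnum q (x v))^-1) x.
Proof. by move=> h; exists (mu * (1 - q `^ 2)^-1) => v /h /qnum_inv_le. Qed.

Lemma dominated_sqrt x y : (forall v, adml v -> 0 <= x v) ->
  dominated (fun v => Num.sqrt (qnum q (x v) * qnum q (y v))) (fun v => - ((x v + y v) / 2)).
Proof. by move=> h; exists mu^-1 => v /h /sqrt_qnum_le; apply. Qed.

End Factors.

(** * Asymptotics of the coefficients of the representation *)
Section Coefficients.
Variables (R : realType) (q : R).
Hypothesis hq : 0 < q < 1.
Let q0 : 0 < q. Proof. by case/andP: hq. Qed.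
Implicit Types (v d : label) (i : axis) (F G : label -> R).

Local Notation N1 v := ((n1 v)%:~R : R).
Local Notation K1 v := ((k1 v)%:~R : R).
Local Notation N2 v := ((n2 v)%:~R : R).
Local Notation K2 v := ((k2 v)%:~R : R).
Local Notation spl := (label_l R). Local Notation spj := (label_j R).
Local Notation spm1 := (label_m1 R). Local Notation spm2 := (label_m2 R).
Local Notation vanishes := (vanishing_on q adml).
Local Notation bdd := (bounded_on adml).
Local Notation feels := (feels q).
Local Notation std := (standard_factor q).
Local Notation an1 := ((false, false) : axis).
Local Notation ak1 := ((true, false) : axis).
Local Notation an2 := ((false, true) : axis).
Local Notation ak2 := ((true, true) : axis).

Definition epsilon v : R := eps (spl v) (spj v) (spm2 v).

Lemma epsilonE v : epsilon v = 2^-1 * (-1) ^ k2 v.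
Proof.
rewrite /epsilon /eps; congr (_ * (_ ^ _)).
have -> : spl v + 2^-1 - spj v - spm2 v = (k2 v)%:~R.
  by rewrite /label_l totalR /label_j /label_m2; lra.
by rewrite intrKfloor.
Qed.

Lemma sign_int (z : int) : (-1) ^ z = (if (z %% 2)%Z == 0 then 1 else -1) :> R.
Proof.
have m1 : -1 != 0 :> R by rewrite oppr_eq0 oner_eq0.
have sq1 (m : int) : (-1) ^ (2 * m) = 1 :> R.
  rewrite -exprz_exp; have -> : (-1) ^ (2 : int) = 1 :> R by exact: sqrr_sign 1%N.
  by rewrite exp1rz.
case: eqP => h.
  have -> : z = 2 * (z %/ 2)%Z by lia.
  by rewrite sq1.
have -> : z = 2 * (z %/ 2)%Z + 1 by lia.
by rewrite expfzDr// sq1 mul1r expr1z.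
Qed.

Lemma adm_real v : adml v -> [/\ 0 <= N1 v, 0 <= K1 v, 0 <= N2 v, 0 <= K2 v &
  1 <= N1 v + K1 v /\ 1 <= N2 v + K2 v].
Proof.
move=> /and5P[h1 h2 h3 h4 /andP[h5 h6]].
have h7 : 1 <= n1 v + k1 v by lia.
have h8 : 1 <= n2 v + k2 v by lia.
by rewrite -!intrD !ler0z -[1]/(1%:~R) !ler_int.
Qed.

Lemma epsilon_cases v : adml v ->
  (epsilon v = 2^-1 /\ 1 <= N2 v) \/ (epsilon v = - 2^-1 /\ 1 <= K2 v).
Proof.
move=> /and5P[h1 h2 h3 h4 /andP[h5 h6]].
rewrite epsilonE sign_int -[1 <= N2 v]/(1%:~R <= N2 v) -[1 <= K2 v]/(1%:~R <= K2 v) !ler_int.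
case: eqP => h; [left|right]; split; rewrite ?mulr1 ?mulrN1//; lia.
Qed.

(** The sign is given by the parity of k2, thus also by that of n2, as n2 + k2
    is odd; this makes it a function of the lowest coordinate. *)
Lemma epsilon_exact v w : adml v -> adml w -> n2 v = n2 w -> epsilon v = epsilon w.
Proof.
move=> /and5P[_ _ _ _ /andP[_ /eqP h]] /and5P[_ _ _ _ /andP[_ /eqP h']] e.
rewrite !epsilonE !sign_int; rewrite e in h.
by have -> : ((k2 v %% 2)%Z == 0) = ((k2 w %% 2)%Z == 0) by lia.
Qed.

Lemma upper_fix i t d v : supported (upper i) d -> (rank t < rank i)%N -> (v + d) t = v t.
Proof.
move=> sd ti; rewrite labelD; have [->|/sd] := eqVneq (d t) 0; first by rewrite addr0.
by rewrite /upper leqNgt ti.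
Qed.

Lemma fix_k2 d v : supported (upper ak2) d -> adml v -> adml (v + d) ->
  [/\ n1 (v + d) = n1 v, k1 (v + d) = k1 v, n2 (v + d) = n2 v & epsilon (v + d) = epsilon v].
Proof.
move=> sd av avd; have e : n2 (v + d) = n2 v by exact: upper_fix sd _.
by split=> //; [exact: upper_fix sd _|exact: upper_fix sd _|exact: epsilon_exact].
Qed.
Lemma fix_k1 d v : supported (upper ak1) d -> adml v -> adml (v + d) ->
  [/\ n1 (v + d) = n1 v, n2 (v + d) = n2 v & epsilon (v + d) = epsilon v].
Proof.
move=> sd av avd; have e : n2 (v + d) = n2 v by exact: upper_fix sd _.
by split=> //; [exact: upper_fix sd _|exact: epsilon_exact].
Qed.
Lemma fix_n1 d v : supported (upper an1) d -> adml v -> adml (v + d) ->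
  n2 (v + d) = n2 v /\ epsilon (v + d) = epsilon v.
Proof.
move=> sd av avd; have e : n2 (v + d) = n2 v by exact: upper_fix sd _.
by split=> //; exact: epsilon_exact.
Qed.

Lemma vanishes_opp i F : vanishes i F -> vanishes i (fun v => - F v).
Proof. by move=> [K hK]; exists K => v /hK; rewrite normrN. Qed.
Lemma feels_opp i F : feels i F -> feels i (fun v => - F v).
Proof.
by move=> h d /h[K hK]; exists K => v av avd; rewrite -opprD normrN hK.
Qed.

Definition FAp v := Ap q (spj v) (spm1 v).
Definition FA0 v := A0 q (spj v) (spm1 v).
Definition FBp v := Bp q (spj v) (spm1 v).
Definition FB0 v := B0 q (spj v) (spm1 v).
Definition FBm v := Bm q (spj v) (spm1 v).
Definition FCp v := Cp q (spl v) (spj v) (spm2 v).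
Definition FC0 v := C0 q (spl v) (spj v) (spm2 v).
Definition FCm v := Cm q (spl v) (spj v) (spm2 v).
Definition FHp v := Hp q (spl v) (spj v) (spm2 v).
Definition FH0 v := H0 q (spl v) (spj v) (spm2 v).
Definition FDp v := Dp q (spl v) (spj v) (spm2 v).
Definition FD0 v := D0 q (spl v) (spj v) (spm2 v).
Definition FDm v := Dm q (spl v) (spj v) (spm2 v).

Ltac unsp := rewrite /label_l ?totalR /label_j /label_m1 /label_m2.

Lemma FApE v : adml v -> FAp v = std (fun v => N1 v) (fun v => N1 v + 1)
  (fun v => K1 v + 1) (fun v => N1 v + K1 v + 2) v.
Proof.
move=> av; have [? ? ? ? [? ?]] := adm_real av.
rewrite /FAp /Ap standard_factor_qnum//; last by unsp; lra.
by rewrite /standard_factor; congr (q `^ _ * (root_factor q _ * root_factor q _) * inverse_factor q _); unsp; lra.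
Qed.

Lemma FBpE v : adml v -> FBp v = std (fun v => 0) (fun v => N1 v + 1)
  (fun v => N1 v + 2) (fun v => N1 v + K1 v + 2) v.
Proof.
move=> av; have [? ? ? ? [? ?]] := adm_real av.
rewrite /FBp /Bp standard_factor_qnum//; last by unsp; lra.
by rewrite /standard_factor; congr (q `^ _ * (root_factor q _ * root_factor q _) * inverse_factor q _); unsp; lra.
Qed.

Lemma FBmE v : adml v -> FBm v = - std (fun v => N1 v + N1 v + 1) (fun v => K1 v)
  (fun v => K1 v - 1) (fun v => N1 v + K1 v) v.
Proof.
move=> av; have [? ? ? ? [? ?]] := adm_real av.
rewrite /FBm /Bm standard_factor_qnum//; last by unsp; lra.
by rewrite /standard_factor; congr (- (q `^ _ * (root_factor q _ * root_factor q _) * inverse_factor q _)); unsp; lra.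
Qed.

Local Notation W v := (N1 v + K1 v + N2 v + K2 v).

Lemma FCpE v : adml v -> FCp v = - std (fun v => N2 v - 2^-1 - epsilon v)
  (fun v => N1 v + K1 v + N2 v + 5 / 2 + epsilon v)
  (fun v => N1 v + K1 v + K2 v + 5 / 2 - epsilon v) (fun v => W v + 3) v.
Proof.
move=> av; have [? ? ? ? [? ?]] := adm_real av.
rewrite /FCp /Cp standard_factor_qnum// -/(epsilon v).
  by rewrite /standard_factor; congr (- (q `^ _ * (root_factor q _ * root_factor q _) * inverse_factor q _)); unsp; lra.
by have [[-> ?]|[-> ?]] := epsilon_cases av; unsp; lra.
Qed.

Lemma FCmE v : adml v -> FCm v = - std (fun v => N1 v + K1 v + N2 v + 2^-1 + epsilon v)
  (fun v => N2 v - 2^-1 - epsilon v)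
  (fun v => K2 v - 2^-1 + epsilon v) (fun v => W v + 1) v.
Proof.
move=> av; have [? ? ? ? [? ?]] := adm_real av.
rewrite /FCm /Cm standard_factor_qnum// -/(epsilon v).
  by rewrite /standard_factor; congr (- (q `^ _ * (root_factor q _ * root_factor q _) * inverse_factor q _)); unsp; lra.
by have [[-> ?]|[-> ?]] := epsilon_cases av; unsp; lra.
Qed.

Definition epsilon2j1 v := epsilon v * (N1 v + K1 v + 1).

Lemma FHpE v : adml v -> FHp v = std
  (fun v => N2 v + (N1 v + K1 v) / 2 + 2^-1 + epsilon2j1 v)
  (fun v => K2 v + (N1 v + K1 v) / 2 + 3 / 2 + epsilon2j1 v)
  (fun v => N2 v + (N1 v + K1 v) / 2 + 3 / 2 - epsilon2j1 v) (fun v => W v + 3) v.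
Proof.
move=> av; have [? ? ? ? [? ?]] := adm_real av.
rewrite /FHp /Hp standard_factor_qnum// -/(epsilon v).
  by rewrite /standard_factor; congr (q `^ _ * (root_factor q _ * root_factor q _) * inverse_factor q _); rewrite /epsilon2j1; unsp; lra.
by have [[-> ?]|[-> ?]] := epsilon_cases av; unsp; lra.
Qed.

Lemma FDpE v : adml v -> FDp v = std (fun v => 0)
  (fun v => N1 v + K1 v + N2 v + 5 / 2 + epsilon v)
  (fun v => N2 v + 3 / 2 - epsilon v) (fun v => W v + 3) v.
Proof.
move=> av; have [? ? ? ? [? ?]] := adm_real av.
rewrite /FDp /Dp standard_factor_qnum// -/(epsilon v).
  by rewrite /standard_factor; congr (q `^ _ * (root_factor q _ * root_factor q _) * inverse_factor q _); unsp; lra.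
by have [[-> ?]|[-> ?]] := epsilon_cases av; unsp; lra.
Qed.

Lemma FDmE v : adml v -> FDm v = - std (fun v => N1 v + K1 v + N2 v + N2 v + 2)
  (fun v => K2 v - 2^-1 + epsilon v)
  (fun v => N1 v + K1 v + K2 v + 2^-1 - epsilon v) (fun v => W v + 1) v.
Proof.
move=> av; have [? ? ? ? [? ?]] := adm_real av.
rewrite /FDm /Dm standard_factor_qnum// -/(epsilon v).
  by rewrite /standard_factor; congr (- (q `^ _ * (root_factor q _ * root_factor q _) * inverse_factor q _)); unsp; lra.
by have [[-> ?]|[-> ?]] := epsilon_cases av; unsp; lra.
Qed.

Ltac side := let v := fresh "v" in let av := fresh "av" in let he := fresh "he" in
  move=> v av;
  have [? ? ? ? [? ?]] := adm_real av;
  rewrite /epsilon2j1;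
  have [[he ?]|[he ?]] := epsilon_cases av; rewrite ?he;
  rewrite -?[v an1]/(n1 v) -?[v ak1]/(k1 v) -?[v an2]/(n2 v) -?[v ak2]/(k2 v); lra.
Ltac ex_n1 := let d := fresh "d" in let sd := fresh "sd" in let v := fresh "v" in
  let av := fresh "av" in let avd := fresh "avd" in let e1 := fresh "e" in let e2 := fresh "e" in
  move=> d sd v av avd; rewrite /epsilon2j1; have [e1 e2] := fix_n1 sd av avd; rewrite ?e1 ?e2; lra.
Ltac ex_k1 := let d := fresh "d" in let sd := fresh "sd" in let v := fresh "v" in
  let av := fresh "av" in let avd := fresh "avd" in
  let e1 := fresh "e" in let e2 := fresh "e" in let e3 := fresh "e" in
  move=> d sd v av avd; rewrite /epsilon2j1; have [e1 e2 e3] := fix_k1 sd av avd; rewrite ?e1 ?e2 ?e3; lra.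
Ltac ex_k2 := let d := fresh "d" in let sd := fresh "sd" in let v := fresh "v" in
  let av := fresh "av" in let avd := fresh "avd" in
  let e1 := fresh "e" in let e2 := fresh "e" in let e3 := fresh "e" in let e4 := fresh "e" in
  move=> d sd v av avd; rewrite /epsilon2j1; have [e1 e2 e3 e4] := fix_k2 sd av avd;
  rewrite ?e1 ?e2 ?e3 ?e4; lra.
Ltac solve_mild := first [by left; ex_n1 | by left; ex_k1 | by left; ex_k2 | by right; side].
Ltac solve_feels C := apply: (@standard_factor_feels _ _ hq _ _ _ _ _ C);
  [side|side|first [ex_n1|ex_k1|ex_k2|by move=> ? ? ? ? ?]|solve_mild|solve_mild|solve_mild].
Ltac solve_vanishes C := apply: (@standard_factor_vanishes _ _ hq _ _ _ _ _ C); side.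

Lemma FAp_facts : [/\ bdd FAp, vanishes an1 FAp, feels ak1 FAp & feels ak2 FAp].
Proof.
have v1 : vanishes an1 FAp by apply: (eq_on_vanishes FApE); solve_vanishes (0:R).
by split=> //; [exact: (vanishes_bdd hq v1)|apply: (eq_on_feels FApE); solve_feels (0:R)..].
Qed.

Lemma FBp_facts : [/\ bdd FBp, feels an1 FBp, feels ak1 FBp & feels ak2 FBp].
Proof.
split; first by apply: (eq_on_bdd FBpE); apply: (@standard_factor_bdd _ _ hq _ _ _ _ 0); side.
all: by apply: (eq_on_feels FBpE); solve_feels (0:R).
Qed.

Lemma FBm_facts : [/\ bdd FBm, vanishes an1 FBm, feels ak1 FBm & feels ak2 FBm].
Proof.
have v1 : vanishes an1 FBm.
  by apply: (eq_on_vanishes FBmE); apply: vanishes_opp; solve_vanishes (0:R).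
by split=> //; [exact: (vanishes_bdd hq v1)|apply: (eq_on_feels FBmE); apply: feels_opp; solve_feels (0:R)..].
Qed.

Lemma FCp_facts : [/\ bdd FCp, vanishes an2 FCp, feels an1 FCp, feels ak1 FCp & feels ak2 FCp].
Proof.
have v1 : vanishes an2 FCp.
  by apply: (eq_on_vanishes FCpE); apply: vanishes_opp; solve_vanishes (1:R).
by split=> //; [exact: (vanishes_bdd hq v1)|apply: (eq_on_feels FCpE); apply: feels_opp; solve_feels (1:R)..].
Qed.

Lemma FCm_facts : [/\ bdd FCm, vanishes an1 FCm, vanishes an2 FCm, vanishes ak1 FCm & feels ak2 FCm].
Proof.
have v i : i \in [:: an1; an2; ak1] -> vanishes i FCm.
  rewrite !inE => /or3P[] /eqP ->;
  by apply: (eq_on_vanishes FCmE); apply: vanishes_opp; solve_vanishes (1:R).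
split; try by apply: v.
  by apply: (vanishes_bdd hq (v an1 _)).
by apply: (eq_on_feels FCmE); apply: feels_opp; solve_feels (1:R).
Qed.

Lemma FHp_facts : [/\ bdd FHp, vanishes an2 FHp & feels ak2 FHp].
Proof.
have v1 : vanishes an2 FHp by apply: (eq_on_vanishes FHpE); solve_vanishes (1:R).
by split=> //; [exact: (vanishes_bdd hq v1)|apply: (eq_on_feels FHpE); solve_feels (1:R)].
Qed.

Lemma FDp_facts : [/\ bdd FDp, feels an1 FDp, feels an2 FDp, feels ak1 FDp & feels ak2 FDp].
Proof.
split; first by apply: (eq_on_bdd FDpE); apply: (@standard_factor_bdd _ _ hq _ _ _ _ 0); side.
all: by apply: (eq_on_feels FDpE); solve_feels (0:R).
Qed.

Lemma FDm_facts : [/\ bdd FDm, vanishes an1 FDm, vanishes an2 FDm, vanishes ak1 FDm & feels ak2 FDm].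
Proof.
have v i : i \in [:: an1; an2; ak1] -> vanishes i FDm.
  rewrite !inE => /or3P[] /eqP ->;
  by apply: (eq_on_vanishes FDmE); apply: vanishes_opp; solve_vanishes (1:R).
split; try by apply: v.
  by apply: (vanishes_bdd hq (v an1 _)).
by apply: (eq_on_feels FDmE); apply: feels_opp; solve_feels (1:R).
Qed.

Local Notation dominated := (dominated q).

Ltac spside := let v := fresh "v" in let av := fresh "av" in let he := fresh "he" in
  move=> v av; have [? ? ? ? [? ?]] := adm_real av;
  have [[he ?]|[he ?]] := epsilon_cases av; rewrite -?/(epsilon v) ?he; unsp; lra.

Lemma invj_bound : dominated (fun v => (qnum q (2 * spj v) * qnum q (2 * spj v + 2))^-1)
    (fun v => 2 * (N1 v + K1 v) + 2).
Proof.
have z1 v : adml v -> 1 <= 2 * spj v by move: v; spside.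
have z2 v : adml v -> 1 <= 2 * spj v + 2 by move: v; spside.
under eq_fun do rewrite invfM.
by apply: (dominatedW hq _ (dominatedM hq (dominated_qnumV hq z1) (dominated_qnumV hq z2))); spside.
Qed.

Lemma invl_bound : dominated (fun v => (qnum q (2 * spl v + 2) * qnum q (2 * spl v + 4))^-1)
    (fun v => 2 * W v + 4).
Proof.
have z1 v : adml v -> 1 <= 2 * spl v + 2 by move: v; spside.
have z2 v : adml v -> 1 <= 2 * spl v + 4 by move: v; spside.
under eq_fun do rewrite invfM.
by apply: (dominatedW hq _ (dominatedM hq (dominated_qnumV hq z1) (dominated_qnumV hq z2))); spside.
Qed.

Lemma FA0_bound : dominated FA0 (fun v => N1 v + K1 v).
Proof.
have z1 v : adml v -> 0 <= spj v - spm1 v by move: v; spside.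
have z2 v : adml v -> 0 <= 2 * spj v by move: v; spside.
have h1 : dominated (fun v => q `^ (spj v + spm1 v + 1) * qnum q 2 * qnum q (spj v - spm1 v))
    (fun v => - (N1 v + K1 v)).
  by apply: (dominatedW hq _ (dominatedM hq (dominatedM hq (dominated_pow q _)
    (dominated_cst _ (qnum q 2))) (dominated_qnum hq z1))); spside.
have h2 : dominated (fun v => qnum q (2 * spj v)) (fun v => - (N1 v + K1 v)).
  by apply: (dominatedW hq _ (dominated_qnum hq z2)); spside.
by apply: (dominatedW hq _ (dominatedM hq (dominated_cst _ (q `^ (- 2)))
  (dominatedM hq (dominatedB h1 h2) invj_bound))); spside.
Qed.

Lemma FB0_bound : dominated FB0 (fun v => N1 v + K1 v).
Proof.
have z1 v : adml v -> 0 <= spj v - spm1 v by move: v; spside.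
by apply: (dominatedW hq _ (dominatedM hq (dominatedM hq (dominatedM hq
  (dominated_cst _ (1 + q ^+ 2)) (dominated_pow q _)) (dominated_sqrt hq _ z1)) invj_bound)); spside.
Qed.

Lemma FC0_bound : dominated FC0 (fun v => W v).
Proof.
have z1 v : adml v -> 0 <= spl v + 2^-1 + spj v - 2 * epsilon v * spm2 v + 2 by move: v; spside.
have h4 : dominated (fun v => qnum q (4 * epsilon v)) (fun=> 0).
  apply: dominated_bdd; exists (`|qnum q (4 * 2^-1)| + `|qnum q (4 * - 2^-1)|) => v av.
  by have [[-> _]|[-> _]] := epsilon_cases av; rewrite ?lerDl ?lerDr.
by apply: (dominatedW hq _ (dominatedM hq (dominatedM hq (dominatedM hq
  h4 (dominated_pow q _)) (dominated_sqrt hq _ z1)) invl_bound)); spside.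
Qed.

Lemma FD0_bound : dominated FD0 (fun v => W v).
Proof.
have z1 v : adml v -> 0 <= spl v - 2 * epsilon v * spj v - spm2 v + 1 - epsilon v by move: v; spside.
by apply: (dominatedW hq _ (dominatedM hq (dominatedM hq (dominatedM hq
  (dominated_cst _ (qnum q 2)) (dominated_pow q _)) (dominated_sqrt hq _ z1)) invl_bound)); spside.
Qed.

(** This alone does not decrease with l when j is close to l; the factors
    A^0 and B^0 supply the missing power of q. *)
Lemma FH0_bound : dominated FH0 (fun v => N2 v + K2 v).
Proof.
have z1 v : adml v -> 0 <= spl v - epsilon v * (2 * spj v + 1) - spm2 v + 1 by move: v; spside.
have z2 v : adml v -> 0 <= spl v - epsilon v * (2 * spj v + 1) + spm2 v + 2 by move: v; spside.
have z3 v : adml v -> 0 <= spl v + epsilon v * (2 * spj v + 1) - spm2 v + 2 by move: v; spside.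
have z4 v : adml v -> 0 <= spl v + epsilon v * (2 * spj v + 1) + spm2 v + 1 by move: v; spside.
have h1 : dominated (fun v => qnum q (spl v - epsilon v * (2 * spj v + 1) - spm2 v + 1) *
    qnum q (spl v - epsilon v * (2 * spj v + 1) + spm2 v + 2))
    (fun v => - (2 * (N1 v + K1 v) + N2 v + K2 v + 4)).
  by apply: (dominatedW hq _ (dominatedM hq (dominated_qnum hq z1) (dominated_qnum hq z2))); spside.
have h2 : dominated (fun v => q `^ (- 2) * qnum q (spl v + epsilon v * (2 * spj v + 1) - spm2 v + 2) *
    qnum q (spl v + epsilon v * (2 * spj v + 1) + spm2 v + 1))
    (fun v => - (2 * (N1 v + K1 v) + N2 v + K2 v + 4)).
  by apply: (dominatedW hq _ (dominatedM hq (dominatedM hq (dominated_cst _ (q `^ (- 2)))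
    (dominated_qnum hq z3)) (dominated_qnum hq z4))); spside.
by apply: (dominatedW hq _ (dominatedM hq (dominatedB h1 h2) invl_bound)); spside.
Qed.

Lemma bound_vanishes i F : i \in [:: an1; ak1] ->
  dominated F (fun v => N1 v + K1 v) -> vanishes i F.
Proof.
move=> ii [K hK]; exists `|K| => v av; apply: le_trans (hK _ av) _.
apply: le_trans (_ : `|K| * q `^ (N1 v + K1 v) <= _).
  by rewrite ler_wpM2r ?ler_norm// powq_ge0.
rewrite ler_wpM2l//; apply: (powq_le hq); have [? ? ? ? _] := adm_real av.
by move: ii; rewrite !inE => /orP[] /eqP ->; rewrite -?[v an1]/(n1 v) -?[v ak1]/(k1 v); lra.
Qed.

Lemma exact_j F : (forall v w, n1 v = n1 w -> k1 v = k1 w -> F v = F w) -> feels ak2 F.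
Proof.
move=> h; apply: feels_exact => d sd v av avd; have [e1 e2 _ _] := fix_k2 sd av avd.
exact: h.
Qed.

Lemma FA0_facts : [/\ bdd FA0, vanishes an1 FA0, vanishes ak1 FA0 & feels ak2 FA0].
Proof.
have v1 := bound_vanishes (i := an1) isT FA0_bound.
have v2 := bound_vanishes (i := ak1) isT FA0_bound.
split=> //; first exact: (vanishes_bdd hq v1).
by apply: exact_j => v w e1 e2; rewrite /FA0 /label_j /label_m1 e1 e2.
Qed.

Lemma FB0_facts : [/\ bdd FB0, vanishes an1 FB0, vanishes ak1 FB0 & feels ak2 FB0].
Proof.
have v1 := bound_vanishes (i := an1) isT FB0_bound.
have v2 := bound_vanishes (i := ak1) isT FB0_bound.
split=> //; first exact: (vanishes_bdd hq v1).
by apply: exact_j => v w e1 e2; rewrite /FB0 /label_j /label_m1 e1 e2.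
Qed.

Definition negligible_symbol F := dominated F (fun v => W v).

Lemma negligible_A0H0 : negligible_symbol (fun v => FA0 v * FH0 v).
Proof. by apply: (dominatedW hq _ (dominatedM hq FA0_bound FH0_bound)) => v av; lra. Qed.
Lemma negligible_B0H0 : negligible_symbol (fun v => FB0 v * FH0 v).
Proof. by apply: (dominatedW hq _ (dominatedM hq FB0_bound FH0_bound)) => v av; lra. Qed.

Lemma negligible_bdd F G : bdd F -> negligible_symbol G -> negligible_symbol (fun v => F v * G v).
Proof.
move=> /dominated_bdd bF nG.
by apply: (dominatedW hq _ (dominatedM hq (bF q) nG)) => v av; lra.
Qed.

End Coefficients.

(** * The generators are lower operators *)
Section Generators.
Variables (R : realType) (q : R).
Hypothesis hq : 0 < q < 1.
Variable H : completeNormedModType R[i].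
Variable ip : {dot H for (@Num.conj R[i])}.
Hypothesis hip : hilbert_norm ip.
Variable ket : bool -> R -> R -> R -> R -> H.
Hypothesis hket : spinor_basis ket ip.
Implicit Types (v d : label) (i : axis) (F G : label -> R) (x y : spin_index).

Local Notation e := (spin_ket ket).
Let gb := spin_graded_basis hip hket.
Local Notation smoothing := (smoothing ip e adm_index degree).
Local Notation banded_operator := (banded_operator ip e adm_index degree).
Local Notation rapid := (rapid adm_index degree).
Local Notation pdo := (pdo q ip e lower upper).
Local Notation vanishes := (vanishing_on q adml).
Local Notation bdd := (bounded_on adml).
Local Notation feels := (feels q).

(** The family [f] is the image of the basis by an operator of the calculus, up
    to a rapidly decreasing error.  This additive notion follows the
    terms of the formulas for the generators, where individual terms are not
    yet known to come from bounded operators. *)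
Definition symbolic (f : spin_index -> H) := exists P, [/\ pdo P,
  exists N, forall x y, adm_index x -> adm_index y -> ~~ degree_close degree N x y -> ip (f x) (e y) = 0
  & rapid (fun x => f x - P (e x))].

Lemma symbolic_pdo T f : bounded_operator T -> (forall x, adm_index x -> T (e x) = f x) ->
  symbolic f -> pdo T.
Proof.
move=> bT Tf [P [pP [N hN] rP]]; have [bP [M hM]] := pdo_banded gb pP.
have sS : smoothing (fun u => T u - P u).
  split; first exact: bounded_sub.
    exists (maxn N M) => x y ax ay nxy; rewrite ipBl Tf// hN//.
      by rewrite (bandedW gb (leq_maxr N M) hM)// subr0.
    by apply: contraNN nxy; rewrite /degree_close => /andP[h1 h2]; lia.
  by move=> p; have [K hK] := rP p; exists K => x ax /=; rewrite Tf// hK.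
have -> : T = (fun u => P u + (T u - P u)) by apply/funext => u; rewrite addrC subrK.
exact: (pdo_add pP (pdo_smoothing q lower upper sS)).
Qed.

Lemma symbolic_add f f' : symbolic f -> symbolic f' -> symbolic (fun x => f x + f' x).
Proof.
move=> [P [pP [N hN] rP]] [P' [pP' [N' hN'] rP']].
exists (fun u => P u + P' u); split; first exact: pdo_add.
  exists (maxn N N') => x y ax ay nxy; rewrite ipDl hN ?hN' ?addr0//;
  by apply: contraNN nxy; rewrite /degree_close => /andP[h1 h2]; lia.
move=> p; have [K hK] := rP p; have [L hL] := rP' p; exists (K + L) => x ax.
apply: le_trans (lerD (hK x ax) (hL x ax)); rewrite -mulrDl.
by rewrite ler_wpM2r ?exprn_ge0// opprD addrACA rnormD.
Qed.

Lemma symbolic_opp f : symbolic f -> symbolic (fun x => - f x).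
Proof.
move=> [P [pP [N hN] rP]]; exists (fun u => -1 *: P u); split; first exact: pdo_scale.
  by exists N => x y ax ay nxy; rewrite -scaleN1r ipZl hN// mulr0.
move=> p; have [K hK] := rP p; exists K => x ax.
by rewrite scaleN1r -opprD rnormN hK.
Qed.

Lemma symbolic_symbol d c f : regime q (active d) lower upper d c ->
  (forall x, adm_index x -> f x = (c x.2)%:C%C *: e (move_index false d x)) -> symbolic f.
Proof.
move=> rc fE; have sc := symbol_cutoff hq lower_upper rc.
have [P sP] := shift_op_ex gb false sc.
have PE x : adm_index x -> P (e x) = f x.
  move=> ax; have [_ ->//] := sP; rewrite fE// /cutoff.
  have [//|na] := boolP (adml (x.2 + d)).
  by rewrite [e _](gb_out gb)// !scaler0.
exists P; split; first exact: pdo_shift sc sP.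
  by have [_ [N hN]] := shift_op_banded gb sP; exists N => x y ax ay nxy; rewrite -PE// hN.
by move=> p; exists 0 => x ax; rewrite PE// subrr rnorm0 mul0r.
Qed.

Lemma bounded_zero : bounded_operator (fun _ : H => 0 : H).
Proof.
apply/bounded_operatorP; split; first by move=> a u w; rewrite scaler0 addr0.
by exists 0; split=> // u; rewrite rnorm0 mul0r.
Qed.

Lemma symbolic_negligible d (b : spin_index -> R) f :
  (exists K, forall x, adm_index x -> adm_index (move_index false d x) ->
     `|b x| <= K * q `^ (total x.2)%:~R) ->
  (forall x, adm_index x -> f x = (b x)%:C%C *: e (move_index false d x)) -> symbolic f.
Proof.
move=> [K hK] fE; exists (fun=> 0); split.
- apply: pdo_smoothing; split; first exact: bounded_zero.
    by exists 0%N => x y *; rewrite ip0l.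
  by move=> p; exists 0 => x ax; rewrite /= rnorm0 mul0r.
- exists (absz (total d)) => x y ax ay nxy; rewrite fE// ipZl (ip_e gb)//.
  case: eqP => [xy|_]; last by rewrite mulr0.
  case/negP: nxy; have hy : degree y = absz (total x.2 + total d) by rewrite -xy /degree /= totalD.
  rewrite /degree_close hy /degree; clear; move: (total x.2) (total d) => a c.
  by apply/andP; split; lia.
- move=> p; have [L hL] := rapid_power p hq; exists (`|K| * L) => x ax; rewrite subr0 fE//.
  have [ad|na] := boolP (adm_index (move_index false d x)); last first.
    rewrite (gb_out gb)// scaler0 rnorm0 mul0r mulr_ge0//.
    by have := hL 0%N; rewrite expr0 mul1r; apply: le_trans; rewrite expr1n.
  rewrite rnormZ -/(cmod _) cmodR (rnorm_e gb)// mulr1.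
  apply: le_trans (_ : `|K| * (q ^+ degree x * (degree x).+1%:R ^+ p) <= _); last first.
    by rewrite ler_wpM2l.
  rewrite mulrA ler_wpM2r ?exprn_ge0//; apply: le_trans (hK _ ax ad) _.
  have /andP[q0 q1] := hq.
  rewrite -powR_mulrn ?(ltW q0)// -[(degree x)%:R]/((degree x)%:Z%:~R) degreeE//.
  by rewrite ler_wpM2r ?powR_ge0// ler_norm.
Qed.

(** Factors of a coefficient are evaluated at the source of the shift or at its
    target. *)
Definition endpoint (p : bool) d v := if p then v + d else v.

Definition regime_at i d F G := vanishes i F \/ vanishes i G \/
  (supported (lower i) d /\ feels i F /\ feels i G).

Lemma endpoint_vanishes p d i F : vanishes i F ->
  vanishing_on q (active d) i (fun v => F (endpoint p d v)).
Proof.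
move=> [K hK]; exists (`|K| * (1 + weight q i d)) => v /andP[av avd].
have w0 := weight_gt0 hq i v; have w1 := weight_gt0 hq i d.
have h : `|F (endpoint p d v)| <= `|K| * weight q i (endpoint p d v).
  apply: le_trans (hK _ _) _; first by case: p.
  by rewrite ler_wpM2r ?ler_norm// (ltW (weight_gt0 hq _ _)).
apply: (le_trans h); rewrite -mulrA ler_wpM2l//.
case: p {h}; rewrite /endpoint ?weightD// mulrDl mul1r ?lerDl ?mulr_ge0 ?(ltW w0) ?(ltW w1)//.
by rewrite mulrC lerDr (ltW w0).
Qed.

Lemma endpoint_bdd p d F : bdd F -> bounded_on (active d) (fun v => F (endpoint p d v)).
Proof. by move=> [K hK]; exists K => v /andP[av avd]; apply: hK; case: p. Qed.

Lemma endpoint_feels p d i F d' : feels i F -> supported (upper i) d' ->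
  invariant_on q (active d) i d' (fun v => F (endpoint p d v)).
Proof.
move=> fF sd; have [K hK] := fF d' sd.
exists (`|K| * (1 + weight q i d)) => v /andP[av avd] /andP[av' avd'].
have w0 := weight_gt0 hq i v; have w1 := weight_gt0 hq i d.
have E : endpoint p d (v + d') = endpoint p d v + d' by case: p => //=; rewrite addrAC.
have h : `|F (endpoint p d (v + d')) - F (endpoint p d v)| <= `|K| * weight q i (endpoint p d v).
  rewrite E; apply: le_trans (hK _ _ _) _; first by case: p {E}.
    by rewrite -E; case: p {E}.
  by rewrite ler_wpM2r ?ler_norm// (ltW (weight_gt0 hq _ _)).
apply: (le_trans h); rewrite -mulrA ler_wpM2l//.
case: p {h E}; rewrite /endpoint ?weightD// mulrDl mul1r ?lerDl ?mulr_ge0 ?(ltW w0) ?(ltW w1)//.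
by rewrite mulrC lerDr (ltW w0).
Qed.

(** In each limit one factor vanishes, or both are insensitive and the
    displacement is of lower type. *)
Lemma regime_prod p p' d F G : bdd F -> bdd G -> (forall i, regime_at i d F G) ->
  regime q (active d) lower upper d (fun v => F (endpoint p d v) * G (endpoint p' d v)).
Proof.
move=> bF bG h; have [K hK] := endpoint_bdd p d bF; have [L hL] := endpoint_bdd p' d bG.
split.
  by exists (K * L) => v av; rewrite normrM; apply: ler_pM => //; [exact: hK|exact: hL].
move=> i; have [/(endpoint_vanishes p d)[M hM]|[/(endpoint_vanishes p' d)[M hM]|[sd [fF fG]]]] := h i.
- left; exists (M * L) => v av; rewrite normrM mulrAC.
  by apply: ler_pM => //; [exact: hM|exact: hL].
- left; exists (K * M) => v av; rewrite normrM -mulrA.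
  by apply: ler_pM => //; [exact: hK|exact: hM].
- right; split=> // d' sd'.
  have [M hM] := endpoint_feels p d fF sd'; have [N hN] := endpoint_feels p' d fG sd'.
  exists (M * L + K * N) => v av avd.
  set f := F (endpoint p d v); set f' := F _; set g := G (endpoint p' d v); set g' := G _.
  have -> : f' * g' - f * g = (f' - f) * g' + f * (g' - g) by ring.
  rewrite (le_trans (ler_normD _ _))// [leRHS]mulrDl !normrM; apply: lerD.
    by rewrite mulrAC; apply: ler_pM => //; [exact: hM|exact: hL].
  by rewrite -mulrA; apply: ler_pM => //; [exact: hK|exact: hN].
Qed.

End Generators.

(** * The action of the three generators *)
Section SpinGenerators.
Variables (R : realType) (q : R).
Hypothesis hq : 0 < q < 1.
Variable H : completeNormedModType R[i].
Variable ip : {dot H for (@Num.conj R[i])}.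
Hypothesis hip : hilbert_norm ip.
Variable ket : bool -> R -> R -> R -> R -> H.
Hypothesis hket : spinor_basis ket ip.
Implicit Types (v d : label) (i : axis) (F G : label -> R) (x y : spin_index).

Local Notation symbolic := (symbolic q ip ket).
Local Notation pdo := (pdo q ip (spin_ket ket) lower upper).

Lemma spin_shift (a b c d : int) v : [/\ label_l R (v + mk_label a b c d) =
    label_l R v + (a%:~R + b%:~R + c%:~R + d%:~R) / 2,
  label_m1 R (v + mk_label a b c d) = label_m1 R v + (a%:~R - b%:~R) / 2,
  label_m2 R (v + mk_label a b c d) = label_m2 R v + (c%:~R - d%:~R) / 2 &
  label_j R (v + mk_label a b c d) = label_j R v + (a%:~R + b%:~R) / 2].
Proof.
have [E1 E2 E3 E4] := mk_labelE a b c d.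
have D1 : n1 (v + mk_label a b c d) = n1 v + a by rewrite -{2}E1 /n1 labelD.
have D2 : k1 (v + mk_label a b c d) = k1 v + b by rewrite -{2}E2 /k1 labelD.
have D3 : n2 (v + mk_label a b c d) = n2 v + c by rewrite -{2}E3 /n2 labelD.
have D4 : k2 (v + mk_label a b c d) = k2 v + d by rewrite -{2}E4 /k2 labelD.
rewrite /label_l !totalR /label_m1 /label_m2 /label_j D1 D2 D3 D4 !intrD; split; lra.
Qed.

(** Identifies a ket of the explicit formulas with a shifted basis vector. *)
Ltac ketmatch := cbn [fst snd]; rewrite /spin_ket /move_index /endpoint; cbn [fst snd]; rewrite addbF;
  match goal with |- (_ *: ket ?s ?l ?m1 ?m2 ?j) = (_ *: ket _ (label_l _ (?v + ?D)) _ _ _) =>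
    let E1 := fresh "E" in let E2 := fresh "E" in let E3 := fresh "E" in let E4 := fresh "E" in
    (have [E1 E2 E3 E4] : [/\ label_l R (v + D) = l, label_m1 R (v + D) = m1,
      label_m2 R (v + D) = m2 & label_j R (v + D) = j]; [
      match D with mk_label ?a ?b ?c ?d =>
        (have [-> -> -> ->] := spin_shift a b c d v) end; rewrite ?mulrNz; split; lra |]);
    (rewrite ?/FAp ?/FA0 ?/FBp ?/FB0 ?/FBm ?/FCp ?/FC0 ?/FCm
      ?/FHp ?/FH0 ?/FDp ?/FD0 ?/FDm ?E1 ?E2 ?E3 ?E4 ?mulr1 ?E1 ?E2 ?E3 ?E4)
  end.

Ltac supp := let t := fresh "t" in move=> t; rewrite ffunE; by case: t => -[] [].
Ltac regimes := case=> -[] [];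
  first [by left | by right; left | by right; right; split; [supp|split] ].
Ltac symbol_term D p p' F G := refine (@symbolic_symbol _ _ hq _ _ hip _ hket D
   (fun v => F (endpoint p D v) * G (endpoint p' D v)) _ _ _);
  [apply: (@regime_prod _ _ hq p p' D F G) => //; regimes
  | let s := fresh "s" in let v := fresh "v" in let av := fresh "av" in
    move=> [s v] av; ketmatch => //].

Lemma cst_bdd (a : R) : bounded_on adml (fun=> a).
Proof. by exists `|a|. Qed.
Lemma cst_feels (a : R) i : feels q i (fun=> a).
Proof. by apply: feels_exact. Qed.

Local Notation W v := ((n1 v)%:~R + (k1 v)%:~R + (n2 v)%:~R + (k2 v)%:~R : R).

Lemma negligible_at p d F : negligible_symbol q F ->
  exists K, forall v, active d v -> `|F (endpoint p d v)| <= K * q `^ (total v)%:~R.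
Proof.
move=> [K hK]; exists (`|K| * (1 + q `^ (total d)%:~R)) => v /andP[av avd].
have p0 (z : R) : 0 <= q `^ z by exact: powR_ge0.
have h : `|F (endpoint p d v)| <= `|K| * q `^ (total (endpoint p d v))%:~R.
  apply: le_trans (hK _ _) _; first by case: p.
  by rewrite -totalR ler_wpM2r ?ler_norm.
apply: (le_trans h); rewrite -mulrA ler_wpM2l//.
case: p {h} => /=; last by rewrite mulrDl mul1r lerDl mulr_ge0.
by rewrite totalD intrD (powqD hq) mulrDl mul1r [leLHS]mulrC lerDr.
Qed.

Lemma negligible_at_bdd d F G : bounded_on adml F -> negligible_symbol q G ->
  exists K, forall v, active d v -> `|F v * G (v + d)| <= K * q `^ (total v)%:~R.
Proof.
move=> [L hL] /(negligible_at true d)[K hK]; exists (L * K) => v av.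
rewrite normrM -mulrA; apply: ler_pM => //; last exact: hK.
by apply: hL; case/andP: av.
Qed.

Lemma symbolic_signed d (B : label -> R) f :
  (exists K, forall v, active d v -> `|B v| <= K * q `^ (total v)%:~R) ->
  (forall x, adm_index x ->
     f x = ((-1) ^+ x.1 * B x.2)%:C%C *: spin_ket ket (move_index false d x)) -> symbolic f.
Proof.
move=> [K hK] fE; apply: (symbolic_negligible hq hip hket _ fE); exists K => x ax ad.
rewrite normrM normrX normrN1 expr1n mul1r; apply: hK.
exact/andP.
Qed.

Ltac sign_term D B hB := refine (@symbolic_signed D B _ hB _);
  let s := fresh "s" in let v := fresh "v" in let av := fresh "av" in
    move=> [s v] av; ketmatch => //.

Lemma spin_x2_symbolic : symbolic (fun x =>
  spin_x2 ket q x.1 (label_l R x.2) (label_m1 R x.2) (label_m2 R x.2) (label_j R x.2)).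
Proof.
have [bDp n1Dp n2Dp k1Dp k2Dp] := FDp_facts hq.
have [bDm n1Dm n2Dm k1Dm k2Dm] := FDm_facts hq.
have b1 := cst_bdd 1; have f1 := cst_feels 1.
rewrite /spin_x2; apply: (symbolic_add hq); first apply: (symbolic_add hq).
- by symbol_term (mk_label 0 0 2 0) false false (FDp q) (fun _ : label => (1:R)); supp.
- by sign_term (mk_label 0 0 1 (-1)) (FD0 q) (negligible_at false (mk_label 0 0 1 (-1)) (FD0_bound hq)).
- by symbol_term (mk_label 0 0 0 (-2)) false false (FDm q) (fun _ : label => (1:R)); supp.
Qed.

Lemma spin_x1_symbolic : symbolic (fun x =>
  spin_x1 ket q x.1 (label_l R x.2) (label_m1 R x.2) (label_m2 R x.2) (label_j R x.2)).
Proof.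
have [bBp n1Bp k1Bp k2Bp] := FBp_facts hq.
have [bB0 n1B0 k1B0 k2B0] := FB0_facts hq.
have [bBm n1Bm k1Bm k2Bm] := FBm_facts hq.
have [bCp n2Cp n1Cp k1Cp k2Cp] := FCp_facts hq.
have [bCm n1Cm n2Cm k1Cm k2Cm] := FCm_facts hq.
have [bHp n2Hp k2Hp] := FHp_facts hq.
have nC0 := FC0_bound hq.
rewrite /spin_x1; repeat apply: (symbolic_add hq).
- by symbol_term (mk_label 2 0 0 0) false false (FBp q) (FCp q); supp.
- apply: symbolic_opp.
  by sign_term (mk_label 2 0 (-1) (-1)) (fun v => FBp q v * FC0 q v)
    (negligible_at false (mk_label 2 0 (-1) (-1)) (negligible_bdd hq bBp nC0)).
- by symbol_term (mk_label 2 0 (-2) (-2)) false false (FBp q) (FCm q); supp.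
- by symbol_term (mk_label 1 (-1) 1 1) false false (FB0 q) (FHp q); supp.
- by sign_term (mk_label 1 (-1) 0 0) (fun v => FB0 q v * FH0 q v)
    (negligible_at false (mk_label 1 (-1) 0 0) (negligible_B0H0 hq)).
- by symbol_term (mk_label 1 (-1) (-1) (-1)) false true (FB0 q) (FHp q); supp.
- by symbol_term (mk_label 0 (-2) 2 2) false true (FBm q) (FCm q); supp.
- apply: symbolic_opp.
  by sign_term (mk_label 0 (-2) 1 1) (fun v => FBm q v * FC0 q (v + mk_label 0 (-2) 1 1))
    (negligible_at_bdd (mk_label 0 (-2) 1 1) bBm nC0).
- by symbol_term (mk_label 0 (-2) 0 0) false true (FBm q) (FCp q); supp.
Qed.

Lemma spin_x0_symbolic : symbolic (fun x =>
  spin_x0 ket q x.1 (label_l R x.2) (label_m1 R x.2) (label_m2 R x.2) (label_j R x.2)).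
Proof.
have [bAp n1Ap k1Ap k2Ap] := FAp_facts hq.
have [bA0 n1A0 k1A0 k2A0] := FA0_facts hq.
have [bCp n2Cp n1Cp k1Cp k2Cp] := FCp_facts hq.
have [bCm n1Cm n2Cm k1Cm k2Cm] := FCm_facts hq.
have [bHp n2Hp k2Hp] := FHp_facts hq.
have nAC := negligible_bdd hq bAp (FC0_bound hq).
rewrite /spin_x0; repeat apply: (symbolic_add hq).
- by symbol_term (mk_label 1 1 0 0) false false (FAp q) (FCp q); supp.
- apply: symbolic_opp.
  by sign_term (mk_label 1 1 (-1) (-1)) (fun v => FAp q v * FC0 q v)
    (negligible_at false (mk_label 1 1 (-1) (-1)) nAC).
- by symbol_term (mk_label 1 1 (-2) (-2)) false false (FAp q) (FCm q); supp.
- by symbol_term (mk_label 0 0 1 1) false false (FA0 q) (FHp q); supp.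
- by sign_term (mk_label 0 0 0 0) (fun v => FA0 q v * FH0 q v)
    (negligible_at false (mk_label 0 0 0 0) (negligible_A0H0 hq)).
- by symbol_term (mk_label 0 0 (-1) (-1)) false true (FA0 q) (FHp q); supp.
- by symbol_term (mk_label (-1) (-1) 2 2) true true (FAp q) (FCm q); supp.
- apply: symbolic_opp.
  by sign_term (mk_label (-1) (-1) 1 1)
    (fun v => FAp q (v + mk_label (-1) (-1) 1 1) * FC0 q (v + mk_label (-1) (-1) 1 1))
    (negligible_at true (mk_label (-1) (-1) 1 1) nAC).
- by symbol_term (mk_label (-1) (-1) 0 0) true true (FAp q) (FCp q); supp.
Qed.

End SpinGenerators.

(** * The image of the quantum sphere *)
Section Representation.
Variables (R : realType) (q : R).
Hypothesis hq : 0 < q < 1.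
Variable H : completeNormedModType R[i].
Variable ip : {dot H for (@Num.conj R[i])}.
Hypothesis hip : hilbert_norm ip.
Variable ket : bool -> R -> R -> R -> R -> H.
Hypothesis hket : spinor_basis ket ip.
Variable pi : sphere q -> H -> H.
Hypothesis hpi : spinor_representation ket ip pi.

Local Notation e := (spin_ket ket).
Let gb := spin_graded_basis hip hket.
Local Notation pdo := (pdo q ip e lower upper).

Lemma pdo_id : pdo id.
Proof.
apply: (symbolic_pdo hq hip hket (f := e)) => //.
  by split=> //; exists 1 => w; rewrite mul1r.
apply: (@symbolic_symbol _ _ hq _ _ hip _ hket 0 (fun v => 1 * 1)).
  apply: (@regime_prod _ _ hq false false 0 (fun=> 1) (fun=> 1)).
  - exact: cst_bdd.
  - exact: cst_bdd.
  - move=> i; right; right; split; last by split; exact: cst_feels.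
    by move=> t; rewrite ffunE eqxx.
move=> [s v] _; rewrite mulr1 scale1r /move_index /=.
by rewrite addbF addr0.
Qed.

Lemma pdo_generator (k : 'I_3) : pdo (pi (sphere_class q (TGen k))).
Proof.
have [sr hk] := hpi.
have kE : sphere_class q (TGen k) = sphere_x q k by rewrite /sphere_x inord_val.
rewrite kE.
have bk := rep_bounded sr (sphere_x q k).
have [|k1|k2] : [\/ (k : nat) = 0%N, (k : nat) = 1%N | (k : nat) = 2%N].
  by case: k {kE bk} => -[|[|[|//]]] ? /=; [apply: Or31|apply: Or32|apply: Or33].
- move=> k0; apply: (symbolic_pdo hq hip hket bk _ (spin_x0_symbolic hq hip hket)).
  move=> [s v] av; rewrite k0; have [|-> _ _//] := hk s (label_l R v) (label_m1 R v) (label_m2 R v) (label_j R v).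
  by rewrite admissibleE.
- apply: (symbolic_pdo hq hip hket bk _ (spin_x1_symbolic hq hip hket)).
  move=> [s v] av; rewrite k1; have [|_ -> _//] := hk s (label_l R v) (label_m1 R v) (label_m2 R v) (label_j R v).
  by rewrite admissibleE.
- apply: (symbolic_pdo hq hip hket bk _ (spin_x2_symbolic hq hip hket)).
  move=> [s v] av; rewrite k2; have [|_ _ ->//] := hk s (label_l R v) (label_m1 R v) (label_m2 R v) (label_j R v).
  by rewrite admissibleE.
Qed.

(** Induction on expressions in the generators; the adjoint of an operator of
    the calculus is unique and belongs to the calculus. *)
Lemma pdo_representation a : pdo (pi a).
Proof.
have [sr _] := hpi; elim/sphere_ind: a; elim.
- exact: pdo_generator.
- have -> : pi (sphere_class q TZero) = (fun u => 0 *: u).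
    apply/funext => u; rewrite scale0r; apply: (addrI (pi (sphere_class q TZero) u)).
    by rewrite -(rep_add sr) addr0 -[sphere_class q TZero]/(0 : sphere q) addr0.
  by apply: (pdo_scale 0 (T := id)); exact: pdo_id.
- have -> : pi (sphere_class q TOne) = id by apply/funext => u; exact: (rep_one sr).
  exact: pdo_id.
- move=> s IH; have -> : pi (sphere_class q (TOpp s)) = (fun u => -1 *: pi (sphere_class q s) u).
    apply/funext => u; rewrite -(rep_scale sr) scaleN1r; congr (pi _ u).
    by rewrite -sphere_oppE.
  exact: pdo_scale.
- move=> s IHs t IHt.
  have -> : pi (sphere_class q (TAdd s t)) = (fun u => pi (sphere_class q s) u + pi (sphere_class q t) u).
    by apply/funext => u; rewrite -(rep_add sr) sphere_class_add.
  exact: pdo_add.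
- move=> s IHs t IHt.
  have -> : pi (sphere_class q (TMul s t)) = (fun u => pi (sphere_class q s) (pi (sphere_class q t) u)).
    by apply/funext => u; rewrite -(rep_mul sr) sphere_class_mul.
  exact: (pdo_comp IHs IHt).
- move=> c s IH; have -> : pi (sphere_class q (TScale c s)) = (fun u => c *: pi (sphere_class q s) u).
    by apply/funext => u; rewrite -(rep_scale sr) sphere_class_scale.
  exact: pdo_scale.
- move=> s IH; have [T' pT' aT'] := pdo_adjoint hq gb lower_upper IH.
  have -> // : pi (sphere_class q (TStar s)) = T'.
  apply: (adjoint_unique gb _ aT') => u w.
  by rewrite -sphere_starE (rep_star sr).
Qed.

End Representation.

Lemma spin_dirac (R : realType) (H : completeNormedModType R[i])
    (ip : {dot H for (@Num.conj R[i])}) (ket : bool -> R -> R -> R -> R -> H)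
    (D : unbounded_operator H) : dirac_operator ket ip D ->
  forall x, adm_index x -> dom D (spin_ket ket x) /\
    D (spin_ket ket x) = (dirac_eigenvalue R (degree x))%:C%C *: spin_ket ket (flip_sign x).
Proof.
move=> [_ hD] [s v] av; have [|dv Dv] := hD s (label_l R v) (label_m1 R v) (label_m2 R v) (label_j R v).
  by rewrite admissibleE.
split=> //; rewrite {}Dv; congr (_%:C%C *: _).
by rewrite /dirac_eigenvalue -[(degree _)%:R]/((degree (s, v))%:Z%:~R) degreeE// /label_l; field.
Qed.

Lemma spin_conjugation (R : realType) (H : completeNormedModType R[i])
    (ket : bool -> R -> R -> R -> R -> H) (J : H -> H) : real_structure ket J ->
  forall s v, adml v ->
    J (spin_ket ket (s, v)) = phase R v *: spin_ket ket (s, reflect_label v).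
Proof.
move=> [_ hJ] s v av; rewrite /spin_ket /= hJ ?admissibleE//.
have -> : 2 * label_l R v + 1 = (total v)%:~R by rewrite /label_l; field.
have -> : label_j R v + label_m1 R v = (n1 v)%:~R by rewrite /label_j /label_m1; field.
rewrite !intrKfloor -/(phase R v); congr (_ *: ket _ _ _ _ _).
- by rewrite /label_l total_reflect.
- by rewrite /label_m1 /n1 /k1 !reflectE /=; field.
- by rewrite /label_m2 /n2 /k2 !reflectE /=; field.
- by rewrite /label_j /n1 /k1 !reflectE /= addrC.
Qed.

Theorem proposition9p2 (R : realType) (q : R) (hq : 0 < q < 1)
    (H : completeNormedModType R[i])
    (ip : {dot H for (@Num.conj R[i])}) (hip : hilbert_norm ip)
    (ket : bool -> R -> R -> R -> R -> H) (hket : spinor_basis ket ip)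
    (pi : sphere q -> H -> H) (hpi : spinor_representation ket ip pi)
    (D : unbounded_operator H) (hD : dirac_operator ket ip D)
    (absD : unbounded_operator H) (habsD : is_absolute_value ip D absD)
    (J : H -> H) (hJ : real_structure ket J) (a b : sphere q) :
  OPminf absD (commutator (pi a) (fun v => J (pi b (J v)))) /\
  exists Da : H -> H,
    bounded_commutator D (pi a) Da /\
    OPminf absD (commutator Da (fun v => J (pi b (J v)))).
Proof.
have gb := spin_graded_basis hip hket.
have sD : self_adjoint ip D by case: hD.
have D_e := spin_dirac hD.
have E_e := abs_e gb sD habsD flip_signK (fun _ => erefl) (fun _ => erefl) D_e.
have sE : self_adjoint ip absD by case: habsD.
have pa := pdo_representation hq hip hket hpi a.
have pb := pdo_representation hq hip hket hpi b.
have [aJ _] := hJ.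
have pY := pdo_conj hq gb aJ (spin_conjugation hJ) upper_flip pb.
have [Da pDa bDa] := pdo_dirac hq gb sD D_e lower_upper pa.
split; first exact: (smoothing_OPminf gb sE E_e (pdo_commutator hq gb pa pY)).
exists Da; split=> //.
exact: (smoothing_OPminf gb sE E_e (pdo_commutator hq gb pDa pY)).
Qed.
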